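(* Let $G=(V,A)$ be a directed graph with $n=|V|$, $m=|A|$, let $c:A\to\mathbb{R}^+$ be a positive weight function and $b:\mathcal{P}(V)\to\mathbb{Z}$ a submodular function. The minimum weighted spread $\sigma^*$ of a submodular flow, along with sets $X,Y\subseteq V$ attaining the maximum in the dual formula for $\sigma^*$ given in the context, can be computed by solving $$\mathcal{O}\left(n^4m^6\log^6(m)\cdot\left(n^2+m\log^2(m)\right)\right)$$ submodular function minimization problems.
   Context: $G=(V,A)$ is a finite directed graph and $\mathcal{P}(V)$ is the power set of $V$. The function $b$ (given by a value oracle) is submodular if $b(X)+b(Y)\ge b(X\cup Y)+b(X\cap Y)$ for all $X,Y\subseteq V$. For $x\in\mathbb{R}^A$ and $X\subseteq V$, $\varrho_x(X)$ and $\delta_x(X)$ denote the sum of $x(e)$ over the edges $e$ entering, resp. leaving, $X$, and $\partial_x(X):=\varrho_x(X)-\delta_x(X)$. Put $\tilde c(e):=1/c(e)$. A submodular flow is a vector $x\in\mathbb{R}^A$ with $\varrho_x(X)-\delta_x(X)\le b(X)$ for every $X\subseteq V$. The weighted spread of $x$ is $\sigma_c(x):=\max_{a\in A}c(a)x(a)-\min_{a\in A}c(a)x(a)$, and $\sigma^*$ is the minimum of $\sigma_c(x)$ over all submodular flows $x$. Dual formula: if some $X\subseteq V$ has $\partial_{\tilde c}(X)>0$, then $$\sigma^*=\max\left\{\frac{-b(X)\partial_{\tilde c}(Y)+b(Y)\partial_{\tilde c}(X)}{\delta_{\tilde c}(X)\partial_{\tilde c}(Y)-\delta_{\tilde c}(Y)\partial_{\tilde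 c}(X)} : \partial_{\tilde c}(X)\ge0,\ \partial_{\tilde c}(Y)<0,\ \varrho_{\tilde c}(X)+\delta_{\tilde c}(X)>0\right\}$$ or $\sigma^*=0$ if this maximum is negative; if $\partial_{\tilde c}(X)=0$ for all $X$, then $\sigma^*=\max\{-b(X)/\delta_{\tilde c}(X): b(X)<0\}$ (only a set $X$ is involved), or $\sigma^*=0$ if $b\ge0$. Maximizing sets are required when $\sigma^*$ equals the maximum in the formula. Standing assumptions: $G$ has no isolated vertex, and a submodular flow exists, i.e. $b(U)\ge0$ for every $U\subseteq V$ that no edge enters or leaves. *)

(* Defs.v *)
From HB Require Import structures.
From mathcomp Require Import all_boot all_order all_algebra.
From mathcomp Require Import boolp reals exp.
Set Implicit Arguments.
Unset Strict Implicit.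
Unset Printing Implicit Defensive.
Import Order.TTheory GRing.Theory Num.Theory.
Local Open Scope ring_scope.

(** * Submodular flows and weighted spread *)

Definition submodular (T : numDomainType) (V : finType) (f : {set V} -> T) : Prop :=
  forall X Y : {set V}, f (X :|: Y) + f (X :&: Y) <= f X + f Y.

(** A digraph on the vertex type [V] with edge type [A] is given by the tail and
    head of each edge; parallel edges and loops are allowed, and a loop neither
    enters nor leaves any set. *)
Section Digraph.
Context (V A : finType) (tl hd : A -> V).

Definition no_isolated : Prop := forall v : V, exists e : A, tl e = v \/ hd e = v.

Context (R : realType).
Implicit Types (x c : A -> R) (X Y : {set V}).

Definition rho x X : R := \sum_(e | (tl e \notin X) && (hd e \in X)) x e.
Definition delta x X : R := \sum_(e | (tl e \in X) && (hd e \notin X)) x e.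
Definition bd x X : R := rho x X - delta x X.

Definition submodular_flow (b : {set V} -> int) x : Prop :=
  forall X, bd x X <= (b X)%:~R.

(** Maximum and minimum over the edges; the value 0 is used only if [A] is empty. *)
Definition max_edge (f : A -> R) : R :=
  if [pick a : A] is Some a0 then \big[Num.max/f a0]_(a : A) f a else 0.
Definition min_edge (f : A -> R) : R :=
  if [pick a : A] is Some a0 then \big[Num.min/f a0]_(a : A) f a else 0.

Definition spread c x : R :=
  max_edge (fun a => c a * x a) - min_edge (fun a => c a * x a).

Definition is_min_spread c (b : {set V} -> int) (s : R) : Prop :=
  (exists2 x, submodular_flow b x & spread c x = s) /\
  (forall x, submodular_flow b x -> s <= spread c x).

Definition cinv c : A -> R := fun e => (c e)^-1.

Definition dual_pair c X Y : Prop :=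
  [/\ 0 <= bd (cinv c) X, bd (cinv c) Y < 0
    & 0 < rho (cinv c) X + delta (cinv c) X].

Definition dual_value c (b : {set V} -> int) X Y : R :=
  (- (b X)%:~R * bd (cinv c) Y + (b Y)%:~R * bd (cinv c) X) /
  (delta (cinv c) X * bd (cinv c) Y - delta (cinv c) Y * bd (cinv c) X).

Definition dual_value1 c (b : {set V} -> int) X : R :=
  - (b X)%:~R / delta (cinv c) X.

(** [X], [Y] certify the value [s] in the dual formula: they attain the maximum
    and [s] equals it, except that no condition is put on them when the formula
    gives [s = 0] because the maximum is negative (resp. because [b >= 0]). *)
Definition dual_certificate c (b : {set V} -> int) (s : R) X Y : Prop :=
  ((exists U, 0 < bd (cinv c) U) ->
     [/\ dual_pair c X Y, s = dual_value c b X Y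
       & forall X' Y', dual_pair c X' Y' ->
           dual_value c b X' Y' <= dual_value c b X Y]
     \/
     (s = 0 /\ forall X' Y', dual_pair c X' Y' -> dual_value c b X' Y' < 0))
  /\
  ((forall U, bd (cinv c) U = 0) ->
     [/\ b X < 0, s = dual_value1 c b X
       & forall X', b X' < 0 -> dual_value1 c b X' <= dual_value1 c b X]
     \/
     (s = 0 /\ forall X', 0 <= b X')).

End Digraph.

(** * Algorithms

    A real-RAM: unbounded arrays of naturals, of reals and of vertex sets with
    indirect addressing, and structured control.  Reals can only be combined by
    field operations and compared; naturals have no multiplication, so that their
    bit length is bounded by the running time.  A program is a finite
    syntactic object, which does not depend on the input. *)

Inductive nexp : Type :=
  | NConst of nat
  | NVerts                    (* number of vertices *)
  | NEdges                    (* number of edges *)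
  | NTail of nexp | NHead of nexp
  | NLoad of nexp
  | NAdd of nexp & nexp
  | NSub of nexp & nexp.      (* truncated *)

Inductive rexp : Type :=
  | RConst of nat
  | RWeight of nexp
  | RLoad of nexp
  | RAdd of rexp & rexp
  | RSub of rexp & rexp
  | RMul of rexp & rexp
  | RDiv of rexp & rexp.

Inductive sexp : Type :=
  | SEmpty
  | SLoad of nexp
  | SInsert of nexp & sexp
  | SRemove of nexp & sexp.

Inductive bexp : Type :=
  | BLeN of nexp & nexp
  | BLeR of rexp & rexp
  | BMem of nexp & sexp
  | BNot of bexp
  | BAnd of bexp & bexp.

(** Commands over a type [J] of additional primitive instructions. *)
Inductive cmd (J : Type) : Type :=
  | Skip
  | SetN of nexp & nexp       (* SetN a e stores the value of e at address a *)
  | SetR of nexp & rexp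
  | SetS of nexp & sexp
  | Query of nexp & sexp      (* Query a Z stores b(Z) at real address a *)
  | Prim of J
  | Seq of cmd J & cmd J
  | If of bexp & cmd J & cmd J
  | While of bexp & cmd J.
Arguments Skip {J}.
Arguments SetN {J}.
Arguments SetR {J}.
Arguments SetS {J}.
Arguments Query {J}.

(** [Minimize arg body val] is the problem of minimizing over all vertex sets [X]
    the function whose value at [X] is the real found at address [val] after
    storing [X] at set address [arg] and running [body].  The minimizer found is
    stored at [arg].  As [body] is of type [cmd void], minimizations do not nest. *)
Inductive minimization : Type := Minimize of nexp & cmd void & nexp.

Definition program : Type := cmd minimization.

(** A memory together with the counts of elementary steps, of evaluations of [b]
    and of submodular function minimizations made so far. *)
Record state (R : realType) (n : nat) : Type := State {
  nmem : nat -> nat;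
  rmem : nat -> R;
  smem : nat -> {set 'I_n};
  steps : nat;
  queries : nat;
  minims : nat }.

Definition init_state (R : realType) (n : nat) : state R n :=
  State (fun=> 0%N) (fun=> 0) (fun=> set0) 0 0 0.

Definition upd (T : Type) (f : nat -> T) (a : nat) (v : T) : nat -> T :=
  fun k => if k == a then v else f k.

(** The [k]-th minimization of a run may be answered by any minimizer; nothing is
    known of the answer when the function is not submodular. *)
Definition sfm_solver (R : realType) (V : finType)
    (M : nat -> ({set V} -> R) -> {set V}) : Prop :=
  forall k f, submodular f -> forall Z, f (M k f) <= f Z.

Section Semantics.
Context (R : realType) (n m : nat) (tl hd : 'I_m -> 'I_n) (c : 'I_m -> R)
  (b : {set 'I_n} -> int) (M : nat -> ({set 'I_n} -> R) -> {set 'I_n}).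
Implicit Types st : state R n.

Fixpoint neval st (e : nexp) : nat :=
  match e with
  | NConst k => k
  | NVerts => n
  | NEdges => m
  | NTail a => if insub (neval st a) is Some i then tl i : nat else 0%N
  | NHead a => if insub (neval st a) is Some i then hd i : nat else 0%N
  | NLoad a => nmem st (neval st a)
  | NAdd e1 e2 => (neval st e1 + neval st e2)%N
  | NSub e1 e2 => (neval st e1 - neval st e2)%N
  end.

Fixpoint reval st (e : rexp) : R :=
  match e with
  | RConst k => k%:R
  | RWeight a => if insub (neval st a) is Some i then c i else 0
  | RLoad a => rmem st (neval st a)
  | RAdd e1 e2 => reval st e1 + reval st e2
  | RSub e1 e2 => reval st e1 - reval st e2
  | RMul e1 e2 => reval st e1 * reval st e2
  | RDiv e1 e2 => reval st e1 / reval st e2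
  end.

Fixpoint seval st (e : sexp) : {set 'I_n} :=
  match e with
  | SEmpty => set0
  | SLoad a => smem st (neval st a)
  | SInsert a e1 => if insub (neval st a) is Some v then v |: seval st e1
                    else seval st e1
  | SRemove a e1 => if insub (neval st a) is Some v then seval st e1 :\ v
                    else seval st e1
  end.

Fixpoint beval st (e : bexp) : bool :=
  match e with
  | BLeN e1 e2 => (neval st e1 <= neval st e2)%N
  | BLeR e1 e2 => reval st e1 <= reval st e2
  | BMem a e1 => if insub (neval st a) is Some v then v \in seval st e1 else false
  | BNot e1 => ~~ beval st e1
  | BAnd e1 e2 => beval st e1 && beval st e2
  end.

Definition tick st : state R n :=
  State (nmem st) (rmem st) (smem st) (steps st).+1 (queries st) (minims st).
Definition store_n st a v : state R n :=
  State (upd (nmem st) a v) (rmem st) (smem st) (steps st) (queries st) (minims st).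
Definition store_r st a v : state R n :=
  State (nmem st) (upd (rmem st) a v) (smem st) (steps st) (queries st) (minims st).
Definition store_s st a v : state R n :=
  State (nmem st) (rmem st) (upd (smem st) a v) (steps st) (queries st) (minims st).
Definition count_query st : state R n :=
  State (nmem st) (rmem st) (smem st) (steps st) (queries st).+1 (minims st).

(** [exec prim p st st'] : running [p] from [st] terminates in [st']. *)
Inductive exec (J : Type) (prim : J -> state R n -> state R n -> Prop) :
    cmd J -> state R n -> state R n -> Prop :=
  | ExecSkip st : exec prim Skip st (tick st)
  | ExecSetN a e st :
      exec prim (SetN a e) st (tick (store_n st (neval st a) (neval st e)))
  | ExecSetR a e st :
      exec prim (SetR a e) st (tick (store_r st (neval st a) (reval st e)))
  | ExecSetS a e st :
      exec prim (SetS a e) st (tick (store_s st (neval st a) (seval st e)))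
  | ExecQuery a e st :
      exec prim (Query a e) st
        (tick (count_query (store_r st (neval st a) (b (seval st e))%:~R)))
  | ExecPrim j st st' : prim j st st' -> exec prim (Prim j) st (tick st')
  | ExecSeq p q st st1 st2 :
      exec prim p st st1 -> exec prim q st1 st2 -> exec prim (Seq p q) st st2
  | ExecIfTrue t p q st st' :
      beval st t -> exec prim p (tick st) st' -> exec prim (If t p q) st st'
  | ExecIfFalse t p q st st' :
      ~~ beval st t -> exec prim q (tick st) st' -> exec prim (If t p q) st st'
  | ExecWhileFalse t p st :
      ~~ beval st t -> exec prim (While t p) st (tick st)
  | ExecWhileTrue t p st st1 st2 :
      beval st t -> exec prim p (tick st) st1 ->
      exec prim (While t p) st1 st2 -> exec prim (While t p) st st2.

Definition no_prim (j : void) (st st' : state R n) : Prop := False.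

(** [ev X] is the final state of the evaluation of the objective at [X].  Since all
    these evaluations start from the counts of [st], taking the maximum of the
    final counts charges the minimization with the time and the number of
    evaluations of [b] that one evaluation of the objective takes at worst. *)
Inductive minimize : minimization -> state R n -> state R n -> Prop :=
  | MinimizeRun arg body val st (ev : {set 'I_n} -> state R n) :
      (forall X, exec no_prim body (store_s st (neval st arg) X) (ev X)) ->
      minimize (Minimize arg body val) st
        (State (nmem st) (rmem st)
           (upd (smem st) (neval st arg)
              (M (minims st) (fun X => rmem (ev X) (neval st val))))
           (\max_(X : {set 'I_n}) steps (ev X))
           (\max_(X : {set 'I_n}) queries (ev X))
           (minims st).+1).

Definition run (P : program) : state R n -> state R n -> Prop := exec minimize P.

Lemma exec_deterministic (J : Type) (prim : J -> state R n -> state R n -> Prop) :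
  (forall j st st1 st2, prim j st st1 -> prim j st st2 -> st1 = st2) ->
  forall p st st1 st2, exec prim p st st1 -> exec prim p st st2 -> st1 = st2.
Proof.
move=> prim_det p st st1 st2 H; elim: H st2 => {p st st1}.
all: try by move=> *; match goal with H : exec _ _ _ _ |- _ => inversion H; subst end.
- by move=> j st st' pj st2 H; inversion H; subst; congr tick; apply: prim_det pj _.
- move=> p q st st1 st2 _ IH1 _ IH2 st3 H; inversion H as [| | | | | |? ? ? ? ? Hp Hq| | | |]; subst.
  by apply: IH2; rewrite (IH1 _ Hp).
- move=> t p q st st' Ht _ IH st2 H.
  inversion H as [| | | | | | |? ? ? ? ? Ht' Hp|? ? ? ? ? Ht' Hq| |]; subst; first exact: IH.
  by rewrite Ht in Ht'.
- move=> t p q st st' Ht _ IH st2 H.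
  inversion H as [| | | | | | |? ? ? ? ? Ht' Hp|? ? ? ? ? Ht' Hq| |]; subst; last exact: IH.
  by rewrite Ht' in Ht.
- move=> t p st Ht st2 H.
  inversion H as [| | | | | | | | |? ? ? Ht'|? ? ? ? ? Ht' Hp Hw]; subst => //.
  by rewrite Ht' in Ht.
- move=> t p st st1 st2 Ht _ IH1 _ IH2 st3 H.
  inversion H as [| | | | | | | | |? ? ? Ht'|? ? ? ? ? Ht' Hp Hw]; subst.
    by rewrite Ht in Ht'.
  by apply: IH2; rewrite (IH1 _ Hp).
Qed.

Lemma run_deterministic (P : program) st st1 st2 :
  run P st st1 -> run P st st2 -> st1 = st2.
Proof.
apply: exec_deterministic => j {}st {}st1 {}st2 H1 H2.
inversion H1 as [arg body val st' ev Hev E1 E2 E3]; subst.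
inversion H2 as [arg' body' val' st' ev' Hev' E1 E2 E3]; subst.
suff -> : ev = ev' by [].
by apply: funext => X; apply: exec_deterministic (Hev X) (Hev' X).
Qed.

End Semantics.

Definition sfm_bound (R : realType) (n m : nat) : R :=
  n%:R ^+ 4 * m%:R ^+ 6 * ln m%:R ^+ 6 * (n%:R ^+ 2 + m%:R * ln m%:R ^+ 2).

(* Main.v *)
Require Import Defs.
From mathcomp Require Import all_boot all_order all_algebra.
From mathcomp Require Import reals exp.
From mathcomp Require Import boolp zify ring lra.
Set Implicit Arguments.
Unset Strict Implicit.
Unset Printing Implicit Defensive.
Import Order.TTheory GRing.Theory Num.Theory.
Local Open Scope ring_scope.

(** Let a(X) be the net and d(X) the total weight 1/c of the edges entering,
    resp. crossing, X.  A flow with y - t <= c x <= y + t on every edge exists iff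
    F(X) = b(X) - y a(X) + t d(X) is nonnegative (fix the edges one at a time), so
    the minimum spread is 2 min T(y), where T(y) is the maximum of 0 and of the lines
    (y a(X) - b(X)) / d(X).  For t >= 0 the function F is submodular.

    One value T(y) is computed by Newton's method, each step being one
    minimization of F.  The convex function T is minimized by intersecting a
    tangent of positive slope with one of negative slope, and replacing one of them
    by the tangent at the intersection.  If T vanishes somewhere, the zero set
    of T is an interval, whose ends Newton's method finds; when the interval is
    nondegenerate, the sets X with d(X) > 0 are tested for F(X) = 0 at its midpoint,
    by minimizing over the sets separating the ends of each edge.

    All the iterations are bounded by two facts.  First, if f >= 0 is submodular and
    its values at X_1, X_2, ... drop by factors of at least n^2, then there are at
    most n^2 of these sets, since each X_i separates a pair of vertices that no later
    one separates.  Second, slopes and weights come in few scales: d(X) is within a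
    factor m of its heaviest crossing edge, and a sequence a(X_1), a(X_2), ... dropping
    by factors above 2 has distinct subset sums, which are determined by the
    multiplicities of the n vertices, so that its length is O(n log n).  In Newton's
    method either the defect or the slope halves.  In the minimization of T, runs of
    replacements on one side are instances of Newton's method, and each change of
    side halves the distance of the lower bound given by the intersections. *)

(** * Rings of sets *)

(** The weights are arbitrary reals, so neither bisection nor bit lengths bound the iterations;
    every count has to be read off the set system. This works because each step exhibits a
    nonnegative submodular function, F at a feasible point or F shifted by its minimum, whose values
    at the earlier sets are known up to bounded factors. These factors are ratios of slopes and of
    cut weights, at most kappa = 2m within one class of scales. Thinning the indices to distances
    above r, where 2^r >= 2 kappa^4 n^2, turns halvings into drops by n^2. Submodularity of F is
    secured for t >= 0. Hence a negative intersection height is lifted to 0 before minimizing, the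
    zero set of T is searched along t = 0, and the search by tangents starts only once T is known to
    be positive everywhere, so that a lifted point is never feasible. The certificate is a pair of
    sets tight at one feasible point: one of positive and one of negative net, or a single crossing
    set of net 0 together with any set of negative net. *)

Section Ring.
Context (R : realFieldType) (V : finType).
Implicit Types (f : {set V} -> R) (A B X Y : {set V}).

Definition trivial_set X := (X == set0) || (X == setT).

Section Subadditive.
Variable f : {set V} -> R.
Hypotheses (f_sub : submodular f) (f_ge0 : forall X, 0 <= f X).

(** Zeroing the two trivial sets makes [f0] subadditive under unions and intersections alike, so a
    union that grows to [setT] or an intersection that shrinks to [set0] costs nothing. *)
Let f0 X := if trivial_set X then 0 else f X.

Let f0_ge0 X : 0 <= f0 X.
Proof. by rewrite /f0; case: ifP. Qed.

Let f0_cases X : [\/ X = set0, X = setT | f0 X = f X].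
Proof.
rewrite /f0 /trivial_set; case: eqP => [->|_]; first by constructor.
by case: eqP => [->|_]; [constructor 2|constructor 3].
Qed.

Let f0_le X : f0 X <= f X.
Proof. by rewrite /f0; case: ifP. Qed.

Let f0T : f0 setT = 0.
Proof. by rewrite /f0 /trivial_set eqxx orbT. Qed.

Let f00 : f0 set0 = 0.
Proof. by rewrite /f0 /trivial_set eqxx. Qed.

Let f0U X Y : f0 (X :|: Y) <= f0 X + f0 Y.
Proof.
case: (f0_cases X) => [->|->|EX]; first by rewrite set0U f00 add0r.
  by rewrite setTU f0T add0r.
case: (f0_cases Y) => [->|->|EY]; first by rewrite setU0 f00 addr0.
  by rewrite setUT f0T addr0.
rewrite EX EY; apply: le_trans (f0_le _) _.
by apply: le_trans (f_sub X Y); rewrite lerDl.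
Qed.

Let f0I X Y : f0 (X :&: Y) <= f0 X + f0 Y.
Proof.
case: (f0_cases X) => [->|->|EX]; first by rewrite set0I f00 add0r.
  by rewrite setTI f0T add0r.
case: (f0_cases Y) => [->|->|EY]; first by rewrite setI0 f00 addr0.
  by rewrite setIT f0T addr0.
rewrite EX EY; apply: le_trans (f0_le _) _.
by apply: le_trans (f_sub X Y); rewrite lerDr.
Qed.

(** [X] is the union over [u] in [X] of the intersections over [v] outside [X] of the sets [S u v].
    Hence [f X] is at most a sum of fewer than [#|V| ^ 2] values [f (S u v)]. *)
Lemma submodular_separators X (S : V -> V -> {set V}) c :
    ~~ trivial_set X -> 0 < f X ->
    (forall u v, u \in X -> v \notin X ->
       [/\ u \in S u v, v \notin S u v & c * f (S u v) <= f X]) ->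
  c < #|V|%:R ^+ 2.
Proof.
move=> ntX fX0 HS; rewrite ltNge; apply/negP => c_ge.
have defX : X = \bigcup_(u in X) \bigcap_(v in ~: X) S u v.
  apply/setP => w; apply/idP/bigcupP => [wX|[u uX /bigcapP Hw]].
    exists w => //; apply/bigcapP => v; rewrite inE => vX.
    by have [] := HS _ _ wX vX.
  apply/negPn/negP => wX; have [_ /negP[]] := HS _ _ uX wX.
  by apply: Hw; rewrite inE.
have f0X : f0 X = f X by rewrite /f0 (negPf ntX).
have le1 : f X <= \sum_(u in X) \sum_(v in ~: X) f (S u v).
  rewrite -f0X {1}defX.
  apply: (@le_trans _ _ (\sum_(u in X) f0 (\bigcap_(v in ~: X) S u v))).
    elim/big_rec2: _ => [|u x A _ IH]; first by rewrite f00.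
    by apply: le_trans (f0U _ _) _; rewrite lerD2l.
  apply: ler_sum => u _.
  apply: (@le_trans _ _ (\sum_(v in ~: X) f0 (S u v))); last exact: ler_sum.
  elim/big_rec2: _ => [|v x A _ IH]; first by rewrite f0T.
  by apply: le_trans (f0I _ _) _; rewrite lerD2l.
have le2 : c * f X <= \sum_(u in X) \sum_(v in ~: X) f X.
  have V0 : (0 : R) <= #|V|%:R ^+ 2 by apply: exprn_ge0.
  apply: (@le_trans _ _ (c * \sum_(u in X) \sum_(v in ~: X) f (S u v))).
    by apply: ler_wpM2l le1; apply: le_trans c_ge.
  rewrite mulr_sumr; apply: ler_sum => u uX; rewrite mulr_sumr.
  apply: ler_sum => v; rewrite inE => vX; by have [] := HS _ _ uX vX.
have : c * f X < c * f X.
  apply: le_lt_trans le2 _; rewrite sumr_const sumr_const -mulrnA mulrC.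
  rewrite -[X in X *+ _]mulr1 -mulrnAr ltr_pM2l //; apply: lt_le_trans c_ge.
  rewrite -natrX ltr_nat.
  have [X0 XT] : (0 < #|X|)%N /\ (#|X| < #|V|)%N.
    move: ntX; rewrite /trivial_set negb_or card_gt0 => /andP[-> XT]; split=> //.
    by rewrite -cardsT; apply: proper_card; rewrite properT.
  have := cardsC X; rewrite -mulnn; nia.
by rewrite ltxx.
Qed.

(** If every pair separated by [X i] were separated by some later [X j], these later sets would be
    separators of [X i] with [c = #|V|%:R ^+ 2], which [submodular_separators] excludes. So each [i]
    owns a pair missed by all later sets, and these pairs are distinct. *)
Lemma ring_bound N (I : {set 'I_N}) (X : nat -> {set V}) :
    (forall i, i \in I -> ~~ trivial_set (X i) /\ 0 < f (X i)) ->
    (forall i j : 'I_N, i \in I -> j \in I -> (i < j)%N ->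
       #|V|%:R ^+ 2 * f (X j) <= f (X i)) ->
  (#|I| <= #|V| ^ 2)%N.
Proof.
move=> HX Hgrow.
have sepP (i : 'I_N) : i \in I -> exists uv : V * V,
    [/\ uv.1 \in X i, uv.2 \notin X i & forall j : 'I_N, j \in I -> (i < j)%N ->
         ~~ ((uv.1 \in X j) && (uv.2 \notin X j))].
  move=> iI; apply: contrapT => /forallNP nosep.
  have Hj u v : u \in X i -> v \notin X i -> exists j : 'I_N,
      [/\ j \in I, (i < j)%N, u \in X j & v \notin X j].
    move=> uX vX; apply: contrapT => /forallNP noj; apply: (nosep (u, v)).
    split=> // j jI ij; apply/negP => /andP[/= uj vj]; by apply: (noj j).
  have : exists S : V -> V -> {set V}, forall u v, u \in X i -> v \notin X i ->
      [/\ u \in S u v, v \notin S u v & #|V|%:R ^+ 2 * f (S u v) <= f (X i)].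
    have /choice[S HS] : forall uv : V * V, exists S : {set V},
        uv.1 \in X i -> uv.2 \notin X i ->
        [/\ uv.1 \in S, uv.2 \notin S & #|V|%:R ^+ 2 * f S <= f (X i)].
      move=> [u v] /=; case: (boolP ((u \in X i) && (v \notin X i))).
        move=> /andP[uX vX]; have [j [jI ij uj vj]] := Hj _ _ uX vX.
        by exists (X j) => _ _; split=> //; apply: Hgrow.
      by move=> /negP H; exists set0 => uX vX; case: H; rewrite uX vX.
    by exists (fun u v => S (u, v)) => u v; apply: (HS (u, v)).
  case=> S HS; have [ntX fX] := HX _ iI.
  by have := submodular_separators ntX fX HS; rewrite ltxx.
have [->|[i0 i0I]] := set_0Vmem I; first by rewrite cards0.
have [sep0 _] := sepP _ i0I.
have /choice[sep Hsep] : forall i : 'I_N, exists uv : V * V, i \in I ->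
    [/\ uv.1 \in X i, uv.2 \notin X i & forall j : 'I_N, j \in I -> (i < j)%N ->
         ~~ ((uv.1 \in X j) && (uv.2 \notin X j))].
  move=> i; case: (boolP (i \in I)) => [iI|iI]; last by exists sep0.
  by have [uv H] := sepP _ iI; exists uv.
have inj : {in I &, injective sep}.
  suff lt_neq (i j : 'I_N) : i \in I -> j \in I -> (i < j)%N -> sep i <> sep j.
    move=> i j iI jI Eij; apply/val_inj => /=.
    case: (ltngtP i j) => // lt; first by case: (lt_neq _ _ iI jI lt).
    by case: (lt_neq _ _ jI iI lt); rewrite Eij.
  move=> iI jI ij E; have [_ _ /(_ _ jI ij)] := Hsep _ iI.
  by have [uj vj _] := Hsep _ jI; rewrite E uj vj.
rewrite -mulnn -card_prod -(card_in_imset inj).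
exact: max_card.
Qed.

End Subadditive.
End Ring.

Lemma coloring_bound (C : finType) N (col : nat -> C) q :
    (forall c, #|[set i : 'I_N | col i == c]| <= q)%N -> (N <= #|C| * q)%N.
Proof.
move=> Hq; rewrite -[N in (N <= _)%N]card_ord -sum1_card.
rewrite (partition_big (fun i : 'I_N => col i) predT) //=.
rewrite -sum_nat_const; apply: leq_sum => c _.
by rewrite sum1dep_card.
Qed.

(** * Scales of a modular function *)

Section Scale.
Context (R : realFieldType) (V : finType) (w : V -> R).

Let a (X : {set V}) := \sum_(v in X) w v.

Lemma halving_tail (x : nat -> R) N :
    (forall i, (i < N)%N -> 0 < x i) ->
    (forall i, (i.+1 < N)%N -> 2 * x i.+1 < x i) ->
  forall i, (i < N)%N -> \sum_(i.+1 <= j < N) x j < x i.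
Proof.
move=> x0 xS i iN; have [k] := ubnP (N - i); elim: k i iN => // k IH i iN Hk.
case: (ltnP i.+1 N) => [iN1|Ni]; last by rewrite big_geq // x0.
rewrite big_ltn //; apply: lt_trans (xS _ iN1).
have := IH i.+1 iN1; move: (xS _ iN1) => ?; have -> : (N - i.+1 < k)%N by lia.
move=> /(_ isT); lra.
Qed.

(* Distinct index sets of a halving sequence have distinct sums of values, and
   such a sum only depends on the multiplicities with which the vertices occur. *)
Lemma halving_length (X : nat -> {set V}) N :
    (forall i, (i < N)%N -> 0 < a (X i)) ->
    (forall i, (i.+1 < N)%N -> 2 * a (X i.+1) < a (X i)) ->
  (2 ^ N <= N.+1 ^ #|V|)%N.
Proof.
move=> a0 aS; have tail := halving_tail a0 aS.
pose mult (I : {set 'I_N}) v := #|[set i : 'I_N in I | v \in X i]|.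
pose cnt (I : {set 'I_N}) : {ffun V -> 'I_N.+1} := [ffun v => inord (mult I v)].
have multE I v : cnt I v = mult I v :> nat.
  by rewrite ffunE inordK // ltnS -[X in (_ <= X)%N]card_ord max_card.
have sumE (I : {set 'I_N}) : \sum_(i : 'I_N | i \in I) a (X i) = \sum_v w v *+ mult I v.
  rewrite /a (exchange_big_dep predT) //=; apply: eq_bigr => v _.
  by rewrite sumr_const /mult cardsE.
(* The first index at which the two index sets differ decides: by [tail] its term outweighs all
   later terms together. *)
have lt_sum (I J : {set 'I_N}) (i0 : 'I_N) : i0 \in I -> i0 \notin J ->
    (forall i : 'I_N, (i < i0)%N -> (i \in I) = (i \in J)) ->
    \sum_(i : 'I_N | i \in J) a (X i) < \sum_(i : 'I_N | i \in I) a (X i).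
  move=> i0I i0J Hlt.
  rewrite (bigID (fun i : 'I_N => i < i0)%N) /=.
  rewrite [X in _ < X](bigID (fun i : 'I_N => i < i0)%N) /=.
  have -> : \sum_(i : 'I_N | (i \in I) && (i < i0)%N) a (X i) = \sum_(i : 'I_N | (i \in J) && (i < i0)%N) a (X i).
    apply: eq_bigl => i; case: (ltnP i i0) => [/Hlt ->|]; by rewrite ?andbF.
  rewrite ltrD2l; apply: (@le_lt_trans _ _ (\sum_(i0.+1 <= j < N) a (X j))); last first.
    apply: lt_le_trans (tail _ (ltn_ord i0)) _.
    rewrite (bigD1 i0) /= ?i0I ?ltnn // lerDl.
    by apply: sumr_ge0 => i _; apply/ltW/a0.
  rewrite (big_nat_widenl _ 0) // big_mkord.
  rewrite [X in _ <= X](bigID (mem J)) /= -[X in X <= _]addr0; apply: lerD; last first.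
    by apply: sumr_ge0 => i _; apply/ltW/a0.
  rewrite le_eqVlt; apply/orP; left; apply/eqP; apply: eq_bigl => i.
  rewrite andbC; case: (boolP (i \in J)) => [iJ|]; rewrite ?andbF // !andbT -leqNgt.
  rewrite leq_eqVlt; case: eqP => //= /val_inj E.
  by rewrite E iJ in i0J.
have inj : injective cnt.
  move=> I J E; apply/eqP/negPn/negP => neq.
  have [k Hk] : exists k : 'I_N, (k \in I) != (k \in J).
    apply: contrapT => /forallNP H; case/negP: neq; apply/eqP/setP => i.
    by apply/eqP/negPn/negP/H.
  case: (@arg_minnP _ k (fun k => (k \in I) != (k \in J)) (fun k => k : nat) Hk).
  move=> i0 Hi0 Hmin.
  have Hlt (i : 'I_N) : (i < i0)%N -> (i \in I) = (i \in J).
    by move=> lt; apply/eqP/negPn/negP => /Hmin; rewrite leqNgt lt.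
  have Esum : \sum_(i : 'I_N | i \in I) a (X i) = \sum_(i : 'I_N | i \in J) a (X i).
    by rewrite !sumE; apply: eq_bigr => v _; rewrite -!multE E.
  case: (boolP (i0 \in I)) Hi0 => [iI|iI] Hi0.
    have iJ : i0 \notin J by move: Hi0; case: (i0 \in J).
    by have := lt_sum _ _ _ iI iJ Hlt; rewrite Esum ltxx.
  have iJ : i0 \in J by move: Hi0; case: (i0 \in J).
  have Hlt' (i : 'I_N) : (i < i0)%N -> (i \in J) = (i \in I) by move=> /Hlt.
  by have := lt_sum _ _ _ iJ iI Hlt'; rewrite Esum ltxx.
have := leq_card _ inj; rewrite card_ffun card_ord.
suff -> : #|{set 'I_N}| = (2 ^ N)%N by [].
by rewrite -cardsT -powersetT card_powerset cardsT card_ord.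
Qed.

Let halv X Y := 2 * a Y < a X.
Let chain s := sorted halv s && all (fun X => 0 < a X) s.

(* The class of [X] is the length of the longest halving chain below [X]. *)
Lemma scale_classes S : (S.+2 ^ #|V| < 2 ^ S.+1)%N ->
  exists cl : {set V} -> 'I_S.+1, forall X Y, 0 < a X -> 0 < a Y ->
    cl X = cl Y -> a X <= 2 * a Y.
Proof.
move=> HS.
have size_chain s : chain s -> (size s <= S)%N.
  case/andP=> srt pos; rewrite leqNgt; apply/negP => Ss.
  have := @halving_length (nth set0 s) S.+1; rewrite leqNgt HS => H.
  suff // : false by []; apply: H => i iS.
    by move/allP: pos; apply; rewrite mem_nth // (leq_trans iS).
  exact: (sortedP set0 srt) (leq_trans iS Ss).
pose P X (k : 'I_S.+1) := [exists t : k.-tuple {set V}, chain (X :: t)].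
pose rank X : nat := \max_(k < S.+1 | P X k) k.
have rankS X : (rank X < S.+1)%N.
  by rewrite ltnS; apply/bigmax_leqP => k _; rewrite -ltnS.
exists (fun X => inord (rank X)) => X Y X0 Y0 /(congr1 val) /=.
rewrite !inordK // => E; rewrite leNgt; apply/negP => lt.
have P0 : P Y ord0.
  by apply/existsP; exists [tuple]; rewrite /chain /= Y0.
have [k Pk Ek] : exists2 k, P Y k & rank Y = k.
  have PY0 : (0 < #|P Y|)%N by apply/card_gt0P; exists ord0.
  by have [k Pk Ek] := @eq_bigmax_cond _ (P Y) (fun k => k : nat) PY0; exists k.
case/existsP: Pk => t Ht.
(* [X] can be put in front of a longest chain starting at [Y], so its rank would be larger than that
   of [Y]. *)
have HXt : chain [:: X, Y & t].
  move: Ht; rewrite /chain /= X0 => /andP[srt /andP[_ ->]].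
  by rewrite Y0 srt /halv lt.
have kS : (k.+1 < S.+1)%N.
  by have := size_chain _ HXt; rewrite /= size_tuple; lia.
have PX : P X (Ordinal kS) by apply/existsP; exists [tuple of Y :: t].
have : (Ordinal kS <= rank X)%N by exact: (@leq_bigmax_cond _ (P X) (fun k => k : nat)).
by rewrite /= E Ek ltnn.
Qed.
End Scale.

(** * Lengths of geometrically decreasing sequences *)

Section Sequences.
Context (R : realFieldType).

Lemma half_decay (x : nat -> R) N :
    (forall i, (i.+1 < N)%N -> 2 * x i.+1 <= x i) ->
  forall i j, (i <= j < N)%N -> 2 ^+ (j - i) * x j <= x i.
Proof.
move=> xS i j; elim: j => [|j IH] /andP[]; first by rewrite leqn0 => /eqP -> _; rewrite mul1r.
rewrite leq_eqVlt => /orP[/eqP <- _|]; first by rewrite subnn mul1r.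
rewrite ltnS => ij jN; have := IH; rewrite ij ltnW // => /(_ isT); apply: le_trans.
by rewrite subSn // exprSr -mulrA ler_wpM2l ?exprn_ge0 // xS.
Qed.

Lemma nonincr_seq (x : nat -> R) N :
    (forall i, (i.+1 < N)%N -> x i.+1 <= x i) ->
  forall i j, (i <= j < N)%N -> x j <= x i.
Proof.
move=> xS i j; elim: j => [|j IH] /andP[]; first by rewrite leqn0 => /eqP ->.
rewrite leq_eqVlt => /orP[/eqP <- //|]; rewrite ltnS => ij jN.
by apply: le_trans (xS _ jN) _; apply: IH; rewrite ij ltnW.
Qed.

Lemma half_decay_sum (x : nat -> R) N :
    (forall i, (i.+1 < N)%N -> 2 * x i.+1 <= x i) ->
    (forall i, (i < N)%N -> 0 <= x i) ->
  forall i k, (i <= k < N)%N -> \sum_(i <= l < k.+1) x l <= 2 * x i.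
Proof.
move=> xS x0 i k; have [n] := ubnP (k - i); elim: n i => // n IH i Hn /andP[ik kN].
rewrite big_ltn ?ltnS //; move: ik; rewrite leq_eqVlt => /orP[/eqP E|ik].
  by rewrite E big_geq // addr0 ler_peMl ?x0 // ler1n.
have iN : (i.+1 < N)%N by apply: leq_ltn_trans kN.
have := IH i.+1; have -> : (k - i.+1 < n)%N by lia.
rewrite ik kN => /(_ isT isT); have := xS _ iN; lra.
Qed.

Definition visited (C : finType) (c : nat -> C) i : {set C} :=
  [set x | [exists j : 'I_i.+1, c j == x]].

Lemma visited_sub (C : finType) (c : nat -> C) i j :
  (i <= j)%N -> visited c i \subset visited c j.
Proof.
move=> ij; apply/subsetP => x; rewrite !inE => /existsP[k Hk].
by apply/existsP; exists (widen_ord (ij : (i < j.+1)%N) k).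
Qed.

(* Along a monotone sequence, indices with as many classes visited so far span
   no new class, so their values differ by a bounded factor. *)
Lemma visited_ratio (C : finType) (c : nat -> C) (x : nat -> R) N kappa i j :
    (forall i, (i.+1 < N)%N -> x i.+1 <= x i) ->
    (forall i j, (i < N)%N -> (j < N)%N -> c i = c j -> x i <= kappa * x j) ->
    (i <= j < N)%N -> #|visited c i| = #|visited c j| ->
  x i <= kappa * x j.
Proof.
move=> xS xc /andP[ij jN] E.
have : c j \in visited c i.
  rewrite (_ : visited c i = visited c j); last first.
    by apply/eqP; rewrite eqEcard visited_sub //= E.
  by rewrite inE; apply/existsP; exists ord_max.
rewrite inE => /existsP[k /eqP Ek].
have kN : (k < N)%N by apply: leq_ltn_trans jN; apply: leq_trans ij; rewrite -ltnS.
apply: le_trans (xc _ _ kN jN Ek); apply: (nonincr_seq xS).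
by rewrite -ltnS ltn_ord (leq_ltn_trans ij).
Qed.

End Sequences.

(** Colouring indices by their residue thins them out: between [i.+1] and a later index of the
    colour of [i] there are at least [r] halvings. *)
Lemma modn_gap i j r : (i < j)%N -> inord (i %% r.+1) = inord (j %% r.+1) :> 'I_r.+1 ->
  (i + r.+1 <= j)%N.
Proof.
move=> ij /(congr1 val) /=; rewrite !inordK ?ltn_mod // => E.
rewrite (divn_eq i r.+1) (divn_eq j r.+1) E in ij *.
rewrite ltn_add2r ltn_mul2r /= in ij.
by rewrite addnAC leq_add2r -mulSnr leq_mul2r ij orbT.
Qed.

Section Lengths.
Context (R : realFieldType) (V : finType).

(* Among iterations in one class and at mutual distances above [r], the values of
   [Phi] at the iterates drop by factors of at least [#|V|^2], as required in
   [ring_bound]. *)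
Lemma newton_length (C : finType) N r (kappa : R) (X : nat -> {set V})
    (e g al : nat -> R) (cl : nat -> C) :
    1 <= kappa -> 2 * kappa ^+ 4 * #|V|%:R ^+ 2 <= 2 ^+ r ->
    (forall i, (i < N)%N -> [/\ ~~ trivial_set (X i), 0 < e i, 0 < g i & 0 < al i]) ->
    (forall i, (i.+1 < N)%N -> e i.+1 * g i + g i.+1 * e i <= e i * g i) ->
    (forall i j, (i < N)%N -> (j < N)%N -> cl i = cl j ->
       g i <= kappa * g j /\ al i <= kappa * al j) ->
    (forall k, (k < N)%N -> exists Phi : {set V} -> R,
       [/\ submodular Phi, forall Y, 0 <= Phi Y
         & forall i, (i < k)%N -> al i * e i.+1 <= Phi (X i)
             /\ Phi (X i) <= al i * g i * \sum_(i <= l < k.+1) e l / g l]) ->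
  (N <= #|C| * r.+1 * (#|V| ^ 2).+1)%N.
Proof.
move=> k1 Hr Hpos Hratio Hcl HPhi.
have k0 : 0 < kappa by lra.
have gS i : (i.+1 < N)%N -> g i.+1 <= g i.
  move=> iN; have [_ ei gi _] := Hpos i (ltnW iN); have [_ ei' gi' _] := Hpos _ iN.
  rewrite -(ler_pM2r ei); apply: le_trans (_ : _ <= e i * g i) _; last by rewrite mulrC.
  by apply: le_trans (Hratio _ iN); rewrite lerDr mulr_ge0 // ltW.
(* The hypothesis reads [e' / e + g' / g <= 1]. By the inequality of arithmetic and geometric means
   the product [e * g] even drops to a quarter. *)
have egS i : (i.+1 < N)%N -> 2 * (e i.+1 * g i.+1) <= e i * g i.
  move=> iN; have [_ ei gi _] := Hpos i (ltnW iN); have [_ ei' gi' _] := Hpos _ iN.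
  have H := Hratio _ iN.
  have : 0 <= (e i.+1 * g i - g i.+1 * e i) ^+ 2 by apply: sqr_ge0.
  move=> H2; have H3 : 0 < e i * g i by apply: mulr_gt0.
  have H4 : 4 * (e i.+1 * g i.+1) * (e i * g i) <= (e i * g i) * (e i * g i).
    have H5 : (e i.+1 * g i + g i.+1 * e i) ^+ 2 <= (e i * g i) ^+ 2.
      by apply: lerXn2r => //; rewrite nnegrE ?addr_ge0 ?mulr_ge0 // ltW.
    nra.
  move: H4; rewrite ler_pM2r // => H4; apply: le_trans H4.
  have := mulr_gt0 ei' gi'; lra.
have eg0 i : (i < N)%N -> 0 <= e i * g i.
  by move=> /Hpos[_ ei gi _]; rewrite mulr_ge0 // ltW.
(* Writing [e l / g l] as [e l * g l / g l ^+ 2] and bounding [g l] below by [g k] leaves a sum of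
   halving products. Comparing [g i] with [g k] inside the class costs [kappa ^+ 2]. *)
have upper k i Phi : (i < k)%N -> (k < N)%N -> cl i = cl k ->
    Phi <= al i * g i * \sum_(i <= l < k.+1) e l / g l ->
    Phi <= 2 * kappa ^+ 2 * (al i * e i).
  move=> ik kN Ecl H; have iN := ltn_trans ik kN; apply: le_trans H _.
  have [_ ei gi ai] := Hpos _ iN; have [_ ek gk _] := Hpos _ kN.
  have -> : 2 * kappa ^+ 2 * (al i * e i) = al i * g i * (2 * kappa ^+ 2 * e i / g i).
    by field; rewrite gt_eqF.
  rewrite ler_pM2l ?mulr_gt0 //.
  apply: (@le_trans _ _ (\sum_(i <= l < k.+1) e l * g l / g k ^+ 2)).
    rewrite !big_nat; apply: ler_sum => l /andP[il lk].
    have lN : (l < N)%N by apply: leq_ltn_trans kN; rewrite -ltnS.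
    have [_ el gl _] := Hpos _ lN.
    have gkl : g k <= g l by apply: (nonincr_seq gS); rewrite -ltnS lk.
    rewrite -mulrA ler_pM2l // ler_pdivlMr ?exprn_gt0 // mulrC ler_pdivrMr //.
    by rewrite expr2; apply: ler_pM; rewrite // ltW.
  rewrite -mulr_suml ler_pdivrMr ?exprn_gt0 //.
  apply: le_trans (half_decay_sum egS eg0 (i:=i) (k:=k) _) _; first by rewrite ltnW.
  have [gik _] := Hcl _ _ iN kN Ecl.
  have -> : 2 * kappa ^+ 2 * e i / g i * g k ^+ 2 = 2 * (e i / g i * (kappa * g k) ^+ 2).
    by field; rewrite gt_eqF.
  rewrite ler_pM2l // -[X in X <= _](_ : e i / g i * g i ^+ 2 = _); last first.
    by field; rewrite gt_eqF.
  rewrite ler_pM2l ?divr_gt0 //; apply: lerXn2r => //; rewrite nnegrE ltW //.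
  by rewrite mulr_gt0.
have := @coloring_bound (C * 'I_r.+1)%type N (fun i => (cl i, inord (i %% r.+1)))
  (#|V| ^ 2).+1.
rewrite card_prod card_ord; apply=> -[c s].
set D := [set i : 'I_N | _].
have [->|[i0 i0D]] := set_0Vmem D; first by rewrite cards0.
(* The function [Phi] of the last index [k] of the colour serves all its other indices. Setting [k]
   aside accounts for the successor in [(#|V| ^ 2).+1]. *)
case: (@arg_maxnP _ i0 (mem D) (fun i => i : nat) i0D) => k kD kmax.
rewrite (cardsD1 k) [k \in D]kD add1n ltnS.
have [Phi [Psub P0 PX]] := HPhi k (ltn_ord k).
have inD i : i \in D :\ k -> [/\ (i < k)%N, cl i = c & inord (i %% r.+1) = s].
  rewrite !inE => /andP[ik /eqP[Ec Es]]; split=> //.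
  rewrite ltn_neqAle; apply/andP; split; first by apply: contraNneq ik => /val_inj ->.
  by apply: kmax; rewrite !inE Ec Es.
have kc : cl k = c by move: kD; rewrite !inE => /eqP[].
apply: (ring_bound Psub P0 (X:=X)).
  move=> i /inD[ik _ _]; have [ntX ei gi ai] := Hpos _ (ltn_ord i); split=> //.
  have [lo _] := PX _ ik; apply: lt_le_trans lo.
  have [_ ei' _ _] := Hpos i.+1 (leq_ltn_trans ik (ltn_ord k)).
  exact: mulr_gt0.
move=> i j /inD[ik ic is_] /inD[jk jc js] ij.
have gap : (i + r.+1 <= j)%N by apply: modn_gap => //; rewrite is_ js.
have [lo _] := PX _ ik; have [_ hi] := PX _ jk.
have {}hi : Phi (X j) <= 2 * kappa ^+ 2 * (al j * e j).
  by apply: (upper k) => //; rewrite jc kc.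
apply: le_trans lo; have i1N : (i.+1 < N)%N by apply: leq_ltn_trans (ltn_ord j).
have [_ ei gi ai] := Hpos _ (ltn_ord i); have [_ ej gj aj] := Hpos _ (ltn_ord j).
have [_ ei1 gi1 _] := Hpos _ i1N.
have [gij aij] := Hcl _ _ (ltn_ord i) (ltn_ord j) (etrans ic (esym jc)).
have [_ aji] := Hcl _ _ (ltn_ord j) (ltn_ord i) (etrans jc (esym ic)).
have decay : 2 ^+ r * e j <= kappa * e i.+1.
  have := half_decay egS (i:=i.+1) (j:=j); rewrite ij ltn_ord => /(_ isT) H.
  rewrite -(ler_pM2r gj); apply: (@le_trans _ _ (2 ^+ (j - i.+1) * (e j * g j))).
    rewrite -mulrA ler_wpM2r ?mulr_ge0 ?(ltW ej) ?(ltW gj) //.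
    by apply: ler_weXn2l; rewrite ?ler1n // leq_subRL // addSnnS.
  apply: le_trans H _; rewrite -[leRHS]mulrA [leRHS]mulrCA ler_pM2l //.
  exact: le_trans (gS _ i1N) gij.
apply: (@le_trans _ _ (#|V|%:R ^+ 2 * (2 * kappa ^+ 2 * (kappa * al i * e j)))).
  apply: ler_wpM2l; first by rewrite exprn_ge0.
  apply: le_trans hi _; rewrite ler_wpM2l ?mulr_ge0 ?exprn_ge0 ?(ltW k0) //.
  by rewrite ler_pM2r.
(* The fourth power of [kappa] collects two factors from [upper], one from comparing [al j] with
   [al i], and one from [decay]. *)
rewrite -(ler_pM2l k0).
have -> : kappa * (#|V|%:R ^+ 2 * (2 * kappa ^+ 2 * (kappa * al i * e j))) =
   (2 * kappa ^+ 4 * #|V|%:R ^+ 2) * (al i * e j) by ring.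
apply: (@le_trans _ _ (2 ^+ r * (al i * e j))).
  by rewrite ler_pM2r // mulr_gt0.
by rewrite mulrCA [leRHS]mulrCA ler_pM2l.
Qed.

(** To be read with tangents [P i], [Q i] of slopes [p i], [- q i] lying [gaP i], [gaQ i] below a
    fixed point: then [u i] is the depth of their intersection below that point. As [u] halves, the
    gap on the side that dominates the weighted mean has to shrink too, and with it [Phi] on that
    side, up to ratios of slopes and of the factors [alP], [alQ]. *)
Lemma halving_pairs_length (C D : finType) M r (kappa : R) (Phi : {set V} -> R)
    (P Q : nat -> {set V}) (p q u alP alQ gaP gaQ : nat -> R)
    (cp cq : nat -> C) (dp dq : nat -> D) :
    1 <= kappa -> 2 * kappa ^+ 4 * #|V|%:R ^+ 2 <= 2 ^+ r ->
    submodular Phi -> (forall Y, 0 <= Phi Y) ->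
    (forall i, (i < M)%N -> ~~ trivial_set (P i) /\ ~~ trivial_set (Q i)) ->
    (forall i, (i < M)%N -> [/\ 0 < p i, 0 < q i, 0 < u i, 0 < alP i & 0 < alQ i]) ->
    (forall i, (i < M)%N -> Phi (P i) = alP i * gaP i /\ Phi (Q i) = alQ i * gaQ i) ->
    (forall i, (i < M)%N -> u i * (p i + q i) = q i * gaP i + p i * gaQ i) ->
    (forall i, (i.+1 < M)%N -> [/\ 2 * u i.+1 <= u i, p i.+1 <= p i & q i.+1 <= q i]) ->
    (forall i j, (i < M)%N -> (j < M)%N -> cp i = cp j -> p i <= kappa * p j) ->
    (forall i j, (i < M)%N -> (j < M)%N -> cq i = cq j -> q i <= kappa * q j) ->
    (forall i j, (i < M)%N -> (j < M)%N -> dp i = dp j -> alP i <= kappa * alP j) ->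
    (forall i j, (i < M)%N -> (j < M)%N -> dq i = dq j -> alQ i <= kappa * alQ j) ->
  (M <= 2 * r.+1 * #|D| * (#|C| + #|C|).+1 * #|V| ^ 2)%N.
Proof.
move=> k1 Hr Psub P0 ntPQ Hpos HPhi Hu Hstep Hcp Hcq Hdp Hdq.
have k0 : 0 < kappa by lra.
have pS i : (i.+1 < M)%N -> p i.+1 <= p i by case/Hstep.
have qS i : (i.+1 < M)%N -> q i.+1 <= q i by case/Hstep.
have uS i : (i.+1 < M)%N -> 2 * u i.+1 <= u i by case/Hstep.
have ga0 i : (i < M)%N -> 0 <= gaP i /\ 0 <= gaQ i.
  move=> iM; have [EP EQ] := HPhi _ iM; have [_ _ _ aP aQ] := Hpos _ iM.
  by rewrite -(pmulr_rge0 (gaP i) aP) -(pmulr_rge0 (gaQ i) aQ) -EP -EQ.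
(* [W] never decreases and takes few values. Where it stays constant, both sets of visited classes
   do, so [visited_ratio] bounds the ratios of both slopes. *)
pose W i := (#|visited cp i| + #|visited cq i|)%N.
have W_eq i j : (i <= j)%N -> W i = W j ->
    #|visited cp i| = #|visited cp j| /\ #|visited cq i| = #|visited cq j|.
  move=> ij; have := subset_leq_card (visited_sub cp ij).
  by have := subset_leq_card (visited_sub cq ij); rewrite /W; lia.
(* One side of an index carries at least half of [u i]; the two sides are
   handled alike. *)
have side_bound (b : bool) (A : nat -> {set V}) (x y al ga : nat -> R) (da : nat -> D) :
    (forall i, (i < M)%N -> ~~ trivial_set (A i)) ->
    (forall i, (i < M)%N -> [/\ 0 < x i, 0 < y i, 0 < al i & 0 <= ga i]) ->
    (forall i, (i < M)%N -> Phi (A i) = al i * ga i) ->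
    (forall i, (i < M)%N -> y i * ga i <= u i * (x i + y i)) ->
    (forall i j, (i <= j < M)%N -> x j <= x i) ->
    (forall i j, (i <= j < M)%N -> y j <= y i) ->
    (forall i j, (i <= j < M)%N -> W i = W j -> y i <= kappa * y j) ->
    (forall i j, (i < M)%N -> (j < M)%N -> da i = da j -> al i <= kappa * al j) ->
    forall I : {set 'I_M},
    (forall i, i \in I -> u i * (x i + y i) <= 2 * (y i * ga i)) ->
    (forall i j, i \in I -> j \in I -> [/\ inord (i %% r.+1) = inord (j %% r.+1) :> 'I_r.+1,
       da i = da j & W i = W j]) ->
    (#|I| <= #|V| ^ 2)%N.
  move=> ntA Apos APhi Aup xle yle' yle Ada I Ilow Icol.
  apply: (ring_bound Psub P0 (X:=A)) => [i iI|i j iI jI ij].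
    split; first exact: ntA.
    have [xi yi ai gi] := Apos _ (ltn_ord i); rewrite APhi //.
    have := Ilow _ iI; have [_ _ ui _ _] := Hpos _ (ltn_ord i) => H.
    have : 0 < u i * (x i + y i) by rewrite mulr_gt0 // addr_gt0.
    move/lt_le_trans/(_ H); rewrite pmulr_rgt0 // pmulr_rgt0 // => gi0.
    exact: mulr_gt0.
  have [/(modn_gap ij) gap Ed Ew] := Icol _ _ iI jI.
  have [xi yi ai gi] := Apos _ (ltn_ord i); have [xj yj aj gj] := Apos _ (ltn_ord j).
  have [_ _ ui _ _] := Hpos _ (ltn_ord i); have [_ _ uj _ _] := Hpos _ (ltn_ord j).
  have ijM : (i <= j < M)%N by rewrite ltnW /=.
  have xji := xle _ _ ijM; have yij := yle _ _ ijM Ew.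
  have aji := Ada _ _ (ltn_ord j) (ltn_ord i) (esym Ed).
  rewrite !APhi //.
  have decay : 2 ^+ r.+1 * u j <= u i.
    apply: le_trans (half_decay uS ijM); rewrite ler_pM2r //; apply: ler_weXn2l; rewrite ?ler1n //.
    by rewrite leq_subRL ?(ltnW ij).
  have low := Ilow _ iI; have up := Aup _ (ltn_ord j).
  (* ga j <= u j * (1 + x j / y j) <= kappa * u j * (1 + x i / y i) *)
  have up2 : ga j * y i <= kappa * (u j * (x i + y i)).
    apply: (@le_trans _ _ (ga j * (kappa * y j))); first by rewrite ler_wpM2l.
    rewrite mulrCA ler_pM2l //.
    apply: le_trans (_ : u j * (x j + y j) <= _); first by rewrite mulrC.
    rewrite ler_pM2l //; apply: lerD => //; exact: yle'.
  rewrite -(ler_pM2r yi) -(ler_pM2l (_ : 0 < 2 ^+ r.+1 :> R)) ?exprn_gt0 //.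
  apply: (@le_trans _ _ (2 ^+ r.+1 * (#|V|%:R ^+ 2 * (kappa * al i) * (kappa * (u j * (x i + y i)))))).
    have T0 : (0 : R) <= #|V|%:R ^+ 2 by rewrite exprn_ge0.
    move: (#|V|%:R ^+ 2) T0 => T T0; rewrite ler_pM2l ?exprn_gt0 //.
    rewrite -!mulrA ler_wpM2l // [leRHS]mulrA.
    apply: ler_pM => //; [exact: ltW|apply: mulr_ge0 => //; exact: ltW].
  have -> : 2 ^+ r.+1 * (#|V|%:R ^+ 2 * (kappa * al i) * (kappa * (u j * (x i + y i)))) =
     (kappa ^+ 2 * #|V|%:R ^+ 2) * al i * (2 ^+ r.+1 * u j) * (x i + y i) by ring.
  have H1 : kappa ^+ 2 * #|V|%:R ^+ 2 <= 2 ^+ r / 2.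
    rewrite ler_pdivlMr //; apply: le_trans Hr; rewrite mulrC mulrA.
    rewrite ler_wpM2r ?exprn_ge0 // ler_pM2l // ler_weXn2l //.
  apply: (@le_trans _ _ ((2 ^+ r / 2) * al i * u i * (x i + y i))).
    rewrite ler_pM2r ?addr_gt0 //; apply: ler_pM => //.
    + by rewrite !mulr_ge0 ?exprn_ge0 // ltW.
    + by rewrite mulr_ge0 ?exprn_ge0 // ltW.
    + by rewrite ler_pM2r.
  have -> : 2 ^+ r / 2 * al i * u i * (x i + y i) = 2 ^+ r * al i / 2 * (u i * (x i + y i)) by ring.
  apply: (@le_trans _ _ (2 ^+ r * al i / 2 * (2 * (y i * ga i)))).
    by rewrite ler_pM2l // divr_gt0 ?mulr_gt0 ?exprn_gt0.
  have : 0 <= 2 ^+ r * (al i * ga i * y i).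
    by apply: mulr_ge0; rewrite ?exprn_ge0 // !mulr_ge0 ?(ltW ai) ?(ltW yi).
  rewrite exprS; lra.
have WC i : (W i < (#|C| + #|C|).+1)%N.
  by rewrite ltnS /W leq_add // max_card.
pose b i := u i * (p i + q i) <= 2 * (q i * gaP i).
(* The colour fixes the dominant side, the residue, the class of the factor [alP] or [alQ] on that
   side, and [W]. *)
pose col i : bool * 'I_r.+1 * D * 'I_(#|C| + #|C|).+1 :=
  (b i, inord (i %% r.+1), if b i then dp i else dq i, inord (W i)).
have := @coloring_bound _ M col (#|V| ^ 2).
rewrite !card_prod !card_ord card_bool; apply=> -[[[bb s] dd] ww].
set I := [set i | _].
have inI i : i \in I -> [/\ b i = bb, inord (i %% r.+1) = s,
    (if b i then dp i else dq i) = dd & inord (W i) = ww].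
  by rewrite inE => /eqP[].
have W_I i j : i \in I -> j \in I -> W i = W j.
  move=> /inI[_ _ _ Ei] /inI[_ _ _ Ej].
  by have /(congr1 val) := etrans Ei (esym Ej); rewrite /= !inordK.
have lerow x y : (0 <= x -> y <= y + x :> R) by rewrite lerDl.
case Eb: bb.
  apply: (side_bound true P p q alP gaP dp) => //.
  - by move=> i /ntPQ[].
  - by move=> i iM; have [] := Hpos _ iM; have [] := ga0 _ iM.
  - by move=> i /HPhi[].
  - move=> i iM; rewrite Hu //; apply: lerow.
    by have [? _ _ _ _] := Hpos _ iM; have [_ ?] := ga0 _ iM; rewrite mulr_ge0 // ltW.
  - exact: nonincr_seq.
  - exact: nonincr_seq.
  - move=> i j ijM /W_eq[|_ E]; first by case/andP: ijM.
    exact: (visited_ratio qS Hcq ijM E).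
  - by move=> i /inI[]; rewrite Eb.
  move=> i j iI jI; have [bi si di _] := inI _ iI; have [bj sj dj _] := inI _ jI.
  by split; rewrite ?si ?sj //; [move: di dj; rewrite bi bj Eb => -> ->|apply: W_I].
apply: (side_bound false Q q p alQ gaQ dq) => //.
- by move=> i /ntPQ[].
- by move=> i iM; have [] := Hpos _ iM; have [] := ga0 _ iM.
- by move=> i /HPhi[].
- move=> i iM; rewrite [q i + _]addrC Hu // addrC; apply: lerow.
  by have [_ ? _ _ _] := Hpos _ iM; have [? _] := ga0 _ iM; rewrite mulr_ge0 // ltW.
- exact: nonincr_seq.
- exact: nonincr_seq.
- move=> i j ijM /W_eq[|E _]; first by case/andP: ijM.
  exact: (visited_ratio pS Hcp ijM E).
- move=> i /inI[]; rewrite Eb /b => /negbT; rewrite -ltNge => H _ _ _.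
  have := Hu _ (ltn_ord i); rewrite [q i + _]addrC; lra.
move=> i j iI jI; have [bi si di _] := inI _ iI; have [bj sj dj _] := inI _ jI.
by split; rewrite ?si ?sj //; [move: di dj; rewrite bi bj Eb => -> ->|apply: W_I].
Qed.

End Lengths.

(** * Newton's method on the potential *)

Section Potential.
Context (R : realFieldType) (V : finType).
Implicit Types (b a d : {set V} -> R) (X Y : {set V}).

(* With [a] and [d] the net and the total weight of the edges crossing [X], the
   function [pot b a d y t] is nonnegative iff some submodular flow [x] satisfies
   y - t <= c(e) x(e) <= y + t for every edge [e]. *)
Definition pot b a d y t X : R := b X - y * a X + t * d X.

Lemma potN b a d y t X : pot b (fun X => - a X) d (- y) t X = pot b a d y t X.
Proof. by rewrite /pot mulrNN. Qed.

(** Modularity of [a] lets [y] have either sign; [d] is only submodular, whence the condition on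
    [t]. *)
Lemma pot_submodular b a d y t :
    submodular b -> submodular d -> 0 <= t ->
    (forall X Y, a (X :|: Y) + a (X :&: Y) = a X + a Y) ->
  submodular (pot b a d y t).
Proof.
move=> bs ds t0 am X Y; rewrite /pot.
have H1 := bs X Y; have H2 := ler_wpM2l t0 (ds X Y).
have H3 : y * (a (X :|: Y) + a (X :&: Y)) = y * (a X + a Y) by rewrite am.
lra.
Qed.

Section Newton.
Variables (b a d : {set V} -> R) (dy dt : R).
Hypotheses (b_sub : submodular b) (d_sub : submodular d) (dt0 : 0 <= dt)
  (a_mod : forall X Y, a (X :|: Y) + a (X :&: Y) = a X + a Y).

Let g X := dt * d X - dy * a X.

(** Dinkelbach's iteration along a ray: for each fixed set the potential is linear in [s] with slope
    [g], and [s i.+1] is the root of the linear function of the minimizer [Z i]. *)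
Definition newton_trace (y0 t0 : R) N (Z : nat -> {set V}) (s : nat -> R) : Prop :=
  s 0%N = 0 /\ forall i, (i < N)%N ->
    let f := pot b a d (y0 + s i * dy) (t0 + s i * dt) in
    [/\ forall Y, f (Z i) <= f Y, f (Z i) < 0, 0 < g (Z i)
      & s i.+1 = s i - f (Z i) / g (Z i)].

(** Minimality of [Z i] gives the classical inequality between consecutive defects [e] and slopes
    [h] that [newton_length] takes as hypothesis. The nonnegative function for step [k] is [f k]
    minus its minimum, with all factors [al] equal to 1. *)
Lemma newton_trace_length (C : finType) (cl : {set V} -> C) kappa r y0 t0 N Z s :
    0 <= t0 -> g set0 = 0 -> g setT = 0 ->
    1 <= kappa -> 2 * kappa ^+ 4 * #|V|%:R ^+ 2 <= 2 ^+ r ->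
    (forall X Y, 0 < g X -> 0 < g Y -> cl X = cl Y -> g X <= kappa * g Y) ->
    newton_trace y0 t0 N Z s ->
  (N <= #|C| * r.+1 * (#|V| ^ 2).+1)%N.
Proof.
move=> t00 g00 gT k1 Hr Hcl [s0 tr].
pose f i := pot b a d (y0 + s i * dy) (t0 + s i * dt).
pose e i := - f i (Z i); pose h i := g (Z i).
have fE i j X : f j X = f i X + (s j - s i) * g X.
  by rewrite /f /g /pot; ring.
have Htr i : (i < N)%N -> [/\ forall Y, - e i <= f i Y, 0 < e i, 0 < h i
     & s i.+1 = s i + e i / h i].
  move=> /tr[H1 H2 H3 H4]; rewrite /e; split=> //.
  - by move=> Y; rewrite opprK; apply: H1.
  - by rewrite oppr_gt0.
  - by rewrite mulNr.
have sE i k : (i <= k <= N)%N -> s k = s i + \sum_(i <= l < k) e l / h l.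
  elim: k => [|k IH] /andP[]; first by rewrite leqn0 => /eqP -> _; rewrite big_geq // addr0.
  rewrite leq_eqVlt => /orP[/eqP <- _|]; first by rewrite big_geq // addr0.
  rewrite ltnS => ik kN; rewrite big_nat_recr // addrA -IH ?ik ?(ltnW kN) //.
  by have [] := Htr _ kN.
have term0 i k l : (i <= l < k)%N -> (k <= N)%N -> 0 <= e l / h l.
  move=> /andP[_ lk] kN; have [_ el hl _] := Htr _ (leq_trans lk kN).
  by rewrite divr_ge0 // ltW.
have s_ge0 k : (k <= N)%N -> 0 <= s k.
  move=> kN; rewrite (sE 0%N k) ?kN // s0 add0r big_nat.
  by apply: sumr_ge0 => l lk; apply: term0 lk kN.
have ratio i : (i.+1 < N)%N -> e i.+1 * h i + h i.+1 * e i <= e i * h i.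
  move=> iN; have [m0 ei hi si] := Htr _ (ltnW iN); have [_ ei' hi' _] := Htr _ iN.
  have := m0 (Z i.+1); rewrite (fE i.+1 i) si -[f i.+1 _]opprK -/(e i.+1) -/(h i.+1) => H.
  have : - e i * h i <= (- e i.+1 + (s i - (s i + e i / h i)) * h i.+1) * h i.
    by rewrite ler_pM2r.
  have -> : (- e i.+1 + (s i - (s i + e i / h i)) * h i.+1) * h i =
     - e i.+1 * h i - e i * h i.+1 by field; rewrite gt_eqF.
  lra.
have hS i : (i.+1 < N)%N -> h i.+1 <= h i.
  move=> iN; have [_ ei hi _] := Htr _ (ltnW iN); have [_ ei' hi' _] := Htr _ iN.
  have := ratio _ iN; have := mulr_gt0 ei' hi => H1 H2.
  by rewrite -(ler_pM2r ei); lra.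
apply: (newton_length (kappa:=kappa) (X:=Z) (e:=e) (g:=h) (al:=fun=> 1) (cl:=fun i => cl (Z i))) => //.
- move=> i iN; have [_ ei hi _] := Htr _ iN; split=> //.
  rewrite /trivial_set; apply/norP; split; apply/eqP => E; move: hi;
  by rewrite /h E ?g00 ?gT ltxx.
- move=> i j iN jN E; have [_ _ hi _] := Htr _ iN; have [_ _ hj _] := Htr _ jN.
  by rewrite mulr1; split=> //; apply: Hcl.
move=> k kN; exists (fun X => f k X + e k); have [mk ek hk _] := Htr _ kN.
have t_ge0 : 0 <= t0 + s k * dt by rewrite addr_ge0 // mulr_ge0 // s_ge0 // (ltnW kN).
split=> [X Y|Y|i ik].
- have := pot_submodular (y0 + s k * dy) b_sub d_sub t_ge0 a_mod X Y.
  rewrite -/(f k); lra.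
- by have := mk Y; lra.
have iN := ltn_trans ik kN; have [_ ei hi si] := Htr _ iN.
rewrite (fE i k) -[f i _]opprK -/(e i) -/(h i) (sE i k) ?(ltnW ik) ?(ltnW kN) //.
have Esum : (s i + \sum_(i <= l < k) e l / h l - s i) * h i - e i =
    h i * \sum_(i.+1 <= l < k) e l / h l.
  by rewrite big_ltn //; field; rewrite gt_eqF.
have hki : h k <= h i by apply: (nonincr_seq hS); rewrite (ltnW ik).
(* The value at [Z i] is [e k] plus [h i] times the sum of [e l / h l] over [i < l < k]. The first
   term of the sum gives the lower bound [e i.+1]; when [i.+1 = k] the sum is empty and [e k] itself
   gives it. *)
rewrite mul1r; split.
  rewrite [- e i + _]addrC Esum; have i1N := leq_ltn_trans ik kN.
  case: (ltnP i.+1 k) => [i1k|ki1]; last first.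
    have -> : i.+1 = k by apply/eqP; rewrite eqn_leq ik ki1.
    by rewrite big_geq // mulr0 add0r.
  rewrite big_ltn //; have [_ ei1 hi1 _] := Htr _ i1N.
  have H0 : 0 <= \sum_(i.+2 <= l < k) e l / h l.
    by rewrite big_nat; apply: sumr_ge0 => l lk; apply: term0 lk (ltnW kN).
  have H1 : e i.+1 <= h i * (e i.+1 / h i.+1).
    by rewrite mulrCA ler_pMr // ler_pdivlMr // mul1r hS.
  have := mulr_ge0 (ltW hi) H0; lra.
rewrite mul1r (big_nat_recr k) /= ?(ltnW ik) // addrC.
have H1 : e k <= h i * (e k / h k).
  by rewrite mulrCA ler_pMr // ler_pdivlMr // mul1r.
have -> : s i + \sum_(i <= l < k) e l / h l - s i = \sum_(i <= l < k) e l / h l by ring.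
lra.
Qed.

End Newton.
End Potential.

(** * Tangents and their intersections *)

(** The rising line of slope [pP] is a tangent at [yP]. Since the falling line stays below it there,
    [yP] lies to the right of the crossing; a line that is higher than the crossing at [y] and not
    higher than the tangent at [yP] has to be flatter. *)
Lemma right_step_lines (R : realFieldType) (p q pP yP tP y v t : R) :
    0 < pP -> 0 < q -> v < t ->
    tP = v + pP * (yP - y) -> v - q * (yP - y) <= tP -> t + p * (yP - y) <= tP ->
  p <= pP.
Proof.
move=> pP0 q0 vt EtP HQ HZ.
have y0 : 0 <= yP - y.
  have : 0 <= (pP + q) * (yP - y) by lra.
  by rewrite pmulr_rge0 //; lra.
have H : 0 < (pP - p) * (yP - y) by lra.
rewrite leNgt; apply/negP => lt.
have : (pP - p) * (yP - y) <= 0 by rewrite mulr_le0_ge0 //; lra.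
lra.
Qed.

Section Lines.
Context (R : realFieldType) (V : finType).
Variables (b d : {set V} -> R).
Implicit Types (a : {set V} -> R) (X Y : {set V}).

Definition feasible a y t := forall X, 0 <= pot b a d y t X.
Definition tangent a X := exists y t, feasible a y t /\ pot b a d y t X = 0.
Definition slope a X : R := a X / d X.
Definition line a X y : R := (y * a X - b X) / d X.

Lemma pot_line a y t X : 0 < d X -> pot b a d y t X = d X * (t - line a X y).
Proof. by move=> dX; rewrite /pot /line; field; rewrite gt_eqF. Qed.

Lemma line_slope a X y y' : line a X y' = line a X y + slope a X * (y' - y).
Proof. by rewrite /line /slope; ring. Qed.

Lemma pot_eq0 a y t X : 0 < d X -> pot b a d y t X = 0 -> t = line a X y.
Proof.
move=> dX /eqP; rewrite pot_line // mulf_eq0 gt_eqF //= subr_eq0.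
by move=> /eqP.
Qed.

Lemma feasible_line a y t X : feasible a y t -> 0 < d X -> line a X y <= t.
Proof. by move=> H dX; have := H X; rewrite pot_line // pmulr_rge0 // subr_ge0. Qed.

(** Kelley's cutting-plane method in one variable: the lines of [P i] and [Q i] cross at
    [(y i, v i)], and [Z i] is a tangent at the abscissa of the crossing. A [Z i] of slope 0 ends
    the search and so never enters a trace. *)
Definition kelley_trace a N (P Q Z : nat -> {set V}) (y v t : nat -> R) : Prop :=
  [/\ tangent a (P 0%N) /\ 0 < a (P 0%N), tangent a (Q 0%N) /\ a (Q 0%N) < 0 &
  forall i, (i < N)%N ->
    [/\ pot b a d (y i) (v i) (P i) = 0 /\ pot b a d (y i) (v i) (Q i) = 0,
        feasible a (y i) (t i), pot b a d (y i) (t i) (Z i) = 0, 0 <= t i /\ v i < t i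
      & [/\ 0 < a (Z i), P i.+1 = Z i & Q i.+1 = Q i] \/
        [/\ a (Z i) < 0, P i.+1 = P i & Q i.+1 = Z i]]].

(** Reflecting [y] to [- y] exchanges the two sides, so everything proved about replacements on the
    right also covers those on the left. *)
Lemma kelley_traceN a N P Q Z y v t : kelley_trace a N P Q Z y v t ->
  kelley_trace (fun X => - a X) N Q P Z (fun i => - y i) v t.
Proof.
have feasN y' t' : feasible a y' t' -> feasible (fun X => - a X) (- y') t'.
  by move=> H X; rewrite potN.
have tanN X : tangent a X -> tangent (fun X => - a X) X.
  by case=> y' [t' [H1 H2]]; exists (- y'), t'; rewrite potN; split=> //; apply: feasN.
move=> [[tP aP] [tQ aQ] H]; split.
- by rewrite oppr_gt0; split=> //; apply: tanN.
- by rewrite oppr_lt0; split=> //; apply: tanN.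
move=> i /H[[H1 H2] H3 H4 H5 H6]; rewrite !potN; split=> //; first exact: feasN.
by rewrite oppr_gt0 oppr_lt0; case: H6 => [][? ? ?]; [right|left].
Qed.

(** Replacements preserve tangency and the signs of the slopes, so a trace may be cut anywhere and
    its tail is again a trace. *)
Lemma kelley_trace_shift a N P Q Z y v t k : kelley_trace a (k + N) P Q Z y v t ->
  kelley_trace a N (fun i => P (k + i)%N) (fun i => Q (k + i)%N) (fun i => Z (k + i)%N)
    (fun i => y (k + i)%N) (fun i => v (k + i)%N) (fun i => t (k + i)%N).
Proof.
move=> [tP tQ H].
have inv i : (i <= k)%N -> (tangent a (P i) /\ 0 < a (P i)) /\ (tangent a (Q i) /\ a (Q i) < 0).
  elim: i => // i IH ik; have [//|IHP IHQ] := IH _; first exact: ltnW.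
  have [_ H2 H3 _ H4] := H i (leq_trans ik (leq_addr _ _)).
  have tZ : tangent a (Z i) by exists (y i), (t i).
  by case: H4 => [][H5 -> ->].
have [inP inQ] := inv k (leqnn k); split; rewrite ?addn0 //.
by move=> i iN; rewrite addnS; apply: H; rewrite ltn_add2l.
Qed.

Section Bounds.
Variable a : {set V} -> R.
Hypothesis (a_le_d : forall X, `|a X| <= d X).

Lemma d_gt0 X : a X != 0 -> 0 < d X.
Proof. by move=> aX; apply: lt_le_trans (a_le_d X); rewrite normr_gt0. Qed.

Lemma right_d X : 0 < a X -> 0 < d X.
Proof. by move=> aX; apply: d_gt0; rewrite gt_eqF. Qed.

Lemma left_d X : a X < 0 -> 0 < d X.
Proof. by move=> aX; apply: d_gt0; rewrite lt_eqF. Qed.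

Lemma slope_gt0 X : 0 < a X -> 0 < slope a X.
Proof. by move=> aX; rewrite divr_gt0 // right_d. Qed.

Lemma slope_lt0 X : a X < 0 -> slope a X < 0.
Proof. by move=> aX; rewrite ltr_pdivrMr ?mul0r // left_d. Qed.

(** The crossing slides to the left along the unchanged line of [Q]. The lower bound rises by the
    share [q / (p + q)] of the gap [t - v], where [p] is the new slope. *)
Lemma right_step P Q Z y v t y' v' :
    tangent a P -> 0 < a P -> a Q < 0 -> 0 < a Z -> v < t ->
    pot b a d y v P = 0 -> pot b a d y v Q = 0 ->
    feasible a y t -> pot b a d y t Z = 0 ->
    pot b a d y' v' Z = 0 -> pot b a d y' v' Q = 0 ->
  let p := slope a Z in let q := - slope a Q in
  [/\ p <= slope a P, (v' - v) * (p + q) = (t - v) * q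
    & (y - y') * (p + q) = t - v].
Proof.
move=> [yP [tP [fP onP]]] aP aQ aZ vt yvP yvQ fyt ytZ yvZ' yvQ' p q.
have [dP dQ dZ] := And3 (right_d aP) (left_d aQ) (right_d aZ).
have [lP lQ lZ] := And3 (pot_eq0 dP yvP) (pot_eq0 dQ yvQ) (pot_eq0 dZ ytZ).
have [lZ' lQ'] := conj (pot_eq0 dZ yvZ') (pot_eq0 dQ yvQ').
have q0 : 0 < q by rewrite oppr_gt0 slope_lt0.
split.
- apply: (@right_step_lines _ p q _ yP tP y v t) => //; first exact: slope_gt0.
  + by rewrite lP -line_slope; apply: pot_eq0.
  + by have := feasible_line fP dQ; rewrite (line_slope a Q y) -lQ /q mulNr opprK.
  + by have := feasible_line fP dZ; rewrite (line_slope a Z y) -lZ.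
- move: lZ' lQ'; rewrite (line_slope a Z y) (line_slope a Q y) -lQ -lZ -/p => E1 E2.
  have Ey : (y - y') * (p + q) = t - v by rewrite /q; lra.
  have -> : v' = v + (y - y') * q by rewrite /q; lra.
  by rewrite -Ey; ring.
- move: lZ' lQ'; rewrite (line_slope a Z y) (line_slope a Q y) -lQ -lZ -/p => E1 E2.
  rewrite /q; lra.
Qed.

End Bounds.

End Lines.

(** * The number of tangent replacements *)

Section KelleyLength.
Context (R : realFieldType) (V : finType).
Variables (b d : {set V} -> R) (C D : finType) (dcl : {set V} -> D) (kd kappa : R) (r : nat).
Hypotheses (b_sub : submodular b) (d_sub : submodular d) (kd1 : 1 <= kd)
  (dclP : forall X Y, 0 < d X -> 0 < d Y -> dcl X = dcl Y -> d X <= kd * d Y)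
  (kappaE : kappa = 2 * kd)
  (kappa_r : 2 * kappa ^+ 4 * #|V|%:R ^+ 2 <= 2 ^+ r).

Let kappa1 : 1 <= kappa. Proof. by have := kd1; rewrite kappaE; lra. Qed.

Let d_kappa X Y : 0 < d X -> 0 < d Y -> dcl X = dcl Y -> d X <= kappa * d Y.
Proof.
move=> dX dY E; apply: le_trans (dclP dX dY E) _.
by rewrite ler_pM2r // kappaE; have := kd1; lra.
Qed.

Section Right.
Variables (a : {set V} -> R) (acl : {set V} -> C).
Hypotheses (a_le_d : forall X, `|a X| <= d X)
  (a_mod : forall X Y, a (X :|: Y) + a (X :&: Y) = a X + a Y)
  (a0 : a set0 = 0) (aT : a setT = 0)
  (aclP : forall X Y, 0 < a X -> 0 < a Y -> acl X = acl Y -> a X <= 2 * a Y).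

Lemma a_neq0_nontrivial X : a X != 0 -> ~~ trivial_set X.
Proof. by apply: contraNN => /orP[] /eqP ->; rewrite ?a0 ?aT. Qed.

(** A slope is a quotient: its numerator costs the factor 2 of [aclP] and its denominator the factor
    [kd] of [dclP], which explains [kappa = 2 * kd]. *)
Lemma slope_class X Y : 0 < a X -> 0 < a Y -> (acl X, dcl X) = (acl Y, dcl Y) ->
  slope d a X <= kappa * slope d a Y.
Proof.
move=> aX aY [Ea Ed]; have [dX dY] := conj (right_d a_le_d aX) (right_d a_le_d aY).
rewrite /slope ler_pdivrMr // mulrA mulrAC ler_pdivlMr // kappaE.
have H1 := aclP aX aY Ea; have H2 := dclP dY dX (esym Ed).
apply: le_trans (_ : (2 * a Y) * (kd * d X) <= _).
  by apply: ler_pM => //; apply: ltW.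
by rewrite le_eqVlt; apply/orP; left; apply/eqP; ring.
Qed.

(** While [Q] is fixed, the replacements are Newton's method for a zero of T minus the line of [Q].
    Its slopes are [p i + q], but the inequality required by [newton_length] persists with [p i]
    alone, whose scales are controlled. The function for step [k] is the potential at the feasible
    point [(y k, t k)]. *)
Lemma right_run_length N P Q Z y v t :
    kelley_trace b d a N P Q Z y v t -> (forall i, (i < N)%N -> 0 < a (Z i)) ->
  (N <= #|C| * #|D| * r.+1 * (#|V| ^ 2).+1)%N.
Proof.
move=> [[tP0 aP0] [tQ0 aQ0] tr] right.
have QE i : (i <= N)%N -> Q i = Q 0%N.
  elim: i => // i IH iN; have [_ _ _ _ [[_ _ ->]|[aZ _ _]]] := tr _ iN; first exact/IH/ltnW.
  by have := lt_trans (right _ iN) aZ; rewrite ltxx.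
have PE i : (i < N)%N -> P i.+1 = Z i.
  move=> iN; have [_ _ _ _ [[_ -> _]|[aZ _ _]]] := tr _ iN => //.
  by have := lt_trans (right _ iN) aZ; rewrite ltxx.
have Pright i : (i <= N)%N -> tangent b d a (P i) /\ 0 < a (P i).
  case: i => // i iN; rewrite PE //; split; last exact: right.
  by have [_ fi Zi _ _] := tr _ iN; exists (y i), (t i).
pose p i := slope d a (Z i); pose q := - slope d a (Q 0%N); pose e i := t i - v i.
have q0 : 0 < q by rewrite oppr_gt0 slope_lt0.
have p0 i : (i < N)%N -> 0 < p i by move=> /right; apply: slope_gt0.
have dZ i : (i < N)%N -> 0 < d (Z i) by move=> /right; apply: right_d.
have e0 i : (i < N)%N -> 0 < e i by move=> /tr[_ _ _ [_]]; rewrite subr_gt0.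
have lZ i : (i < N)%N -> t i = line b d a (Z i) (y i).
  by move=> iN; have [_ _ Zi _ _] := tr _ iN; apply: pot_eq0 Zi; apply: dZ.
have lZ' i : (i.+1 < N)%N -> v i.+1 = line b d a (Z i) (y i.+1).
  move=> iN; have [[Pi _] _ _ _ _] := tr _ iN; apply: pot_eq0; first exact/dZ/ltnW.
  by rewrite -PE // ltnW.
have gap i : (i.+1 < N)%N -> (y i - y i.+1) * (p i + q) = e i.
  move=> iN1; have iN := ltnW iN1; have [[yP yQ] fi Zi [_ vt] _] := tr _ iN.
  have [[yP' yQ'] _ _ _ _] := tr _ iN1; have [tPi aPi] := Pright _ (ltnW iN).
  have aZi := right _ iN.
  rewrite PE // in yP'; rewrite QE // in yQ'; rewrite QE ?(ltnW iN) // in yQ.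
  by have [_ _] := right_step a_le_d tPi aPi aQ0 aZi vt yP yQ fi Zi yP' yQ'.
have yS i : (i.+1 < N)%N -> y i.+1 <= y i.
  move=> iN; rewrite -subr_ge0.
  have pq : 0 < p i + q by rewrite addr_gt0 // p0 // ltnW.
  by rewrite -(pmulr_lge0 _ pq) gap // ltW // e0 // ltnW.
have drop i : (i.+1 < N)%N -> t i.+1 + p i.+1 * (y i - y i.+1) <= t i /\
    e i.+1 <= (p i - p i.+1) * (y i - y i.+1).
  move=> iN1; have iN := ltnW iN1; have [_ fi _ _ _] := tr _ iN.
  have := feasible_line fi (dZ _ iN1); rewrite (line_slope _ _ _ (Z i.+1) (y i.+1)).
  rewrite -lZ // -/(p _) => H; split => //.
  have := lZ' _ iN1; rewrite (line_slope _ _ _ (Z i) (y i)) -lZ // -/(p _) /e; lra.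
have pS i : (i.+1 < N)%N -> p i.+1 <= p i.
  move=> iN; have [_ H] := drop _ iN; have := e0 _ iN => ei.
  have ydiff : 0 <= y i - y i.+1 by rewrite subr_ge0 yS.
  rewrite leNgt; apply/negP => lt.
  have : (p i - p i.+1) * (y i - y i.+1) <= 0 by rewrite mulr_le0_ge0 //; lra.
  lra.
have tS i : (i.+1 < N)%N -> t i.+1 <= t i.
  move=> iN; have [H _] := drop _ iN; apply: le_trans H; rewrite lerDl.
  by rewrite mulr_ge0 ?subr_ge0 ?yS // ltW // p0.
rewrite -card_prod.
apply: (newton_length (kappa:=kappa) (X:=Z) (e:=e) (g:=p) (al:=fun i => d (Z i))
  (cl:=fun i => (acl (Z i), dcl (Z i)))) => //.
- move=> i iN; split; [|exact: e0|exact: p0|exact: dZ].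
  by apply: a_neq0_nontrivial; rewrite gt_eqF // right.
- move=> i iN1; have iN := ltnW iN1; have [_ H] := drop _ iN1.
  have H1 := pS _ iN1; have H2 := p0 _ iN; have H3 := p0 _ iN1; have H4 := e0 _ iN1.
  have ydiff : 0 <= y i - y i.+1 by rewrite subr_ge0 yS.
  apply: (@le_trans _ _ ((p i - p i.+1) * (y i - y i.+1) * p i + p i.+1 * e i)).
    by rewrite lerD2r ler_pM2r.
  rewrite -gap // -subr_ge0.
  have -> : (y i - y i.+1) * (p i + q) * p i - ((p i - p i.+1) * (y i - y i.+1) * p i +
     p i.+1 * ((y i - y i.+1) * (p i + q))) = (y i - y i.+1) * (q * (p i - p i.+1)) by ring.
  by apply: mulr_ge0 => //; apply: mulr_ge0; rewrite ?subr_ge0 // ltW.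
- move=> i j iN jN E; split; first by apply: slope_class => //; apply: right.
  by case: E => _ E; apply: d_kappa => //; apply: dZ.
move=> k kN; exists (pot b a d (y k) (t k)); have [_ fk _ [t0 vt] _] := tr _ kN.
split=> //; first by apply: pot_submodular => //.
move=> i ik; have iN := ltn_trans ik kN; rewrite pot_line ?dZ // -mulrA !ler_pM2l ?dZ //.
have i1N := leq_ltn_trans ik kN; split.
  have yk : y k <= y i.+1 by apply: (nonincr_seq yS); rewrite ik.
  have := feasible_line fk (dZ _ i1N).
  rewrite (line_slope _ _ _ (Z i.+1) (y i.+1)) -lZ // -/(p _).
  rewrite (line_slope _ _ _ (Z i) (y i.+1)) -lZ' // -/(p _) /e => H.
  have : 0 <= (p i - p i.+1) * (y i.+1 - y k) by rewrite mulr_ge0 ?subr_ge0 // pS.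
  lra.
have tk : t k <= t i by apply: (nonincr_seq tS); rewrite ltnW.
rewrite (line_slope _ _ _ (Z i) (y i)) -lZ // -/(p _).
apply: (@le_trans _ _ (p i * (y i - y k))); first by lra.
rewrite ler_pM2l ?p0 //.
have sum_gap : y i - y k <= \sum_(i <= l < k) e l / p l.
  have : (i <= k)%N by apply: ltnW.
  elim: k kN {ik fk t0 vt i1N tk} => [|k IH] kN; first by rewrite leqn0 => /eqP ->; rewrite subrr big_geq.
  rewrite leq_eqVlt => /orP[/eqP <-|]; first by rewrite subrr big_geq.
  rewrite ltnS => ik; rewrite big_nat_recr //=.
  have kN' := ltnW kN.
  have -> : y i - y k.+1 = (y i - y k) + (y k - y k.+1) by ring.
  apply: lerD; first exact: IH.
  rewrite ler_pdivlMr ?p0 // -gap // ler_wpM2l ?subr_ge0 ?yS //.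
  by rewrite lerDl ltW.
apply: le_trans sum_gap _; rewrite big_nat_recr ?(ltnW ik) //= lerDl.
by rewrite divr_ge0 // ltW // ?e0 ?p0.
Qed.

End Right.

Variables (a : {set V} -> R) (acl nacl : {set V} -> C).
Hypotheses (a_le_d : forall X, `|a X| <= d X)
  (a_mod : forall X Y, a (X :|: Y) + a (X :&: Y) = a X + a Y)
  (a0 : a set0 = 0) (aT : a setT = 0)
  (aclP : forall X Y, 0 < a X -> 0 < a Y -> acl X = acl Y -> a X <= 2 * a Y)
  (naclP : forall X Y, a X < 0 -> a Y < 0 -> nacl X = nacl Y -> - a X <= 2 * - a Y).

Let na X := - a X.
Let na_le_d X : `|na X| <= d X. Proof. by rewrite normrN. Qed.
Let na_mod X Y : na (X :|: Y) + na (X :&: Y) = na X + na Y.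
Proof. by rewrite /na -!opprD a_mod. Qed.
Let na0 : na set0 = 0. Proof. by rewrite /na a0 oppr0. Qed.
Let naT : na setT = 0. Proof. by rewrite /na aT oppr0. Qed.
Let na_cl X Y : 0 < na X -> 0 < na Y -> nacl X = nacl Y -> na X <= 2 * na Y.
Proof. by rewrite /na !oppr_gt0; apply: naclP. Qed.

Definition run_bound := (#|C| * #|D| * r.+1 * (#|V| ^ 2).+1)%N.
Definition change_bound := (2 * r.+1 * #|D| * (#|C| * #|D| + #|C| * #|D|).+1 * #|V| ^ 2)%N.

Section Trace.
Variables (N : nat) (P Q Z : nat -> {set V}) (y v t : nat -> R).
Hypothesis tr : kelley_trace b d a N P Q Z y v t.

Let right i := 0 < a (Z i).
Let p i := slope d a (P i).
Let q i := - slope d a (Q i).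

Let left_of i : (i < N)%N -> ~~ right i -> a (Z i) < 0.
Proof.
case: tr => _ _ H /H[_ _ _ _ [[aZ _ _]|[aZ _ _] _ //]].
by case/negP.
Qed.

Let inv i : (i <= N)%N ->
  (tangent b d a (P i) /\ 0 < a (P i)) /\ (tangent b d a (Q i) /\ a (Q i) < 0).
Proof.
case: tr => tP tQ H; elim: i => // i IH iN; have [//|IHP IHQ] := IH _; first exact: ltnW.
have [_ H2 H3 _ H4] := H i iN.
have tZ : tangent b d a (Z i) by exists (y i), (t i).
by case: H4 => [][H5 -> ->].
Qed.

Let p_gt0 i : (i <= N)%N -> 0 < p i.
Proof. by move=> /inv[[_ aP] _]; apply: slope_gt0. Qed.

Let q_gt0 i : (i <= N)%N -> 0 < q i.
Proof. by move=> /inv[_ [_ aQ]]; rewrite oppr_gt0; apply: slope_lt0. Qed.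

Let step i : (i.+1 < N)%N ->
  [/\ p i.+1 <= p i, q i.+1 <= q i &
   (v i.+1 - v i) * (p i.+1 + q i.+1) = (t i - v i) * (if right i then q i.+1 else p i.+1)].
Proof.
move=> iN1; have iN := ltnW iN1; have [_ _ H] := tr.
have [[yP yQ] fi Zi [_ vt] Ht] := H _ iN.
have [[yP' yQ'] _ _ _ _] := H _ iN1; have [[tPi aPi] [tQi aQi]] := inv (ltnW iN).
rewrite /p /q /right; case: Ht => [][aZ EP EQ]; rewrite EP EQ in yP' yQ' *.
  by rewrite aZ; have [H1 H2 _] := right_step a_le_d tPi aPi aQi aZ vt yP yQ fi Zi yP' yQ'.
rewrite ltNge (ltW aZ) /=.
have [_ _ /(_ _ iN)[_ fi' Zi' _ _]] := kelley_traceN tr.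
have tQi' : tangent b d na (Q i).
  have [yQ0 [tQ0 [f0 on0]]] := tQi; exists (- yQ0), tQ0; rewrite potN; split=> // X.
  by rewrite potN.
have slN X : slope d na X = - slope d a X by rewrite /slope mulNr.
have aQi' : 0 < na (Q i) by rewrite oppr_gt0.
have aPi' : na (P i) < 0 by rewrite oppr_lt0.
have aZ' : 0 < na (Z i) by rewrite oppr_gt0.
rewrite -(potN b a) in yP; rewrite -(potN b a) in yQ.
rewrite -(potN b a) in yP'; rewrite -(potN b a) in yQ'.
have := right_step na_le_d tQi' aQi' aPi' aZ' vt yQ yP fi' Zi' yQ' yP'.
by rewrite /= !slN !opprK => -[H1 H2 _]; split=> //; rewrite [slope d a _ + _]addrC.
Qed.

Let v_lt i : (i.+1 < N)%N -> v i < v i.+1.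
Proof.
move=> iN; have [_ _ H] := step iN; have iN' := ltnW iN.
have p0 := p_gt0 iN'; have q0 := q_gt0 iN'; have [_ _ Htr] := tr.
have [_ _ _ [_ vt] _] := Htr _ iN'.
rewrite -subr_gt0 -(pmulr_lgt0 _ (addr_gt0 p0 q0)) H pmulr_rgt0 ?subr_gt0 //.
by case: ifP.
Qed.

(** The weights [q] and [p] cancel the slopes [p] and [- q], so the weighted mean of the two lines
    at any abscissa is the height of their crossing. *)
Let v_weight i yy tt : (i < N)%N ->
  (tt - v i) * (p i + q i) =
    q i * (tt - line b d a (P i) yy) + p i * (tt - line b d a (Q i) yy).
Proof.
move=> iN; have [_ _ H] := tr; have [[yP yQ] _ _ _ _] := H _ iN.
have [[_ aP] [_ aQ]] := inv (ltnW iN).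
rewrite (line_slope _ _ _ (P i) (y i)) (line_slope _ _ _ (Q i) (y i)).
rewrite -(pot_eq0 (right_d a_le_d aP) yP) -(pot_eq0 (left_d a_le_d aQ) yQ).
by rewrite /p /q; ring.
Qed.

Let v_le i yy tt : (i < N)%N -> feasible b d a yy tt -> v i <= tt.
Proof.
move=> iN f; have [[_ aP] [_ aQ]] := inv (ltnW iN).
have p0 := p_gt0 (ltnW iN); have q0 := q_gt0 (ltnW iN).
rewrite -subr_ge0 -(pmulr_lge0 _ (addr_gt0 p0 q0)) (v_weight yy _ iN).
by apply: addr_ge0; apply: mulr_ge0; rewrite ?(ltW p0) ?(ltW q0) // subr_ge0;
  apply: feasible_line => //; [apply: right_d aP|apply: left_d aQ].
Qed.

(* A replacement after which the new tangent is at most as steep as the opposite one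
   raises [v] by at least half of [t - v]; one of the two replacements is of this kind. *)
Let side_change i ts : (i.+2 < N)%N -> (forall j, (j < N)%N -> ts <= t j) ->
  right i != right i.+1 -> 2 * (ts - v i.+2) <= ts - v i.
Proof.
move=> iN2 Hts neq; have iN1 := ltnW iN2; have iN := ltnW iN1.
have [p1 q1 E1] := step iN1; have [p2 q2 E2] := step iN2.
have v1 := v_lt iN1; have v2 := v_lt iN2.
have t1 := Hts _ iN; have t2 := Hts _ iN1.
have P2 := p_gt0 iN1; have Q2 := q_gt0 iN1.
have P1 := p_gt0 iN; have Q1 := q_gt0 iN.
have half (x y' e u : R) : 0 < x -> 0 < y' -> x <= y' -> u * (x + y') = e * y' -> 0 <= e -> e <= 2 * u.
  move=> x0 y0 xy Eu e0'.
  have H : e * (x + y') <= 2 * u * (x + y').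
    have -> : 2 * u * (x + y') = 2 * (u * (x + y')) by ring.
    by rewrite Eu; nra.
  by move: H; rewrite ler_pM2r // addr_gt0.
have [_ _ Htr] := tr.
have [_ _ _ [_ vt1] ev1] := Htr _ iN; have [_ _ _ [_ vt2] ev2] := Htr _ iN1.
have e1 : 0 <= t i - v i by lra.
have e2 : 0 <= t i.+1 - v i.+1 by lra.
case: (boolP (right i)) neq E1 E2 => [ri|ri]; case: (boolP (right i.+1)) => // rj _ E1 E2.
  case: (leP (p i.+1) (q i.+1)) => pq.
    have := half _ _ _ _ P1 Q1 pq E1 e1; lra.
  have pE : p i.+2 = p i.+1.
    by case: ev2 => [][]; [rewrite -/(right _) (negPf rj)|rewrite /p => _ ->].
  have qp : q i.+2 <= p i.+2 by rewrite pE; apply: le_trans q2 (ltW pq).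
  have := half _ _ _ _ Q2 P2 qp; rewrite addrC => /(_ _ _ E2 e2); lra.
case: (leP (q i.+1) (p i.+1)) => pq.
  have := half _ _ _ _ Q1 P1 pq; rewrite addrC => /(_ _ _ E1 e1); lra.
have qE : q i.+2 = q i.+1.
  case: ev2 => [][aZ _ EQ]; first by rewrite /q EQ.
  by have := lt_trans aZ rj; rewrite ltxx.
have qp : p i.+2 <= q i.+2 by rewrite qE; apply: le_trans p2 (ltW pq).
have := half _ _ _ _ P2 Q2 qp E2 e2; lra.
Qed.

Let change_exists i : (i + run_bound.+1 <= N)%N ->
  exists2 j, (i <= j < i + run_bound)%N & right j != right j.+1.
Proof.
move=> iN; apply: contrapT => /forall2NP noch.
have same j : (j <= run_bound)%N -> right (i + j) = right i.
  elim: j => [|j IH] jB; first by rewrite addn0.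
  have [/negP|/negP] := noch (i + j)%N; first by rewrite leq_addr ltn_add2l jB.
  by rewrite negbK -addnS => /eqP <-; apply/IH/ltnW.
have [k Ek] : exists k, N = (i + run_bound.+1 + k)%N by exists (N - (i + run_bound.+1))%N; rewrite subnKC.
have tri : kelley_trace b d a (i + run_bound.+1) P Q Z y v t.
  by case: tr => H1 H2 H3; split=> // j jN; apply: H3; apply: leq_trans iN.
have {}tri := kelley_trace_shift tri.
case: (boolP (right i)) => ri.
  suff : (run_bound.+1 <= run_bound)%N by rewrite ltnn.
  apply: (right_run_length a_le_d a_mod a0 aT aclP tri) => j jB.
  by have := same j jB; rewrite ri.
suff : (run_bound.+1 <= run_bound)%N by rewrite ltnn.
apply: (right_run_length na_le_d na_mod na0 naT na_cl (kelley_traceN tri)) => j jB.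
rewrite oppr_gt0; apply: left_of; last by rewrite same.
by apply: leq_trans iN; rewrite ltn_add2l.
Qed.

(** The trace is sampled every [run_bound.+1] iterations. Between two samples the side changes, so
    the distance of [v] below the reference height halves, and [halving_pairs_length] limits the
    number of samples. *)
Lemma kelley_trace_length : (N <= (change_bound.+1 * run_bound.+1).+1)%N.
Proof.
rewrite leqNgt; apply/negP => big.
have N0 : (0 < N)%N by apply: leq_ltn_trans big.
pose i0 : 'I_N := Ordinal N0.
(* The reference is the lowest height reached in the trace. It belongs to a feasible point, so the
   potential there is nonnegative, and it is at most every [t j], as [side_change] requires. *)
have [k Hk] : exists k : 'I_N, forall j : 'I_N, t k <= t j.
  have := @Order.TotalTheory.arg_minP _ _ _ i0 predT (fun i : 'I_N => t i) isT.
  by case=> k _ Hk; exists k => j; apply: Hk.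
have Hts j : (j < N)%N -> t k <= t j by move=> jN; apply: (Hk (Ordinal jN)).
pose ix j := (j * run_bound.+1)%N.
have [_ _ Htr] := tr; have [_ fk _ [tk0 vtk] _] := Htr _ (ltn_ord k).
have ixN j : (j < change_bound.+1)%N -> ((ix j + run_bound.+1).+1 < N)%N.
  move=> jc; apply: leq_ltn_trans big; rewrite ltnS /ix -mulSnr leq_mul2r.
  by rewrite jc orbT.
have ixN' j : (j < change_bound.+1)%N -> (ix j < N)%N.
  by move=> /ixN; apply: leq_ltn_trans; rewrite -addnS leq_addr.
have mono i : (i.+1 < N)%N -> - v i.+1 <= - v i by move=> /v_lt; rewrite lerN2 => /ltW.
suff : (change_bound.+1 <= change_bound)%N by rewrite ltnn.
rewrite [leqRHS]/change_bound -card_prod.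
apply: (@halving_pairs_length _ _ (C * D)%type D change_bound.+1 r kappa (pot b a d (y k) (t k))
   (fun j => P (ix j)) (fun j => Q (ix j)) (fun j => p (ix j)) (fun j => q (ix j))
   (fun j => t k - v (ix j)) (fun j => d (P (ix j))) (fun j => d (Q (ix j)))
   (fun j => t k - line b d a (P (ix j)) (y k)) (fun j => t k - line b d a (Q (ix j)) (y k))
   (fun j => (acl (P (ix j)), dcl (P (ix j)))) (fun j => (nacl (Q (ix j)), dcl (Q (ix j))))
   (fun j => dcl (P (ix j))) (fun j => dcl (Q (ix j)))) => //.
- by apply: pot_submodular => //.
- move=> j /ixN'/ltnW/inv[[_ aP] [_ aQ]].
  by split; apply: (a_neq0_nontrivial a0 aT); [rewrite gt_eqF|rewrite lt_eqF].
- move=> j jc; have jN := ixN' _ jc; have [[_ aP] [_ aQ]] := inv (ltnW jN).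
  split; [exact/p_gt0/ltnW|exact/q_gt0/ltnW| |exact: right_d aP|exact: left_d aQ].
  (* The depth is strictly positive because the next intersection is strictly higher and still at
     most [t k]; the trace must therefore extend one step beyond the sample. *)
  have jN1 : ((ix j).+1 < N)%N by apply: leq_ltn_trans (ixN _ jc); rewrite ltnS leq_addr.
  by rewrite subr_gt0; apply: lt_le_trans (v_lt jN1) (v_le jN1 fk).
- move=> j /ixN'/ltnW/inv[[_ aP] [_ aQ]].
  by rewrite !pot_line ?(right_d a_le_d aP) ?(left_d a_le_d aQ).
- by move=> j /ixN' jN; rewrite (v_weight (y k) _ jN).
- move=> j jc.
  have jN := ixN' _ jc; have := ixN _ (ltnW jc) => jN'.
  have Eix : ix j.+1 = (ix j + run_bound.+1)%N by rewrite /ix mulSnr.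
  have le_ix : (ix j <= ix j.+1 < N)%N by rewrite jN andbT Eix leq_addr.
  split; last 2 first.
  + by apply: (nonincr_seq (x:=p)) le_ix => i /step[].
  + by apply: (nonincr_seq (x:=q)) le_ix => i /step[].
  have [l /andP[l1 l2] neq] := change_exists (ltnW (ltnW jN')).
  have l2N : (l.+2 < N)%N.
    by apply: leq_ltn_trans (ltnW jN'); rewrite addnS ltnS.
  have H1 := side_change l2N Hts neq.
  have H2 : - v l <= - v (ix j).
    by apply: (nonincr_seq (x:=fun i => - v i) mono); rewrite l1 (ltnW (ltnW l2N)).
  have H3 : - v (ix j.+1) <= - v l.+2.
    apply: (nonincr_seq (x:=fun i => - v i) mono).
    by case/andP: le_ix => _ ->; rewrite Eix addnS ltnS l2.
  lra.
- move=> i j ic jc E.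
  have [[_ aPi] _] := inv (ltnW (ixN' _ ic)); have [[_ aPj] _] := inv (ltnW (ixN' _ jc)).
  exact: (slope_class a_le_d aclP aPi aPj E).
- move=> i j ic jc E.
  have [_ [_ aQi]] := inv (ltnW (ixN' _ ic)); have [_ [_ aQj]] := inv (ltnW (ixN' _ jc)).
  have := @slope_class na nacl na_le_d na_cl (Q (ix i)) (Q (ix j)).
  by rewrite !oppr_gt0 /slope !mulNr -/(slope d a _) => /(_ aQi aQj E).
- move=> i j ic jc; have [[_ aPi] _] := inv (ltnW (ixN' _ ic)).
  have [[_ aPj] _] := inv (ltnW (ixN' _ jc)).
  by apply: d_kappa; apply: (right_d a_le_d).
move=> i j ic jc; have [_ [_ aQi]] := inv (ltnW (ixN' _ ic)).
have [_ [_ aQj]] := inv (ltnW (ixN' _ jc)).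
by apply: d_kappa; apply: (left_d a_le_d).
Qed.

End Trace.
End KelleyLength.

(** * Submodular flows with bounds *)

Section Graph.
Context (R : realType) (V A : finType) (tl hd : A -> V).
Implicit Types (x f g : A -> R) (X Y : {set V}).

Local Notation rho := (rho tl hd).
Local Notation delta := (delta tl hd).
Local Notation bd := (bd tl hd).

Definition cut x X : R := rho x X + delta x X.

Lemma rhoE x X : rho x X = \sum_e ((tl e \notin X) && (hd e \in X))%:R * x e.
Proof. by rewrite /Defs.rho big_mkcond; apply: eq_bigr => e _; case: ifP; rewrite ?mul1r ?mul0r. Qed.

Lemma deltaE x X : delta x X = \sum_e ((tl e \in X) && (hd e \notin X))%:R * x e.
Proof. by rewrite /Defs.delta big_mkcond; apply: eq_bigr => e _; case: ifP; rewrite ?mul1r ?mul0r. Qed.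

Lemma bdE x X : bd x X = \sum_e ((hd e \in X)%:R - (tl e \in X)%:R) * x e.
Proof.
rewrite /Defs.bd rhoE deltaE -sumrB; apply: eq_bigr => e _.
by case: (tl e \in X); case: (hd e \in X) => /=; ring.
Qed.

Lemma cutE x X : cut x X = \sum_e ((tl e \in X) != (hd e \in X))%:R * x e.
Proof.
rewrite /cut rhoE deltaE -big_split /=; apply: eq_bigr => e _.
by case: (tl e \in X); case: (hd e \in X) => /=; ring.
Qed.

Definition net x v : R := \sum_(e | hd e == v) x e - \sum_(e | tl e == v) x e.

(** This presents the net weight as a sum of vertex weights, the form that [scale_classes] requires:
    the number of scales then depends on the number of vertices, not of edges. *)
Lemma bd_net x X : bd x X = \sum_(v in X) net x v.
Proof.
have part (h : A -> V) : \sum_(v in X) \sum_(e | h e == v) x e = \sum_e (h e \in X)%:R * x e.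
  rewrite (exchange_big_dep predT) //=; apply: eq_bigr => e _.
  rewrite (eq_bigl (fun v => (v \in X) && (v == h e))); last by move=> v; rewrite eq_sym.
  case: (boolP (h e \in X)) => hX.
    by rewrite (big_pred1 (h e)) ?mul1r // => v /=;
      case: eqP => [->|]; rewrite ?hX ?andbF.
  rewrite big_pred0 ?mul0r // => v; case: eqP => [->|]; rewrite ?andbF //.
  by rewrite (negPf hX).
rewrite bdE /net sumrB !part -sumrB.
by apply: eq_bigr => e _; rewrite mulrBl.
Qed.

Lemma bd_modular x X Y : bd x (X :|: Y) + bd x (X :&: Y) = bd x X + bd x Y.
Proof.
rewrite !bdE -!big_split /=; apply: eq_bigr => e _; rewrite !inE.
by case: (hd e \in X); case: (hd e \in Y); case: (tl e \in X); case: (tl e \in Y) => /=; ring.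
Qed.

Lemma bd0 x : bd x set0 = 0.
Proof. by rewrite bdE big1 // => e _; rewrite !inE subrr mul0r. Qed.

Lemma bdT x : bd x setT = 0.
Proof. by rewrite bdE big1 // => e _; rewrite !inE subrr mul0r. Qed.

Lemma bdC x X : bd x (~: X) = - bd x X.
Proof.
rewrite !bdE -sumrN; apply: eq_bigr => e _; rewrite !inE.
by case: (hd e \in X); case: (tl e \in X) => /=; ring.
Qed.

(** Complementation changes the sign of [bd x], so it cannot be nonpositive on all sets without
    vanishing. Inspecting single vertices thus decides the balanced case. *)
Lemma bd_eq0 x : (forall v, net x v <= 0) -> forall X, bd x X = 0.
Proof.
move=> H X; have nonpos Y : bd x Y <= 0 by rewrite bd_net; apply: sumr_le0.
by apply/eqP; rewrite eq_le nonpos -oppr_le0 -bdC nonpos.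
Qed.

Lemma cut0 x : cut x set0 = 0.
Proof. by rewrite cutE big1 // => e _; rewrite !inE eqxx mul0r. Qed.

Lemma cutT x : cut x setT = 0.
Proof. by rewrite cutE big1 // => e _; rewrite !inE eqxx mul0r. Qed.

Section Nonneg.
Variable x : A -> R.
Hypothesis x0 : forall e, 0 < x e.

Lemma cut_submodular : submodular (cut x).
Proof.
move=> X Y; rewrite !cutE -!big_split /=; apply: ler_sum => e _; rewrite !inE.
have := x0 e.
by case: (hd e \in X); case: (hd e \in Y); case: (tl e \in X); case: (tl e \in Y) => /=; lra.
Qed.

Lemma rho_ge0 X : 0 <= rho x X.
Proof. by apply: sumr_ge0 => e _; apply: ltW. Qed.

Lemma delta_ge0 X : 0 <= delta x X.
Proof. by apply: sumr_ge0 => e _; apply: ltW. Qed.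

Lemma bd_le_cut X : `|bd x X| <= cut x X.
Proof.
have := rho_ge0 X; have := delta_ge0 X; rewrite /Defs.bd /cut ler_norml => ? ?.
by apply/andP; split; lra.
Qed.

Lemma cut_edge X e : (tl e \in X) != (hd e \in X) -> x e <= cut x X.
Proof.
move=> He; rewrite cutE (bigD1 e) //= He mul1r lerDl.
by apply: sumr_ge0 => e' _; rewrite mulr_ge0 ?ler0n // ltW.
Qed.

Lemma cut_gt0P X : reflect (exists e, (tl e \in X) != (hd e \in X)) (0 < cut x X).
Proof.
apply: (iffP idP) => [dX|[e He]]; last exact: lt_le_trans (cut_edge He).
apply: contrapT => /forallNP no; move: dX; rewrite cutE big1 ?ltxx // => e _.
by have /negP/negbTE -> := no e; rewrite mul0r.
Qed.

Lemma cut_eq0_edges X (y : A -> R) : cut x X <= 0 -> bd y X = 0.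
Proof.
move=> dX; rewrite bdE big1 // => e _.
have -> : (tl e \in X) = (hd e \in X).
  apply/eqP/negPn/negP => He; have := cut_edge He; have := x0 e; lra.
by rewrite subrr mul0r.
Qed.

(* Sets are classified by their heaviest crossing edge. *)
Lemma cut_classes : (0 < #|A|)%N -> exists cl : {set V} -> A, forall X Y,
  0 < cut x X -> 0 < cut x Y -> cl X = cl Y -> cut x X <= #|A|%:R * cut x Y.
Proof.
move=> /card_gt0P[e0 _].
have /choice[cl Hcl] : forall X, exists e, 0 < cut x X ->
    ((tl e \in X) != (hd e \in X)) /\
    (forall e', (tl e' \in X) != (hd e' \in X) -> x e' <= x e).
  move=> X; case: (boolP (0 < cut x X)) => [/cut_gt0P[e He]|_]; last by exists e0.
  have [e1 He1 Hmax] := @Order.TotalTheory.arg_maxP _ _ _ e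
    (fun e => (tl e \in X) != (hd e \in X)) x He.
  by exists e1.
exists cl => X Y dX dY E; have [_ Hmax] := Hcl _ dX; have [HY _] := Hcl _ dY.
apply: (@le_trans _ _ (#|A|%:R * x (cl Y))); last by rewrite ler_wpM2l ?ler0n ?cut_edge.
rewrite cutE mulr_natl -sumr_const; apply: ler_sum => e _.
case: (boolP (_ != _)) => He; rewrite ?mul1r ?mul0r; last exact: ltW.
by rewrite -E; apply: Hmax.
Qed.

End Nonneg.

(** Uncrossing [X] and [Y] loses at least the width of the interval of an edge that enters one set
    and leaves the other. This is what makes the two kinds of constraints on its value
    compatible. *)
Lemma slack_cross f g X Y e : (forall e, f e <= g e) ->
    (tl e \notin X) && (hd e \in X) -> (tl e \in Y) && (hd e \notin Y) ->
  g e - f e <= (delta g X - rho f X) + (delta g Y - rho f Y)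
    - (delta g (X :|: Y) - rho f (X :|: Y)) - (delta g (X :&: Y) - rho f (X :&: Y)).
Proof.
move=> fg /andP[tX hX] /andP[tY hY]; rewrite !rhoE !deltaE.
rewrite -!sumrB -!big_split /= -!sumrB (bigD1 e) //= !inE tY hX (negPf tX) (negPf hY) /=.
apply: (@le_trans _ _ (g e - f e + 0)); first by rewrite addr0.
apply: lerD; first by rewrite /=; lra.
apply: sumr_ge0 => e' _; rewrite !inE; have := fg e'.
by case: (hd e' \in X); case: (hd e' \in Y); case: (tl e' \in X); case: (tl e' \in Y) => /=; lra.
Qed.

(** * Submodular flows between edge bounds *)

Section Frank.
Variable b : {set V} -> R.
Hypothesis b_sub : submodular b.

Let ok f g := (forall e, f e <= g e) /\ forall X, rho f X - delta g X <= b X.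
Let set_at f e t : A -> R := fun e' => if e' == e then t else f e'.

Let rho_set f e t X :
  rho (set_at f e t) X = rho f X + ((tl e \notin X) && (hd e \in X))%:R * (t - f e).
Proof.
rewrite !rhoE (bigD1 e) //= [in RHS](bigD1 e) //= /set_at eqxx.
rewrite (eq_bigr (fun i => ((tl i \notin X) && (hd i \in X))%:R * f i)); first by ring.
by move=> i /negPf ->.
Qed.

Let delta_set f e t X :
  delta (set_at f e t) X = delta f X + ((tl e \in X) && (hd e \notin X))%:R * (t - f e).
Proof.
rewrite !deltaE (bigD1 e) //= [in RHS](bigD1 e) //= /set_at eqxx.
rewrite (eq_bigr (fun i => ((tl i \in X) && (hd i \notin X))%:R * f i)); first by ring.
by move=> i /negPf ->.
Qed.

(** Sets entered by [e] bound the common value from above by their slack, sets left by [e] bound it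
    from below. By [slack_cross] and submodularity of [b] no lower bound exceeds an upper one. *)
Let fix_edge f g e : ok f g ->
  exists t, f e <= t <= g e /\ ok (set_at f e t) (set_at g e t).
Proof.
move=> [fg fgb].
suff [t [/andP[t1 t2] tin tout]] : exists t, [/\ f e <= t <= g e,
    forall X, (tl e \notin X) && (hd e \in X) -> t - f e <= b X - (rho f X - delta g X)
    & forall X, (tl e \in X) && (hd e \notin X) -> g e - t <= b X - (rho f X - delta g X)].
  exists t; rewrite t1 t2; split=> //; split=> [e'|X].
    by rewrite /set_at; case: eqP.
  rewrite rho_set delta_set; have := fgb X.
  case: (boolP ((tl e \notin X) && (hd e \in X))) => H1.
    have := tin _ H1; case/andP: H1 => H1 H1'; rewrite (negPf H1) /=; lra.
  rewrite mul0r addr0; case: (boolP ((tl e \in X) && (hd e \notin X))) => H2; last by rewrite mul0r; lra.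
  rewrite mul1r; have := tout _ H2; lra.
case: (boolP [exists X : {set V}, (tl e \in X) && (hd e \notin X)]) => [/existsP[X0 HX0]|no].
  have [Y HY Hmin] := @Order.TotalTheory.arg_minP _ _ _ X0
    (fun X : {set V} => (tl e \in X) && (hd e \notin X)) (fun X => b X - (rho f X - delta g X)) HX0.
  have fge := fg e; have := fgb Y => slY.
  (* The least value in the interval that meets the tightest constraint among the sets left by
     [e]. *)
  exists (Num.max (f e) (g e - (b Y - (rho f Y - delta g Y)))); split.
  - by rewrite le_max lexx ge_max fge /=; lra.
  - move=> X HX; have H1 := slack_cross fg HX HY; have H2 := b_sub X Y.
    have H3 := fgb (X :|: Y); have H4 := fgb (X :&: Y); have H5 := fgb X.
    by rewrite lerBlDr ge_max; apply/andP; split; lra.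
  - move=> X HX; have H1 := Hmin _ HX; rewrite lerBlDr -lerBlDl le_max.
    by apply/orP; right; lra.
(* Here [e] is a loop, since otherwise its tail alone would form a set that it leaves. *)
exists (f e); rewrite lexx fg; split=> // X HX.
  by rewrite subrr subr_ge0.
by case/existsP: no; exists X.
Qed.

Lemma flow_between f g : (forall e, f e <= g e) ->
    (forall X, rho f X - delta g X <= b X) ->
  exists x, (forall e, f e <= x e <= g e) /\ forall X, bd x X <= b X.
Proof.
move=> fg fgb.
have [f' [g' [H1 H2 [_ H3]]]] : exists f' g', [/\ forall e, f e <= f' e /\ g' e <= g e,
    forall e, e \in enum A -> f' e = g' e & ok f' g'].
  elim: (enum A) => [|e s [f' [g' [H1 H2 H3]]]]; first by exists f, g.
  have [t [/andP[t1 t2] H4]] := fix_edge e H3.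
  exists (set_at f' e t), (set_at g' e t); split=> // e'; last first.
    by rewrite inE /set_at; case: eqP => //= _; apply: H2.
  rewrite /set_at; case: eqP => [->|_]; last exact: H1.
  by have [? ?] := H1 e; split; lra.
have E e : g' e = f' e by rewrite H2 ?mem_enum.
exists f'; split=> [e|X]; first by have [H4 H5] := H1 e; rewrite H4 -E.
by apply: le_trans (H3 X); rewrite (_ : g' = f') //; apply: funext.
Qed.

End Frank.
End Graph.

(** * Duality *)

Section Duality.
Context (R : realType) (n m : nat) (tl hd : 'I_m -> 'I_n) (c : 'I_m -> R)
  (b : {set 'I_n} -> int).
Hypotheses (m0 : (0 < m)%N) (c0 : forall e, 0 < c e) (b_sub : submodular b)
  (flow : exists x : 'I_m -> R, submodular_flow tl hd b x).

Let ci := cinv c.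
Let ci0 e : 0 < ci e. Proof. by rewrite invr_gt0. Qed.

Definition bR (X : {set 'I_n}) : R := (b X)%:~R.
Definition net_weight := bd tl hd (cinv c).
Definition cut_weight := cut tl hd (cinv c).

Local Notation a := net_weight.
Local Notation d := cut_weight.
Local Notation F := (pot bR a d).

Lemma bR_submodular : submodular bR.
Proof. by move=> X Y; rewrite /bR -!intrD ler_int. Qed.

Lemma cut_eq0_b X : d X <= 0 -> 0 <= bR X.
Proof.
move=> dX; have [x Hx] := flow; apply: le_trans (Hx X).
by rewrite (cut_eq0_edges ci0 x dX).
Qed.

Lemma rho_delta X : rho tl hd ci X = (d X + a X) / 2 /\ delta tl hd ci X = (d X - a X) / 2.
Proof. by rewrite /d /a /cut_weight /net_weight /cut /bd; split; field. Qed.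

Lemma max_edge_le (f : 'I_m -> R) t : (forall e, f e <= t) -> max_edge f <= t.
Proof.
move=> H; rewrite /max_edge; case: pickP => [e0 _|no]; first exact: bigmax_le.
by have := no (Ordinal m0).
Qed.

Lemma le_max_edge (f : 'I_m -> R) e : f e <= max_edge f.
Proof.
rewrite /max_edge; case: pickP => [e0 _|no]; last by have := no e.
exact: le_bigmax.
Qed.

Lemma le_min_edge (f : 'I_m -> R) t : (forall e, t <= f e) -> t <= min_edge f.
Proof.
move=> H; rewrite /min_edge; case: pickP => [e0 _|no]; first exact: le_bigmin.
by have := no (Ordinal m0).
Qed.

Lemma min_edge_le (f : 'I_m -> R) e : min_edge f <= f e.
Proof.
rewrite /min_edge; case: pickP => [e0 _|no]; last by have := no e.
exact: bigmin_le.
Qed.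

(** With edge bounds [(y - t) / c e] and [(y + t) / c e], the condition of [flow_between] at [X] is
    exactly nonnegativity of the potential. *)
Lemma feasible_flow y t : 0 <= t -> feasible bR d a y t ->
  exists2 x, submodular_flow tl hd b x & spread c x <= t + t.
Proof.
move=> t0 f.
have fg e : (y - t) * ci e <= (y + t) * ci e by rewrite ler_pM2r //; lra.
have [|x [Hx1 Hx2]] := flow_between (tl:=tl) (hd:=hd) bR_submodular fg.
  move=> X; have [E1 E2] := rho_delta X.
  have -> : rho tl hd (fun e => (y - t) * ci e) X = (y - t) * rho tl hd ci X.
    by rewrite /rho mulr_sumr.
  have -> : delta tl hd (fun e => (y + t) * ci e) X = (y + t) * delta tl hd ci X.
    by rewrite /delta mulr_sumr.
  by have := f X; rewrite /pot E1 E2; lra.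
exists x => //; rewrite /spread.
have bnd e : y - t <= c e * x e <= y + t.
  have /andP[H1 H2] := Hx1 e; rewrite -[y - t](mulfVK (x:=c e)) ?gt_eqF //.
  rewrite -[y + t](mulfVK (x:=c e)) ?gt_eqF // ![_ * c e]mulrC.
  by rewrite !ler_pM2l // H1 H2.
have H1 : max_edge (fun e => c e * x e) <= y + t.
  by apply: max_edge_le => e; case/andP: (bnd e).
have H2 : y - t <= min_edge (fun e => c e * x e).
  by apply: le_min_edge => e; case/andP: (bnd e).
lra.
Qed.

Lemma flow_feasible x : submodular_flow tl hd b x ->
  exists2 y, 0 <= spread c x / 2 & feasible bR d a y (spread c x / 2).
Proof.
move=> Hx; rewrite /spread; set M := max_edge _; set L := min_edge _.
have HM e : x e <= M * ci e.
  by rewrite /ci /cinv ler_pdivlMr // mulrC; apply: (le_max_edge (fun e => c e * x e)).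
have HL e : L * ci e <= x e.
  rewrite /ci /cinv ler_pdivrMr // [leRHS]mulrC.
  exact: (min_edge_le (fun e => c e * x e)).
(* The midpoint of the range of the weighted values serves as [y], half its length as [t]. *)
exists ((M + L) / 2).
  rewrite divr_ge0 // subr_ge0 -(ler_pM2r (ci0 (Ordinal m0))).
  exact: le_trans (HL _) (HM _).
move=> X; rewrite /pot; have [E1 E2] := rho_delta X.
have H1 : L * rho tl hd ci X <= rho tl hd x X.
  by rewrite /rho mulr_sumr; apply: ler_sum.
have H2 : delta tl hd x X <= M * delta tl hd ci X.
  by rewrite /delta mulr_sumr; apply: ler_sum.
have := Hx X; rewrite /bd -/(bR X) => H3.
rewrite E1 in H1; rewrite E2 in H2; lra.
Qed.

Lemma min_spread_feasible y t : 0 <= t -> feasible bR d a y t ->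
    (forall y' t', 0 <= t' -> feasible bR d a y' t' -> t <= t') ->
  is_min_spread tl hd c b (t + t).
Proof.
move=> t0 f opt.
have low x : submodular_flow tl hd b x -> t + t <= spread c x.
  by move=> /flow_feasible[y' s0 /(opt _ _ s0)]; lra.
split=> //; have [x Hx Hs] := feasible_flow t0 f.
by exists x => //; apply/eqP; rewrite eq_le Hs low.
Qed.

(** The combination with weights [- a Y] and [a X] eliminates [y] and is linear in [t] with the
    positive coefficient [- a Y * d X + a X * d Y]. Its root is half the dual value, so its sign
    compares [t] with that root. *)
Lemma dual_value_pot y t X Y : dual_pair tl hd c X Y ->
  (- a Y * F y t X + a X * F y t Y = 0 -> dual_value tl hd c b X Y = t + t) /\
  (0 <= - a Y * F y t X + a X * F y t Y -> dual_value tl hd c b X Y <= t + t) /\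
  (0 < - a Y * F y t X + a X * F y t Y -> dual_value tl hd c b X Y < t + t).
Proof.
move=> [aX aY dX].
have [_ EX] := rho_delta X; have [_ EY] := rho_delta Y.
have dY : 0 < d Y.
  by apply: lt_le_trans (bd_le_cut tl hd ci0 Y); rewrite normr_gt0 lt_eqF.
rewrite -/(d X) -/(a X) -/(a Y) in aX aY dX.
have den : 0 < - a Y * d X + a X * d Y.
  by rewrite ltr_pwDl ?mulr_gt0 ?oppr_gt0 // mulr_ge0 // ltW.
have E : dual_value tl hd c b X Y =
   - (2 * (- a Y * bR X + a X * bR Y)) / (- a Y * d X + a X * d Y).
  rewrite /dual_value EX EY -/(a X) -/(a Y) -/(bR X) -/(bR Y).
  have dn : - a Y * d X + a X * d Y != 0 by rewrite gt_eqF.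
  have -> : (d X - a X) / 2 * a Y - (d Y - a Y) / 2 * a X = - (- a Y * d X + a X * d Y) / 2.
    by field.
  by field.
have E2 : - a Y * F y t X + a X * F y t Y =
    (- a Y * bR X + a X * bR Y) + t * (- a Y * d X + a X * d Y).
  by rewrite /pot; ring.
rewrite E E2; split; [|split]=> H.
  have -> : - (2 * (- a Y * bR X + a X * bR Y)) = (t + t) * (- a Y * d X + a X * d Y) by lra.
  by rewrite mulfK // gt_eqF.
  by rewrite ler_pdivrMr //; lra.
by rewrite ltr_pdivrMr //; lra.
Qed.

Lemma dual_value_feasible y t X Y : feasible bR d a y t -> dual_pair tl hd c X Y ->
  dual_value tl hd c b X Y <= t + t.
Proof.
move=> f XY; have [_ [+ _]] := dual_value_pot y t XY; apply; case: XY => [aX aY dX].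
by rewrite addr_ge0 // mulr_ge0 ?oppr_ge0 ?(ltW aY).
Qed.

Lemma dual_value_tight y t X Y : dual_pair tl hd c X Y -> F y t X = 0 ->
  a X * F y t Y = 0 -> dual_value tl hd c b X Y = t + t.
Proof. by move=> XY HX HY; have [+ _] := dual_value_pot y t XY; apply; rewrite HX HY; ring. Qed.

Lemma tight_optimal y t X Y : dual_pair tl hd c X Y -> F y t X = 0 -> a X * F y t Y = 0 ->
  forall y' t', feasible bR d a y' t' -> t <= t'.
Proof.
move=> XY HX HY y' t' f; have := dual_value_feasible f XY.
by rewrite (dual_value_tight XY HX HY); lra.
Qed.

Section Eulerian.
Hypothesis a_eq0 : forall X, a X = 0.

Lemma dual_value1E X : dual_value1 tl hd c b X = 2 * (- bR X / d X).
Proof.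
have [_ EX] := rho_delta X; rewrite /dual_value1 EX a_eq0 subr0 -/(bR X).
by rewrite invfM invrK; ring.
Qed.

Lemma dual_value1_feasible y t X : feasible bR d a y t -> b X < 0 ->
  dual_value1 tl hd c b X <= t + t.
Proof.
move=> f bX; have -> : t + t = 2 * t by ring.
(* A set crossed by no edge has [b X >= 0] because a flow exists. *)
have dX : 0 < d X.
  by rewrite ltNge; apply/negP => /cut_eq0_b; rewrite /bR ler0z leNgt bX.
rewrite dual_value1E ler_pM2l // ler_pdivrMr //.
by have := f X; rewrite /pot a_eq0; lra.
Qed.

Lemma dual_value1_tight y t X : 0 < d X -> F y t X = 0 -> dual_value1 tl hd c b X = t + t.
Proof.
move=> dX; rewrite /pot a_eq0 mulr0 subr0 dual_value1E => E.
have -> : t + t = 2 * t by ring.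
have -> : - bR X = t * d X by lra.
by rewrite mulfK // gt_eqF.
Qed.

End Eulerian.
End Duality.

(** * Program logic *)

Section Logic.
Context (R : realType) (n m : nat) (tl hd : 'I_m -> 'I_n) (c : 'I_m -> R)
  (b : {set 'I_n} -> int).
Context (J : Type) (prim : J -> state R n -> state R n -> Prop).
Implicit Types (st : state R n) (p q : cmd J) (Q : state R n -> Prop).

(** Total correctness: a terminating run is exhibited, and for programs [run_deterministic] makes it
    the only one. *)
Definition wp p Q st := exists2 st', exec tl hd c b prim p st st' & Q st'.

(** One budget [B] bounds the evaluations of [b] and the minimizations separately; both counts obey
    the same final bound. *)
Definition within K B st st' :=
  [/\ (steps st' <= steps st + K)%N, (queries st' <= queries st + B)%N
    & (minims st' <= minims st + B)%N].

Lemma within_trans K1 B1 K2 B2 K B st1 st2 st3 :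
    within K1 B1 st1 st2 -> within K2 B2 st2 st3 ->
    (K1 + K2 <= K)%N -> (B1 + B2 <= B)%N ->
  within K B st1 st3.
Proof. by move=> [? ? ?] [? ? ?] ? ?; split; lia. Qed.

Lemma within_tick st : within 1 0 st (tick st).
Proof. by split=> /=; rewrite ?addn0 // addn1. Qed.

Lemma wp_mono p Q1 Q2 st : wp p Q1 st -> (forall st', Q1 st' -> Q2 st') -> wp p Q2 st.
Proof. by case=> st' H1 H2 H; exists st' => //; apply: H. Qed.

Lemma wp_skip Q st : Q (tick st) -> wp Skip Q st.
Proof. by move=> H; exists (tick st) => //; apply: ExecSkip. Qed.

Lemma wp_setN x e Q st :
  Q (tick (store_n st (neval tl hd st x) (neval tl hd st e))) -> wp (SetN x e) Q st.
Proof. by move=> H; eexists; [apply: ExecSetN|]. Qed.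

Lemma wp_setR x e Q st :
  Q (tick (store_r st (neval tl hd st x) (reval tl hd c st e))) -> wp (SetR x e) Q st.
Proof. by move=> H; eexists; [apply: ExecSetR|]. Qed.

Lemma wp_setS x e Q st :
  Q (tick (store_s st (neval tl hd st x) (seval tl hd st e))) -> wp (SetS x e) Q st.
Proof. by move=> H; eexists; [apply: ExecSetS|]. Qed.

Lemma wp_query x e Q st :
  Q (tick (count_query (store_r st (neval tl hd st x) (b (seval tl hd st e))%:~R))) ->
  wp (Query x e) Q st.
Proof. by move=> H; eexists; [apply: ExecQuery|]. Qed.

Lemma wp_seq p q Q st : wp p (wp q Q) st -> wp (Seq p q) Q st.
Proof. by case=> st1 H1 [st2 H2 H]; exists st2 => //; apply: ExecSeq H1 H2. Qed.

Lemma wp_if t p q Q st : (beval tl hd c st t -> wp p Q (tick st)) ->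
  (~~ beval tl hd c st t -> wp q Q (tick st)) -> wp (If t p q) Q st.
Proof.
case: (boolP (beval tl hd c st t)) => Ht H1 H2.
  by have [//|st' H H'] := H1; exists st' => //; apply: ExecIfTrue.
by have [//|st' H H'] := H2; exists st' => //; apply: ExecIfFalse.
Qed.

(** Termination comes from the index of the invariant: the bound [N] on [i] is where the length
    theorems about traces enter. *)
Lemma wp_while t p (Inv : nat -> state R n -> Prop) N K B st :
    (forall i st, Inv i st -> (i <= N)%N) ->
    (forall i st, Inv i st -> beval tl hd c st t ->
       wp p (fun st' => Inv i.+1 st' /\ within K B st st') (tick st)) ->
    Inv 0%N st ->
  wp (While t p) (fun st' => (exists i st1, [/\ Inv i st1, ~~ beval tl hd c st1 t &
     st' = tick st1]) /\ within (N * K).+1 (N * B) st st') st.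
Proof.
move=> bound body I0.
suff H k i st1 : Inv i st1 -> (N - i <= k)%N ->
    wp (While t p) (fun st' => (exists i st1, [/\ Inv i st1, ~~ beval tl hd c st1 t &
      st' = tick st1]) /\ within (k * K).+1 (k * B) st1 st') st1.
  by apply: (H N 0%N); rewrite ?subn0.
elim: k i st1 => [|k IH] i st1 Ii Nk.
  case: (boolP (beval tl hd c st1 t)) => Ht.
    by have [st2 _ [/bound I2 _]] := body _ _ Ii Ht; lia.
  exists (tick st1); first exact: ExecWhileFalse.
  by split; [exists i, st1|split=> /=; lia].
case: (boolP (beval tl hd c st1 t)) => Ht; last first.
  exists (tick st1); first exact: ExecWhileFalse.
  by split; [exists i, st1|split=> /=; lia].
have [st2 H2 [I2 w2]] := body _ _ Ii Ht.
have [|st3 H3 [E3 w3]] := IH _ _ I2; first by lia.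
exists st3; first exact: ExecWhileTrue H2 H3.
by split=> //; apply: within_trans w2 w3 _ _; rewrite mulSn; lia.
Qed.

End Logic.

Notation "p ;; q" := (Seq p q) (at level 60, right associativity).

Section Frames.
Context (R : realType) (n : nat).
Implicit Types st : state R n.

Definition frame (NL RL SL : seq nat) st st' :=
  [/\ forall k, k \notin NL -> nmem st' k = nmem st k,
      forall k, k \notin RL -> rmem st' k = rmem st k
    & forall k, k \notin SL -> smem st' k = smem st k].

End Frames.

(** * Evaluating sets and running Newton's method *)

(* Real registers 1 and 2 hold the current point (y, t), 3 and 4 the direction in
   which Newton's method moves it.  Set registers 0 and 1 hold the two sets sought,
   2 the argument of a minimization, and 3 the last set at which the potential
   was made zero. *)
Definition Nreg (k : nat) := NLoad (NConst k).
Definition Rreg (k : nat) := RLoad (NConst k).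
Definition Sreg (k : nat) := SLoad (NConst k).
Definition incrN (k : nat) {J} : cmd J := SetN (NConst k) (NAdd (Nreg k) (NConst 1)).
Definition putN (k : nat) (e : nexp) {J} : cmd J := SetN (NConst k) e.
Definition putR (k : nat) (e : rexp) {J} : cmd J := SetR (NConst k) e.
Definition putS (k : nat) (e : sexp) {J} : cmd J := SetS (NConst k) e.
Definition ltR (e1 e2 : rexp) : bexp := BNot (BLeR e2 e1).
Definition ltN (e1 e2 : nexp) : bexp := BNot (BLeN e2 e1).

(* Stores the net weight, the total crossing weight and the value of [b] of the
   set in register [k] in the real registers 6, 7 and 8. *)
Definition eval_edge (k : nat) {J} : cmd J :=
  If (BAnd (BMem (NTail (Nreg 0)) (Sreg k)) (BNot (BMem (NHead (Nreg 0)) (Sreg k))))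
    (putR 6 (RSub (Rreg 6) (RDiv (RConst 1) (RWeight (Nreg 0)))) ;;
     putR 7 (RAdd (Rreg 7) (RDiv (RConst 1) (RWeight (Nreg 0)))))
    (If (BAnd (BMem (NHead (Nreg 0)) (Sreg k)) (BNot (BMem (NTail (Nreg 0)) (Sreg k))))
      (putR 6 (RAdd (Rreg 6) (RDiv (RConst 1) (RWeight (Nreg 0)))) ;;
       putR 7 (RAdd (Rreg 7) (RDiv (RConst 1) (RWeight (Nreg 0)))))
      Skip).

Definition eval_set (k : nat) {J} : cmd J :=
  putN 0 (NConst 0) ;; putR 6 (RConst 0) ;; putR 7 (RConst 0) ;;
  While (ltN (Nreg 0) NEdges) (eval_edge k ;; incrN 0) ;;
  Query (NConst 8) (Sreg k).

(* The value at the set just evaluated of the potential at the point stored in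
   the real registers 1 and 2. *)
Definition pot_exp := RAdd (RSub (Rreg 8) (RMul (Rreg 1) (Rreg 6))) (RMul (Rreg 2) (Rreg 7)).

Definition sfm : program :=
  Prim (Minimize (NConst 2) (eval_set 2 ;; putR 5 pot_exp) (NConst 5)).

(** A minimization hands back only the minimizer, so its weights, its value and its slope along the
    direction are computed anew. *)
Definition look : program :=
  sfm ;; eval_set 2 ;; putR 5 pot_exp ;;
  putR 9 (RSub (RMul (Rreg 4) (Rreg 7)) (RMul (Rreg 3) (Rreg 6))).

Definition advance : program :=
  putS 3 (Sreg 2) ;; putR 16 (RDiv (Rreg 5) (Rreg 9)) ;;
  putR 1 (RSub (Rreg 1) (RMul (Rreg 16) (Rreg 3))) ;;
  putR 2 (RSub (Rreg 2) (RMul (Rreg 16) (Rreg 4))).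

(** The second guard stops at a violated set of nonpositive slope, which moving further along the
    ray cannot repair. *)
Definition newton : program :=
  look ;;
  While (BAnd (ltR (Rreg 5) (RConst 0)) (ltR (RConst 0) (Rreg 9))) (advance ;; look).

Section Programs.
Context (R : realType) (n m : nat) (tl hd : 'I_m -> 'I_n) (c : 'I_m -> R)
  (b : {set 'I_n} -> int).
Implicit Types (st : state R n).

Local Notation a := (net_weight tl hd c).
Local Notation d := (cut_weight tl hd c).
Local Notation br := (bR R b).
Local Notation F := (pot br a d).

Definition eval_cost := (10 * m + 20)%N.

Section AnyPrim.
Context (J : Type) (prim : J -> state R n -> state R n -> Prop).
Local Notation wp := (wp tl hd c b prim).

Let sum_lt (f : 'I_m -> R) (e : 'I_m) :
  \sum_(i < m | (i < e.+1)%N) f i = \sum_(i < m | (i < e)%N) f i + f e.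
Proof.
rewrite (bigD1 e) /= ?ltnSn // addrC; congr (_ + _); apply: eq_bigl => i.
by rewrite ltnS -val_eqE /= ltn_neqAle andbC.
Qed.

Lemma eval_edge_ok k (e : 'I_m) Q st : nmem st 0%N = e ->
    (forall st', frame [::] [:: 6%N; 7%N] [::] st st' ->
       rmem st' 6%N = rmem st 6%N + ((hd e \in smem st k)%:R - (tl e \in smem st k)%:R) * (c e)^-1 ->
       rmem st' 7%N = rmem st 7%N + ((tl e \in smem st k) != (hd e \in smem st k))%:R * (c e)^-1 ->
       within 5 0 st st' -> Q st') ->
  wp (eval_edge k) Q st.
Proof.
move=> He HQ.
have tailE : neval tl hd st (NTail (Nreg 0)) = tl e by rewrite /= He valK.
have headE : neval tl hd st (NHead (Nreg 0)) = hd e by rewrite /= He valK.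
have frm st' : nmem st' = nmem st -> smem st' = smem st ->
    (forall k, k \notin [:: 6%N; 7%N] -> rmem st' k = rmem st k) ->
    frame [::] [:: 6%N; 7%N] [::] st st'.
  by move=> EN ES H; split=> // j _; rewrite ?EN ?ES.
apply: wp_if => /=; rewrite !He !valK => /andP H.
  have [Et Eh] : (tl e \in smem st k) = true /\ (hd e \in smem st k) = false.
    by case: H => H1 /negPf H2; split; [exact: H1|exact: H2].
  rewrite Et Eh /= in HQ.
  apply: wp_seq; apply: wp_setR; apply: wp_setR; apply: HQ => //=.
  - apply: frm => //= i; rewrite !inE negb_or => /andP[/negPf H6 /negPf H7].
    by rewrite /upd H6 H7.
  - by rewrite /upd /= He valK; ring.
  - by rewrite /upd /= He valK; ring.
  - by split=> /=; lia.
apply: wp_if => /=; rewrite !He !valK => /andP H'.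
  have [Et Eh] : (tl e \in smem st k) = false /\ (hd e \in smem st k) = true.
    by case: H' => H1 /negPf H2; split; [exact: H2|exact: H1].
  rewrite Et Eh /= in HQ.
  apply: wp_seq; apply: wp_setR; apply: wp_setR; apply: HQ => //=.
  - apply: frm => //= i; rewrite !inE negb_or => /andP[/negPf H6 /negPf H7].
    by rewrite /upd H6 H7.
  - by rewrite /upd /= He valK; ring.
  - by rewrite /upd /= He valK; ring.
  - by split=> /=; lia.
have Eth : (hd e \in smem st k) = (tl e \in smem st k).
  by move: H H'; case: (tl e \in _); case: (hd e \in _) => //= H H'; [case: H|case: H'].
rewrite Eth in HQ; apply: wp_skip; apply: HQ => //=; rewrite ?eqxx ?subrr ?mul0r ?addr0 //.
by split=> /=; lia.
Qed.

Lemma eval_set_ok k Q st :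
    (forall st', frame [:: 0%N] [:: 6%N; 7%N; 8%N] [::] st st' ->
       rmem st' 6%N = a (smem st k) -> rmem st' 7%N = d (smem st k) ->
       rmem st' 8%N = br (smem st k) -> within eval_cost 1 st st' -> Q st') ->
  wp (eval_set k) Q st.
Proof.
move=> HQ; apply: wp_seq; apply: wp_setN; apply: wp_seq; apply: wp_setR.
apply: wp_seq; apply: wp_setR; apply: wp_seq; set st1 := tick _.
set X := smem st k.
pose ta (e : 'I_m) := ((hd e \in X)%:R - (tl e \in X)%:R) * (c e)^-1.
pose td (e : 'I_m) := ((tl e \in X) != (hd e \in X))%:R * (c e)^-1.
pose Inv i st' := [/\ nmem st' 0%N = i, (i <= m)%N,
  rmem st' 6%N = \sum_(e < m | (e < i)%N) ta e, rmem st' 7%N = \sum_(e < m | (e < i)%N) td e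
  & frame [:: 0%N] [:: 6%N; 7%N] [::] st st'].
have I0 : Inv 0%N st1.
  split=> //; rewrite /st1 /= /upd /=; try by rewrite big_pred0.
  split=> //= i; rewrite !inE /upd; first by move=> /negPf ->.
  by rewrite negb_or => /andP[/negPf -> /negPf ->].
apply: wp_mono (wp_while (N:=m) (K:=7) (B:=0) _ _ I0) _.
- by move=> i st' [].
- move=> i st' [Hi im H6 H7 [fN fR fS]] /=; rewrite Hi -ltnNge => lt.
  pose e := Ordinal lt; have SX : smem st' k = X by rewrite fS.
  apply: wp_seq; apply: (@eval_edge_ok k e) => //= st2 [gN gR gS].
  rewrite /= SX H6 H7 => E6 E7 [w1 w2 w3]; apply: wp_setN; split; last first.
    by split=> /=; move: w1 w2 w3 => /=; lia.
  rewrite /Inv /= /upd /= !gN //= Hi addn1; split=> //.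
  + by rewrite E6 (sum_lt ta e).
  + by rewrite E7 (sum_lt td e).
  split=> j.
  + by rewrite inE => H; rewrite /= /upd (negPf H) gN //= fN // inE.
  + by move=> H; rewrite gR // fR.
  + by rewrite gS // fS.
move=> st2 [[i [st3 [[Hi im H6 H7 [fN fR fS]] /= H ->]] [w1 w2 w3]]].
rewrite Hi negbK in H.
have Em : i = m by apply/eqP; rewrite eqn_leq im.
have all_lt (f : 'I_m -> R) : \sum_(e < m | (e < i)%N) f e = \sum_e f e.
  by apply: eq_bigl => e; rewrite Em ltn_ord.
apply: wp_query; apply: HQ => //=.
- split=> j.
  + by move=> Hj; rewrite /= fN.
  + rewrite !inE /= /upd => /norP[j6 /norP[j7 j8]].
    by rewrite (negPf j8) fR // !inE (negPf j6).
  + by rewrite /= fS.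
- by rewrite /upd /= H6 all_lt /net_weight bdE.
- by rewrite /upd /= H7 all_lt /cut_weight cutE.
- by rewrite /upd /= fS.
- by move: w1 w2 w3; rewrite /= muln0 => w1 w2 w3; split=> /=; rewrite /eval_cost; lia.
Qed.

End AnyPrim.

Context (M : nat -> ({set 'I_n} -> R) -> {set 'I_n}).
Hypothesis M_ok : sfm_solver M.
Local Notation wpm := (wp tl hd c b (minimize tl hd c b M)).

Lemma minimize_ok body (k j : nat) (f : {set 'I_n} -> R) K Q st :
    submodular f ->
    (forall X, wp tl hd c b (@no_prim R n) body
       (fun st' => rmem st' j = f X /\ within K 1 (store_s st k X) st') (store_s st k X)) ->
    (forall st', frame [::] [::] [:: k] st st' ->
       (forall X, f (smem st' k) <= f X) -> within K.+1 1 st st' -> Q st') ->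
  wpm (Prim (Minimize (NConst k) body (NConst j))) Q st.
Proof.
move=> f_sub Hbody HQ.
have /choice[ev Hev] : forall X, exists st', exec tl hd c b (@no_prim R n) body (store_s st k X) st' /\
    rmem st' j = f X /\ within K 1 (store_s st k X) st'.
  by move=> X; have [st' H1 H2] := Hbody X; exists st'.
eexists; first by apply: ExecPrim; apply: (@MinimizeRun _ _ _ _ _ _ _ _ _ _ _ _ ev) => X; have [] := Hev X.
have fE : (fun X => rmem (ev X) j) = f by apply: funext => X; have [_ []] := Hev X.
rewrite /= fE; apply: HQ.
- by split=> // i; rewrite inE /= /upd => /negPf ->.
- by move=> X; rewrite /= /upd eqxx; apply: M_ok.
split=> /=; last by rewrite addn1.
- rewrite addnS ltnS; apply/bigmax_leqP => X _.
  by have [_ [_ []]] := Hev X.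
- by apply/bigmax_leqP => X _; have [_ [_ []]] := Hev X.
Qed.

Hypotheses (c0 : forall e, 0 < c e) (b_sub : submodular b).

Let ci0 e : 0 < cinv c e. Proof. by rewrite invr_gt0. Qed.

Lemma F_submodular y t : 0 <= t -> submodular (F y t).
Proof.
move=> t0; apply: pot_submodular => //; first exact: bR_submodular.
  exact: cut_submodular.
exact: bd_modular.
Qed.

Lemma sfm_ok Q st : 0 <= rmem st 2%N ->
    (forall st', frame [::] [::] [:: 2%N] st st' ->
       (forall X, F (rmem st 1%N) (rmem st 2%N) (smem st' 2%N) <= F (rmem st 1%N) (rmem st 2%N) X) ->
       within (eval_cost + 2) 1 st st' -> Q st') ->
  wpm sfm Q st.
Proof.
move=> t0 HQ; apply: (minimize_ok (f:=F (rmem st 1%N) (rmem st 2%N)) (K:=eval_cost.+1)).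
- exact: F_submodular.
- move=> X; apply: wp_seq; apply: eval_set_ok => st1 [fN fR fS] E6 E7 E8 [w1 w2 w3].
  apply: wp_setR; rewrite /= /upd /= E6 E7 E8 !fR //=; split=> //.
  by move: w1 w2 w3 => /= ? ? ?; split=> /=; lia.
by move=> st' f1 f2 [w1 w2 w3]; apply: HQ => //; split; lia.
Qed.

Section Newton.
Variables (dy dt : R).
Let g X := dt * d X - dy * a X.

Definition looked st :=
  let f := F (rmem st 1%N) (rmem st 2%N) in
  [/\ forall X, f (smem st 2%N) <= f X, rmem st 5%N = f (smem st 2%N)
    & rmem st 9%N = g (smem st 2%N)].

Definition look_cost := (2 * eval_cost + 10)%N.

Lemma look_ok Q st : 0 <= rmem st 2%N -> rmem st 3%N = dy -> rmem st 4%N = dt ->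
    (forall st', frame [:: 0%N] [:: 5%N; 6%N; 7%N; 8%N; 9%N] [:: 2%N] st st' ->
       looked st' -> within look_cost 2 st st' -> Q st') ->
  wpm look Q st.
Proof.
move=> t0 E3 E4 HQ; apply: wp_seq; apply: sfm_ok => // st1 [fN fR fS] Hmin w1.
apply: wp_seq; apply: eval_set_ok => st2 [gN gR gS] E6 E7 E8 w2.
apply: wp_seq; apply: wp_setR; apply: wp_setR; apply: HQ.
- split=> k; rewrite !inE /=.
  + by move=> H; rewrite gN ?inE // fN.
  + rewrite /upd => /norP[k5 /norP[k6 /norP[k7 /norP[k8 k9]]]].
    by rewrite (negPf k5) (negPf k9) gR ?fR // !inE (negPf k6) (negPf k7) (negPf k8).
  + by move=> H; rewrite gS // fS // inE.
- by rewrite /looked /= /upd /= E6 E7 E8 !gS // !gR // !fR // E3 E4; split.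
- have w3 : within 2 0 st2 (tick (tick st2)) by split=> /=; lia.
  by move: w1 w2 => [? ? ?] [? ? ?]; split=> /=; rewrite /look_cost; lia.
Qed.

(** When no step is taken, set register 3 keeps what the caller put there; a caller that needs a
    tight set must start from one. *)
Definition hit st0 st (s : R) :=
  (s = 0 /\ smem st 3%N = smem st0 3%N) \/
  [/\ 0 < s, F (rmem st 1%N) (rmem st 2%N) (smem st 3%N) = 0 & 0 < g (smem st 3%N)].

Definition newton_post st0 st := exists2 s, 0 <= s &
  [/\ rmem st 1%N = rmem st0 1%N + s * dy, rmem st 2%N = rmem st0 2%N + s * dt,
      looked st, ~~ ((rmem st 5%N < 0) && (0 < rmem st 9%N)) & hit st0 st s].

Definition newton_cost N := (N.+1 * (look_cost + 10))%N.

Lemma newton_ok N Q st : 0 <= dt -> 0 <= rmem st 2%N -> rmem st 3%N = dy -> rmem st 4%N = dt ->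
    (forall k Z s, newton_trace br a d dy dt (rmem st 1%N) (rmem st 2%N) k Z s -> (k <= N)%N) ->
    (forall st', frame [:: 0%N] [:: 1%N; 2%N; 5%N; 6%N; 7%N; 8%N; 9%N; 16%N] [:: 2%N; 3%N] st st' ->
       newton_post st st' -> within (newton_cost N) (N.+1 * 2) st st' -> Q st') ->
  wpm newton Q st.
Proof.
move=> dt0 t0 E3 E4 bound HQ; apply: wp_seq.
apply: look_ok => // st1 [fN fR fS] L1 w1.
(* The invariant carries a Newton trace as ghost data, so that [bound] limits the iterations. *)
pose Inv k st' := exists Z s, [/\ newton_trace br a d dy dt (rmem st 1%N) (rmem st 2%N) k Z s,
  [/\ 0 <= s k, rmem st' 1%N = rmem st 1%N + s k * dy & rmem st' 2%N = rmem st 2%N + s k * dt],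
  looked st', hit st st' (s k) &
  frame [:: 0%N] [:: 1%N; 2%N; 5%N; 6%N; 7%N; 8%N; 9%N; 16%N] [:: 2%N; 3%N] st st'].
have I0 : Inv 0%N st1.
  exists (fun=> set0), (fun=> 0); split=> //.
  - by rewrite !mul0r !addr0 !fR.
  - by left; rewrite fS.
  split=> k H.
  + exact: fN.
  + apply: fR; apply: contraNN H; rewrite !inE.
    by case/or4P => [|||/orP[]] ->; rewrite ?orbT.
  + by apply: fS; apply: contraNN H; rewrite !inE => ->.
apply: wp_mono (wp_while (N:=N) (K:=(look_cost + 6)%N) (B:=2) _ _ I0) _.
- by move=> k st' [Z [s [tr _ _ _ _]]]; apply: bound tr.
- move=> k st' [Z [s [tr [s0 E1 E2] [Lmin L5 L9] _ [gN gR gS]]]] /=.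
  rewrite -!ltNge => /andP[neg pos].
  have [gZ fZ] := conj pos neg; rewrite L9 in gZ; rewrite L5 in fZ.
  set y := rmem st' 1%N in Lmin L5 fZ *; set t := rmem st' 2%N in Lmin L5 fZ *.
  set X := smem st' 2%N in Lmin L5 L9 fZ gZ.
  pose ds := - F y t X / g X.
  have ds0 : 0 < ds by rewrite divr_gt0 // oppr_gt0.
  apply: wp_seq; apply: wp_seq; apply: wp_setS; apply: wp_seq; apply: wp_setR.
  apply: wp_seq; apply: wp_setR; apply: wp_setR; set st2 := tick _.
  have E16 : rmem st' 5%N / rmem st' 9%N = - ds by rewrite L5 L9 /ds mulNr opprK.
  have R3 : rmem st' 3%N = dy by rewrite gR.
  have R4 : rmem st' 4%N = dt by rewrite gR.
  have R1 : rmem st2 1%N = y + ds * dy.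
    by rewrite /st2 /= /upd /= E16 R3 mulNr opprK.
  have R2 : rmem st2 2%N = t + ds * dt.
    by rewrite /st2 /= /upd /= E16 R4 mulNr opprK.
  have S3 : smem st2 3%N = X by rewrite /st2.
  have T0 : 0 <= rmem st2 2%N.
    rewrite R2; apply: addr_ge0; last by rewrite mulr_ge0 // ltW.
    by rewrite /t E2 addr_ge0 // mulr_ge0.
  apply: look_ok => // st3 [hN hR hS] L3 w3; split; last first.
    have w12 : within 5 0 st' st2 by rewrite /st2; split=> /=; clear; lia.
    by apply: within_trans w12 w3 _ _; rewrite // addnC leq_add2l.
  pose Z' i := if i == k then X else Z i.
  pose s' i := if i == k.+1 then s k + ds else s i.
  have s'E i : (i <= k)%N -> s' i = s i by rewrite /s'; case: eqP => // ->; rewrite ltnn.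
  have Ek1 : s' k.+1 = s k + ds by rewrite /s' eqxx.
  have E1' : rmem st3 1%N = rmem st 1%N + s' k.+1 * dy.
    by rewrite hR // R1 Ek1 /y E1; ring.
  have E2' : rmem st3 2%N = rmem st 2%N + s' k.+1 * dt.
    by rewrite hR // R2 Ek1 /t E2; ring.
  exists Z', s'; split=> //.
  + case: tr => s00 tr; split; first by rewrite s'E.
    move=> i; rewrite ltnS leq_eqVlt => /orP[/eqP ->|ik].
      rewrite Ek1 s'E // /Z' eqxx -E1 -E2 -/y -/t; split=> //.
      by rewrite /ds mulNr.
    have := tr _ ik; rewrite /Z' (ltn_eqF ik) !s'E // ltnW //.
  + by split=> //; rewrite Ek1 addr_ge0 // ltW.
  + right; split; first by rewrite Ek1 ltr_wpDl.
      rewrite (hS 3%N) // S3 hR // hR // R1 R2.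
      have -> : F (y + ds * dy) (t + ds * dt) X = F y t X + ds * g X by rewrite /pot /g; ring.
      by rewrite /ds divfK ?gt_eqF // subrr.
    by rewrite hS // S3.
  split=> j H.
  + by rewrite hN // gN.
  + have {H} := H; rewrite !inE => H; rewrite hR; last first.
      by move: H; rewrite !inE; apply: contraNN => /or4P[|||/orP[]] ->; rewrite ?orbT.
    move: H => /norP[j1 /norP[j2 /norP[j5 /norP[j6 /norP[j7 /norP[j8 /norP[j9 j16]]]]]]].
    rewrite /st2 /= /upd (negPf j1) (negPf j2) (negPf j16) gR //.
    by rewrite !inE (negPf j1) (negPf j2) (negPf j5) (negPf j6) (negPf j7) (negPf j8) (negPf j9).
  + move: H; rewrite !inE => /norP[j2 j3]; rewrite hS ?inE // /st2 /= /upd (negPf j3) gS //.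
    by rewrite !inE (negPf j2).
move=> st2 [[k [st3 [[Z [s [tr [s0 E1 E2] L H fr]]] ends ->]] w2]].
apply: HQ => //; last first.
  by apply: within_trans w1 w2 _ _; rewrite /newton_cost; move: (look_cost); clear; nia.
exists (s k) => //; split=> //.
by move: ends; rewrite /= -!ltNge.
Qed.

End Newton.
End Programs.

(** * Iteration bounds *)

(** The summand 2 makes [2 ^ log_size m] exceed [2 * m], which bounds [n] in the absence of isolated
    vertices. *)
Definition log_size (m : nat) := (trunc_log 2 m).+2.
(** Chosen as a number [S] with [(S + 2) ^ n < 2 ^ (S + 1)], the hypothesis of [scale_classes]: the
    factor [2 * log_size m + 4] is an exponent of 2 large enough to exceed [S + 1]. *)
Definition scale_count (n m : nat) := (n * (2 * log_size m + 4))%N.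
(** The exponent [r] for [kappa = 2 * m]: by [n <= 2 * m] the quantity [2 * kappa ^ 4 * n ^ 2] is at
    most [2 * (2 * m) ^ 6]. *)
Definition gap_size (m : nat) := ((6 * log_size m).+1)%N.
Definition cut_newton_bound (n m : nat) := (m * (gap_size m).+1 * (n ^ 2).+1)%N.
Definition net_newton_bound (n m : nat) := ((scale_count n m).+1 * (gap_size m).+1 * (n ^ 2).+1)%N.
Definition run_length (n m : nat) := ((scale_count n m).+1 * m * (gap_size m).+1 * (n ^ 2).+1)%N.
Definition change_count (n m : nat) :=
  (2 * (gap_size m).+1 * m * ((scale_count n m).+1 * m + (scale_count n m).+1 * m).+1 * n ^ 2)%N.
Definition kelley_bound (n m : nat) := (((change_count n m).+1 * (run_length n m).+1).+1)%N.

Lemma log_sizeP m : (2 * m < 2 ^ log_size m)%N.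
Proof. by rewrite /log_size expnS ltn_pmul2l // trunc_log_ltn. Qed.

Lemma gap_sizeP (R : realType) n m : (n <= 2 * m)%N ->
  2 * (2 * m%:R) ^+ 4 * n%:R ^+ 2 <= 2 ^+ gap_size m :> R.
Proof.
move=> nm; have -> : 2 ^+ gap_size m = (2 ^ gap_size m)%:R :> R by rewrite natrX.
have -> : 2 * (2 * m%:R) ^+ 4 * n%:R ^+ 2 = (2 * ((2 * m) ^ 4 * n ^ 2))%:R :> R.
  by rewrite (natrM R 2) (natrM R ((2 * m) ^ 4)) !(natrX R) (natrM R 2 m) mulrA.
rewrite ler_nat /gap_size [leqRHS]expnS leq_pmul2l //.
apply: (@leq_trans ((2 * m) ^ 4 * (2 * m) ^ 2)); first by rewrite leq_mul2l leq_exp2r ?nm ?orbT.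
by rewrite -expnD (mulnC 6%N) expnM leq_exp2r //; apply/ltnW/log_sizeP.
Qed.

Lemma scale_countP n m : (n <= 2 * m)%N ->
  ((scale_count n m).+2 ^ n < 2 ^ (scale_count n m).+1)%N.
Proof.
move=> nm; set k := (2 * log_size m + 4)%N; rewrite expnS /scale_count -/k [(n * k)%N]mulnC expnM.
have le : ((k * n).+2 <= 2 ^ k)%N.
  have H1 := log_sizeP m; have H2 : (log_size m < 2 ^ log_size m)%N by apply: ltn_expl.
  have -> : (2 ^ k = 16 * (2 ^ log_size m * 2 ^ log_size m))%N.
    by rewrite /k expnD mul2n -addnn expnD mulnC.
  move: H1 H2; rewrite /k; move: (2 ^ log_size m)%N (log_size m) => p l; nia.
apply: (@leq_ltn_trans ((2 ^ k) ^ n)).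
  by case: (n) le => // n' le; rewrite leq_exp2r.
by rewrite ltn_Pmull // !expn_gt0.
Qed.

Lemma card_no_isolated n m (tl hd : 'I_m -> 'I_n) : no_isolated tl hd -> (n <= 2 * m)%N.
Proof.
move=> H; rewrite -[n]card_ord -cardsT mul2n -addnn.
have -> : [set: 'I_n] = [set tl e | e in 'I_m] :|: [set hd e | e in 'I_m].
  apply/setP => v; rewrite !inE; have [e [<-|<-]] := H v.
    by rewrite imset_f.
  by rewrite [X in _ || X]imset_f ?orbT.
apply: leq_trans (leq_card_setU _ _) _; apply: leq_add.
  by apply: leq_trans (leq_imset_card _ _) _; rewrite card_ord.
by apply: leq_trans (leq_imset_card _ _) _; rewrite card_ord.
Qed.

Section Counts.
Context (R : realType) (n m : nat) (tl hd : 'I_m -> 'I_n) (c : 'I_m -> R)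
  (b : {set 'I_n} -> int).
Hypotheses (m0 : (0 < m)%N) (nm : (n <= 2 * m)%N) (c0 : forall e, 0 < c e) (b_sub : submodular b).

Local Notation a := (net_weight tl hd c).
Local Notation d := (cut_weight tl hd c).
Local Notation br := (bR R b).

Let ci0 e : 0 < cinv c e. Proof. by rewrite invr_gt0. Qed.
Let m1 : (1 : R) <= m%:R. Proof. by rewrite ler1n. Qed.

Let kappa_r : 2 * (2 * m%:R) ^+ 4 * #|'I_n|%:R ^+ 2 <= 2 ^+ gap_size m :> R.
Proof. by rewrite card_ord gap_sizeP. Qed.

Let card_gap C : (#|'I_C| * (gap_size m).+1 * (#|'I_n| ^ 2).+1 = C * (gap_size m).+1 * (n ^ 2).+1)%N.
Proof. by rewrite !card_ord. Qed.

Lemma net_classes : exists cl : {set 'I_n} -> 'I_(scale_count n m).+1,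
  forall X Y, 0 < a X -> 0 < a Y -> cl X = cl Y -> a X <= 2 * a Y.
Proof.
have [|cl Hcl] := @scale_classes R _ (net tl hd (cinv c)) (scale_count n m).
  by rewrite card_ord scale_countP.
by exists cl => X Y; rewrite /a /net_weight !bd_net; apply: Hcl.
Qed.

Lemma net_classesN : exists cl : {set 'I_n} -> 'I_(scale_count n m).+1,
  forall X Y, a X < 0 -> a Y < 0 -> cl X = cl Y -> - a X <= 2 * - a Y.
Proof.
have [|cl Hcl] := @scale_classes R _ (fun v => - net tl hd (cinv c) v) (scale_count n m).
  by rewrite card_ord scale_countP.
exists cl => X Y; rewrite /a /net_weight !bd_net -!sumrN -oppr_gt0 -[_ < 0]oppr_gt0 -!sumrN.
exact: Hcl.
Qed.

Lemma weight_classes : exists cl : {set 'I_n} -> 'I_m,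
  forall X Y, 0 < d X -> 0 < d Y -> cl X = cl Y -> d X <= m%:R * d Y.
Proof.
have [|cl Hcl] := cut_classes tl hd ci0; first by rewrite card_ord.
by exists cl => X Y dX dY E; have := Hcl X Y dX dY E; rewrite card_ord.
Qed.

Lemma cut_newton_length y0 t0 k Z s : 0 <= t0 -> newton_trace br a d 0 1 y0 t0 k Z s ->
  (k <= cut_newton_bound n m)%N.
Proof.
move=> t00 tr; have [cl Hcl] := weight_classes.
rewrite /cut_newton_bound -card_gap.
apply: (newton_trace_length (cl:=cl) (kappa:=2 * m%:R) _ _ _ _ t00 _ _ _ _ _ tr) => //.
- exact: bR_submodular.
- exact: cut_submodular.
- exact: bd_modular.
- by rewrite mul1r mul0r subr0 /cut_weight cut0.
- by rewrite mul1r mul0r subr0 /cut_weight cutT.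
- by have := m1; lra.
move=> X Y; rewrite !mul1r !mul0r !subr0 => dX dY E; apply: le_trans (Hcl _ _ dX dY E) _.
by rewrite ler_pM2r //; have := m1; lra.
Qed.

(** Along the axis [t = 0] the slope is [- (dy * a X)], so the scales of [a] or of [- a] apply
    according to the sign of [dy]. *)
Lemma net_newton_length (dy : R) y0 k Z s : `|dy| = 1 -> newton_trace br a d dy 0 y0 0 k Z s ->
  (k <= net_newton_bound n m)%N.
Proof.
move=> dy1 tr; rewrite /net_newton_bound -card_gap.
have [cl Hcl] : exists cl : {set 'I_n} -> 'I_(scale_count n m).+1,
    forall X Y, 0 < - (dy * a X) -> 0 < - (dy * a Y) -> cl X = cl Y ->
    - (dy * a X) <= 2 * - (dy * a Y).
  case: (lerP 0 dy) dy1 => dy0.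
    rewrite ger0_norm // => ->; have [cl Hcl] := net_classesN; exists cl => X Y.
    by rewrite !mul1r !oppr_gt0; apply: Hcl.
  rewrite ltr0_norm // => E; have [cl Hcl] := net_classes; exists cl => X Y.
  by rewrite -!mulNr E !mul1r; apply: Hcl.
apply: (newton_trace_length (cl:=cl) (kappa:=2 * m%:R) _ _ _ _ _ _ _ _ _ _ tr) => //.
- exact: bR_submodular.
- exact: cut_submodular.
- exact: bd_modular.
- by rewrite mul0r sub0r /net_weight bd0 mulr0 oppr0.
- by rewrite mul0r sub0r /net_weight bdT mulr0 oppr0.
- by have := m1; lra.
move=> X Y; rewrite !mul0r !sub0r => aX aY E; apply: le_trans (Hcl _ _ aX aY E) _.
by rewrite ler_pM2r //; have := m1; lra.
Qed.

Lemma kelley_length N P Q Z y v t : kelley_trace br d a N P Q Z y v t ->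
  (N <= kelley_bound n m)%N.
Proof.
move=> tr; have [cl Hcl] := net_classes; have [ncl Hncl] := net_classesN.
have [dcl Hdcl] := weight_classes.
have := kelley_trace_length (kd:=m%:R) (kappa:=2 * m%:R) (r:=gap_size m) (dcl:=dcl)
  (acl:=cl) (nacl:=ncl) _ _ _ Hdcl _ _ _ _ _ _ Hcl Hncl tr.
rewrite /kelley_bound /change_bound /run_bound !card_ord; apply => //.
- exact: bR_submodular.
- exact: cut_submodular.
- by rewrite gap_sizeP.
- exact: bd_le_cut.
- exact: bd_modular.
- exact: bd0.
- exact: bdT.
Qed.

End Counts.

(** * The program *)

Definition find_body : program :=
  putS 2 (SInsert (Nreg 1) SEmpty) ;; eval_set 2 ;;
  If (ltR (RConst 0) (Rreg 6)) (putS 0 (Sreg 2))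
    (If (ltR (Rreg 6) (RConst 0)) (putS 1 (Sreg 2)) Skip) ;;
  incrN 1.

Definition find_vertices : program := While (ltN (Nreg 1) NVerts) find_body.

Definition eulerian_case : program :=
  putR 4 (RConst 1) ;; newton ;; putR 0 (RAdd (Rreg 2) (Rreg 2)) ;; putS 0 (Sreg 3).

(** Forcing [u] in and [v] out before evaluating turns the minimization over sets separating [u]
    from [v] into an unconstrained one. Run again after the minimization, it replaces the answer by
    the separating set it stands for. *)
Definition probe_eval (u v : nexp) {J} : cmd J :=
  putS 2 (SInsert u (SRemove v (Sreg 2))) ;; eval_set 2 ;; putR 5 pot_exp.

Definition probe_pair (u v : nexp) : program :=
  If (BAnd (BLeN u v) (BLeN v u)) Skip
    (Prim (Minimize (NConst 2) (probe_eval u v) (NConst 5)) ;; probe_eval u v ;;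
     If (BLeR (Rreg 5) (RConst 0)) (putS 0 (Sreg 2)) Skip).

Definition probe_edge : program :=
  probe_pair (NTail (Nreg 1)) (NHead (Nreg 1)) ;;
  probe_pair (NHead (Nreg 1)) (NTail (Nreg 1)) ;; incrN 1.

Definition probe : program :=
  putN 1 (NConst 0) ;; While (ltN (Nreg 1) NEdges) probe_edge.

Definition max0 : rexp -> program := fun e =>
  If (BLeR (RConst 0) e) (putR 2 e) (putR 2 (RConst 0)).

(** The start is the root of the potential of the set in register [k] at height 0. That set is tight
    there, so register 3 holds a tight set even if Newton's method does not move. *)
Definition net_newton (k : nat) (dir : rexp) : program :=
  eval_set k ;; putR 1 (RDiv (Rreg 8) (Rreg 6)) ;; putR 2 (RConst 0) ;; putR 3 dir ;;
  putR 4 (RConst 0) ;; putS 3 (Sreg k) ;; newton ;; putS k (Sreg 3).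

(* Expects the ends of the zero set of T in the real registers 1 and 20. *)
Definition zero_end : program :=
  putR 0 (RConst 0) ;;
  If (BLeR (Rreg 20) (Rreg 1)) Skip
    (putR 1 (RDiv (RAdd (Rreg 1) (Rreg 20)) (RConst 2)) ;; probe).

Definition zero_case : program := net_newton 1 (RConst 1) ;; zero_end.

(** Real register 17 holds a level above the height found at [y = 0]. The search starts where the
    line of the set reaches this level; by [prime_side] the tangent found there has a slope of the
    same sign. *)
Definition prime_tangent (k : nat) : program :=
  eval_set k ;; putR 1 (RDiv (RAdd (RMul (Rreg 17) (Rreg 7)) (Rreg 8)) (Rreg 6)) ;;
  putR 2 (RConst 0) ;; newton ;; putS k (Sreg 3).

Definition prime_tangents : program :=
  putR 3 (RConst 0) ;; putR 4 (RConst 1) ;; putR 1 (RConst 0) ;; putR 2 (RConst 0) ;;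
  newton ;; putR 17 (RAdd (Rreg 2) (RConst 1)) ;; prime_tangent 0 ;; prime_tangent 1.

Definition intersect : program :=
  eval_set 0 ;; putR 10 (Rreg 6) ;; putR 11 (Rreg 7) ;; putR 12 (Rreg 8) ;; eval_set 1 ;;
  putR 18 (RDiv (RSub (RMul (Rreg 6) (Rreg 12)) (RMul (Rreg 10) (Rreg 8)))
                (RSub (RMul (Rreg 10) (Rreg 7)) (RMul (Rreg 6) (Rreg 11)))) ;;
  putR 1 (RDiv (RAdd (Rreg 12) (RMul (Rreg 18) (Rreg 11))) (Rreg 10)).

Definition finish : program := putR 0 (RAdd (Rreg 2) (Rreg 2)) ;; putN 2 (NConst 1).

(** The search stops when the point found is no higher than the intersection, both lines then being
    tight there, or when the new tangent is horizontal. *)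
Definition kelley_step : program :=
  intersect ;; max0 (Rreg 18) ;; putS 3 (Sreg 0) ;; newton ;;
  If (BLeR (Rreg 2) (Rreg 18)) finish
    (eval_set 3 ;;
     If (ltR (RConst 0) (Rreg 6)) (putS 0 (Sreg 3))
       (If (ltR (Rreg 6) (RConst 0)) (putS 1 (Sreg 3)) (putS 0 (Sreg 3) ;; finish))).

Definition kelley : program :=
  prime_tangents ;; While (ltN (Nreg 2) (NConst 1)) kelley_step.

Definition min_spread : program :=
  find_vertices ;; eval_set 0 ;;
  If (BLeR (Rreg 6) (RConst 0)) eulerian_case
    (net_newton 0 (RSub (RConst 0) (RConst 1)) ;; putR 20 (Rreg 1) ;;
     If (BLeR (RConst 0) (Rreg 5)) zero_case kelley).

(** * Correctness and cost of the program *)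

Section Correctness.
Context (R : realType) (n m : nat) (tl hd : 'I_m -> 'I_n) (c : 'I_m -> R)
  (b : {set 'I_n} -> int) (M : nat -> ({set 'I_n} -> R) -> {set 'I_n}).
Hypotheses (m0 : (0 < m)%N) (nm : (n <= 2 * m)%N) (c0 : forall e, 0 < c e)
  (b_sub : submodular b) (flow : exists x : 'I_m -> R, submodular_flow tl hd b x)
  (M_ok : sfm_solver M).
Implicit Types (st : state R n).

Local Notation a := (net_weight tl hd c).
Local Notation d := (cut_weight tl hd c).
Local Notation br := (bR R b).
Local Notation F := (pot br a d).
Local Notation wpm := (wp tl hd c b (minimize tl hd c b M)).
Local Notation E := (eval_cost m).

Let ci0 e : 0 < cinv c e. Proof. by rewrite invr_gt0. Qed.

Definition solved st := is_min_spread tl hd c b (rmem st 0%N) /\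
  dual_certificate tl hd c b (rmem st 0%N) (smem st 0%N) (smem st 1%N).

Lemma a_le_d X : `|a X| <= d X.
Proof. exact: bd_le_cut. Qed.

(** A set crossed by no edge has net 0 and, as a flow exists, [b >= 0]. Hence moving upward helps
    every violated set, and [newton_up_ok] always ends at a feasible point. *)
Lemma pot_bound y t X : F y t X < 0 -> 0 <= t -> 0 < d X.
Proof.
move=> H t0; rewrite ltNge; apply/negP => dX.
have b0 := cut_eq0_b c0 flow dX; have := a_le_d X.
have d0 : 0 <= d X by apply: le_trans (a_le_d X).
have -> : d X = 0 by apply/eqP; rewrite eq_le dX d0.
rewrite normr_le0 => /eqP aX; move: H; rewrite /pot aX; have -> : d X = 0 by apply/eqP; rewrite eq_le dX d0.
by rewrite !mulr0 subr0 addr0 ltNge b0.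
Qed.

Lemma solved_pair y t st : 0 <= t -> feasible br d a y t ->
    dual_pair tl hd c (smem st 0%N) (smem st 1%N) ->
    F y t (smem st 0%N) = 0 -> a (smem st 0%N) * F y t (smem st 1%N) = 0 ->
    rmem st 0%N = t + t ->
  solved st.
Proof.
move=> t0 f XY HX HY E0; rewrite /solved E0.
split.
  apply: (min_spread_feasible m0 c0 b_sub t0 f) => y' t' _.
  exact: (tight_optimal c0 XY HX HY).
split=> [_|H]; last by case: XY => _; rewrite H ltxx.
left; split=> //; first by rewrite (dual_value_tight c0 XY HX HY).
move=> X' Y' XY'; rewrite (dual_value_tight c0 XY HX HY).
exact: (dual_value_feasible c0 f XY').
Qed.

(** Strict positivity at height 0 on all crossing sets makes every dual value negative, the
    alternative of the formula in which no maximizing pair is asked for. *)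
Lemma solved_zero y Y st : feasible br d a y 0 -> a Y < 0 -> rmem st 0%N = 0 ->
  (forall X, 0 < d X -> 0 < F y 0 X) -> solved st.
Proof.
move=> f aY r0 pos; split.
  rewrite r0 -[0]addr0; exact: (min_spread_feasible m0 c0 b_sub (lexx 0) f).
split=> [_|H]; last by have := H Y; move: aY; rewrite /net_weight => aY H'; rewrite H' ltxx in aY.
right; split=> // X' Y' XY; have [_ [_]] := dual_value_pot b c0 y 0 XY.
rewrite addr0; apply; case: XY => [aX aY' dX].
rewrite ltr_pwDl // ?mulr_gt0 ?oppr_gt0 // ?pos //.
by rewrite mulr_ge0 // f.
Qed.

Definition cut_cost := newton_cost m (cut_newton_bound n m).
Definition cut_calls := ((cut_newton_bound n m).+1 * 2)%N.
Definition net_cost := newton_cost m (net_newton_bound n m).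
Definition net_calls := ((net_newton_bound n m).+1 * 2)%N.

Lemma newton_up_ok Q st : 0 <= rmem st 2%N -> rmem st 3%N = 0 -> rmem st 4%N = 1 ->
    (forall st', frame [:: 0%N] [:: 1%N; 2%N; 5%N; 6%N; 7%N; 8%N; 9%N; 16%N] [:: 2%N; 3%N] st st' ->
       rmem st' 1%N = rmem st 1%N -> feasible br d a (rmem st' 1%N) (rmem st' 2%N) ->
       (rmem st' 2%N = rmem st 2%N /\ smem st' 3%N = smem st 3%N) \/
       [/\ rmem st 2%N < rmem st' 2%N, F (rmem st' 1%N) (rmem st' 2%N) (smem st' 3%N) = 0
         & 0 < d (smem st' 3%N)] ->
       within cut_cost cut_calls st st' -> Q st') ->
  wpm newton Q st.
Proof.
move=> t0 E3 E4 HQ.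
apply: (newton_ok M_ok c0 b_sub (N:=cut_newton_bound n m) ler01 t0 E3 E4).
  by move=> k Z s; apply: cut_newton_length.
move=> st' fr [s s0 [E1 E2 [Lmin L5 L9] ends H]] w.
rewrite mulr0 addr0 in E1; rewrite mulr1 in E2.
apply: HQ => //.
  move=> X; apply: le_trans (Lmin X); rewrite leNgt; apply/negP => neg.
  case/negP: ends; rewrite L5 neg L9 mul1r mul0r subr0.
  by apply: pot_bound neg _; rewrite E2 addr_ge0.
case: H => [[s00 E]|[s0' onF]]; first by left; rewrite E2 s00 addr0.
by rewrite mul1r mul0r subr0 => dX; right; split=> //; rewrite E2 ltrDl.
Qed.

Lemma find_vertices_ok Q st : nmem st 1%N = 0%N -> smem st 0%N = set0 -> smem st 1%N = set0 ->
    (forall st', frame [:: 0%N; 1%N] [:: 6%N; 7%N; 8%N] [:: 0%N; 1%N; 2%N] st st' ->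
      a (smem st' 0%N) <= 0 /\ (forall X, a X = 0) \/
        0 < a (smem st' 0%N) /\ a (smem st' 1%N) < 0 ->
      within (n * (E + 10)).+1 n st st' -> Q st') ->
  wpm find_vertices Q st.
Proof.
move=> N1 S0 S1 HQ.
pose HP i (X : {set 'I_n}) := 0 < a X \/ a X <= 0 /\ forall v : 'I_n, (v < i)%N -> a [set v] <= 0.
pose HN i (X : {set 'I_n}) := a X < 0 \/ forall v : 'I_n, (v < i)%N -> 0 <= a [set v].
pose Inv i st' := [/\ nmem st' 1%N = i, (i <= n)%N, HP i (smem st' 0%N), HN i (smem st' 1%N)
  & frame [:: 0%N; 1%N] [:: 6%N; 7%N; 8%N] [:: 0%N; 1%N; 2%N] st st'].
have I0 : Inv 0%N st.
  by split=> //; [right; rewrite S0 /net_weight bd0|right].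
apply: wp_mono (wp_while (N:=n) (K:=(E + 10)%N) (B:=1) _ _ I0) _.
- by move=> i st' [].
- move=> i st' [Hi iN HPi HNi [fN fR fS]] /=; rewrite Hi -ltnNge => lt.
  pose v := Ordinal lt.
  apply: wp_seq; apply: wp_setS; apply: wp_seq; set st1 := tick _.
  have S2 : smem st1 2%N = [set v].
    by rewrite /st1 /= /upd /= Hi (_ : i = v :> nat) // valK setU0.
  apply: eval_set_ok => st2 [gN gR gS]; rewrite S2 => E6 _ _ [w1 w2 w3].
  have vlt (w : 'I_n) : (w < i.+1)%N -> w = v \/ (w < i)%N.
    rewrite ltnS leq_eqVlt => /orP[/eqP Ew|]; last by right.
    by left; apply: val_inj.
  have SS k : k != 2%N -> smem st2 k = smem st' k.
    by move=> k2; rewrite gS // /st1 /= /upd (negPf k2).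
  have S22 : smem st2 2%N = [set v] by rewrite gS.
  have keepP : a [set v] <= 0 -> HP i.+1 (smem st' 0%N).
    by move=> av; case: HPi => [|[? H]]; [left|right; split=> // w /vlt[->|/H]].
  have keepN : 0 <= a [set v] -> HN i.+1 (smem st' 1%N).
    by move=> av; case: HNi => [|H]; [left|right => w /vlt[->|/H]].
  apply: wp_seq; apply: (@wp_mono _ _ _ _ _ _ _ _ _ _ (fun st3 => [/\ nmem st3 = nmem st2,
     rmem st3 = rmem st2, HP i.+1 (smem st3 0%N) /\ HN i.+1 (smem st3 1%N),
     forall k, k \notin [:: 0%N; 1%N] -> smem st3 k = smem st2 k & within 3 0 st2 st3])).
    apply: wp_if => /=; rewrite E6.
      rewrite -ltNge => pos; apply: wp_setS; split=> //=; last by split=> /=; lia.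
        rewrite /upd /= S22 SS //; split; first by left.
        by apply: keepN; apply: ltW.
      by move=> k; rewrite !inE /upd => /norP[/negPf ->].
    rewrite negbK => npos; apply: wp_if => /=; rewrite E6.
      rewrite -ltNge => neg; apply: wp_setS; split=> //=; last by split=> /=; lia.
        by rewrite /upd /= S22 SS //; split; [apply: keepP|left].
      by move=> k; rewrite !inE /upd => /norP[_ /negPf ->].
    rewrite negbK => nneg; apply: wp_skip; split=> //=; last by split=> /=; lia.
    by rewrite !SS //; split; [apply: keepP|apply: keepN].
  move=> st3 [Hn Hr [H1 H2] H3 [v1 v2 v3]]; apply: wp_setN.
  have N1' : nmem st3 1%N = i by rewrite Hn gN.
  split; last by move: w1 w2 w3 => /= ? ? ?; split=> /=; lia.
  split=> //=; first by rewrite /upd /= N1' addn1.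
  split=> k /=.
  + rewrite !inE /= /upd => /norP[k0 k1]; rewrite (negPf k1) Hn gN ?inE // fN //.
    by rewrite !inE (negPf k0).
  + by move=> H; rewrite Hr gR // fR.
  + rewrite !inE => /norP[k0 /norP[k1 k2]].
    by rewrite H3 ?SS ?fS // !inE (negPf k0) (negPf k1).
move=> st2 [[i [st3 [[Hi iN HPi HNi fr] /= H ->]]] w].
rewrite Hi negbK in H; have {H iN} En : i = n by apply/eqP; rewrite eqn_leq iN.
have netE v : a [set v] = net tl hd (cinv c) v by rewrite /net_weight bd_net big_set1.
apply: HQ => //=; last by rewrite muln1 in w.
case: HPi => [pos|[npos H]]; last first.
  left; split=> // X; apply: bd_eq0 => v; rewrite -netE; apply: H.
  by rewrite En ltn_ord.
right; split=> //; case: HNi => // H; exfalso.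
(* A set of positive net has a complement of negative net, so some vertex has negative net. *)
have : 0 <= a (~: smem st3 0%N).
  rewrite /net_weight bd_net; apply: sumr_ge0 => v _; rewrite -netE; apply: H.
  by rewrite En ltn_ord.
by rewrite /net_weight bdC oppr_ge0 leNgt pos.
Qed.


Lemma eulerian_case_ok Q st : rmem st 1%N = 0 -> rmem st 2%N = 0 -> rmem st 3%N = 0 ->
    (forall X, a X = 0) ->
    (forall st', solved st' -> within (cut_cost + 3) cut_calls st st' -> Q st') ->
  wpm eulerian_case Q st.
Proof.
move=> E1 E2 E3 aX0 HQ; apply: wp_seq; apply: wp_setR; apply: wp_seq.
apply: newton_up_ok => //=; first by rewrite /upd /= E2.
move=> st' fr R1 f H w; apply: wp_seq; apply: wp_setR; apply: wp_setS.
apply: HQ; last by move: w => [/= ? ? ?]; split=> /=; lia.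
rewrite /solved /= /upd /=.
set y := rmem st' 1%N in f H; set t := rmem st' 2%N in f H *; set Z := smem st' 3%N in H *.
have no_pos : ~ exists U, 0 < bd tl hd (cinv c) U.
  by case=> U; have := aX0 U; rewrite /net_weight => ->; rewrite ltxx.
have Eu : upd (rmem st) 4 1 2 = 0 by rewrite /upd /= E2.
move: H; rewrite /= !Eu => -[[t0 _]|[t0 onF dZ]].
  split; first by apply: (min_spread_feasible m0 c0 b_sub _ f) => [|y' t' t'0 _]; rewrite t0.
  split=> // _; right; rewrite t0 addr0; split=> // X.
  by have := f X; rewrite /pot aX0 t0 mulr0 mul0r subr0 addr0 ler0z.
have bZ : b Z < 0.
  rewrite -(ltrz0 R) -/(bR R b Z); move: onF; rewrite /pot aX0 mulr0 subr0.
  have := mulr_gt0 t0 dZ; lra.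
split.
  apply: (min_spread_feasible m0 c0 b_sub (ltW t0) f) => y' t' t'0 f'.
  have := dual_value1_feasible c0 flow aX0 f' bZ.
  by rewrite (dual_value1_tight aX0 dZ onF); rewrite -/t; lra.
split=> // _; left; split=> //; first by rewrite (dual_value1_tight aX0 dZ onF).
move=> X' bX'; rewrite (dual_value1_tight aX0 dZ onF).
exact: (dual_value1_feasible c0 flow aX0 f bX').
Qed.

Let restr (u v : 'I_n) X := u |: (X :\ v).

Lemma restr_submodular (f : {set 'I_n} -> R) u v : submodular f -> submodular (fun X => f (restr u v X)).
Proof.
move=> fs X Y; have := fs (restr u v X) (restr u v Y).
have -> : restr u v X :|: restr u v Y = restr u v (X :|: Y).
  by apply/setP => w; rewrite !inE; case: (w == u); case: (w == v); case: (w \in X); case: (w \in Y).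
have -> // : restr u v X :&: restr u v Y = restr u v (X :&: Y).
by apply/setP => w; rewrite !inE; case: (w == u); case: (w == v); case: (w \in X); case: (w \in Y).
Qed.

Lemma restr_id u v (X : {set _}) : u \in X -> v \notin X -> restr u v X = X.
Proof.
move=> uX vX; apply/setP => w; rewrite !inE.
by case: eqP => [->|] //=; case: eqP => [->|] //=; rewrite (negPf vX).
Qed.

Definition probe_cost := (2 * E + 20)%N.

Lemma probe_pair_ok (u v : nexp) (u0 v0 : 'I_n) e Q st :
    (forall st', nmem st' 1%N = nmem st 1%N -> neval tl hd st' u = u0 /\ neval tl hd st' v = v0) ->
    (tl e, hd e) = (u0, v0) \/ (tl e, hd e) = (v0, u0) ->
    rmem st 2%N = 0 ->
    (forall st', frame [:: 0%N] [:: 5%N; 6%N; 7%N; 8%N] [:: 0%N; 2%N] st st' ->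
       (F (rmem st 1%N) 0 (smem st' 0%N) <= 0 /\ 0 < d (smem st' 0%N)) \/
       (smem st' 0%N = smem st 0%N /\
        forall X : {set _}, u0 \in X -> v0 \notin X -> 0 < F (rmem st 1%N) 0 X) ->
       within probe_cost 2 st st' -> Q st') ->
  wpm (probe_pair u v) Q st.
Proof.
move=> uv Euv t0 HQ; have [ust vst] := uv st erefl.
apply: wp_if => /=; rewrite ust vst.
  rewrite -eqn_leq => /eqP/val_inj Eu; apply: wp_skip; apply: HQ => //.
    by right; split=> // X; rewrite Eu => ->.
  by split=> /=; rewrite /probe_cost; lia.
move=> neq; have {}neq : u0 != v0 by apply: contraNneq neq => ->; rewrite leqnn.
apply: wp_seq; set st1 := tick st; set y := rmem st 1%N.
have restrE (st' : state R n) : nmem st' 1%N = nmem st 1%N ->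
    seval tl hd st' (SInsert u (SRemove v (Sreg 2))) = restr u0 v0 (smem st' 2%N).
  by move=> /uv[/= -> ->]; rewrite !valK.
have evalE J prim (Q' : state R n -> Prop) (st' : state R n) :
    nmem st' 1%N = nmem st 1%N -> rmem st' 1%N = y -> rmem st' 2%N = 0 ->
    (forall st'', frame [:: 0%N] [:: 5%N; 6%N; 7%N; 8%N] [:: 2%N] st' st'' ->
       smem st'' 2%N = restr u0 v0 (smem st' 2%N) ->
       rmem st'' 5%N = F y 0 (restr u0 v0 (smem st' 2%N)) ->
       within (E + 5) 1 st' st'' -> Q' st'') ->
    @wp R n m tl hd c b J prim (probe_eval u v) Q' st'.
  move=> Hn Hy Ht HQ'; apply: wp_seq; apply: wp_setS; rewrite restrE //; set st2 := tick _.
  have S2 : smem st2 2%N = restr u0 v0 (smem st' 2%N) by rewrite /st2 /= /upd.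
  apply: wp_seq; apply: eval_set_ok => st3 [fN fR fS] E6 E7 E8 [w1 w2 w3].
  apply: wp_setR; apply: HQ' => /=.
  - split=> k.
    + exact: fN.
    + rewrite !inE /= /upd => /norP[k5 /norP[k6 /norP[k7 k8]]].
      by rewrite (negPf k5) fR // !inE (negPf k6) (negPf k7) (negPf k8).
    + by rewrite inE /= => k2; rewrite fS // /st2 /= /upd (negPf k2).
  - by rewrite fS.
  - by rewrite /upd /= E6 E7 E8 !fR // S2 /st2 /= Hy Ht.
  - by move: w1 w2 w3; rewrite /st2 /= => ? ? ?; split=> /=; lia.
apply: (minimize_ok M_ok (f:=fun X => F y 0 (restr u0 v0 X)) (K:=(E + 5)%N)).
- by apply: restr_submodular; apply: F_submodular.
- by move=> X; apply: evalE => // st2 _ S2 R5 w; split=> //; rewrite R5.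
move=> st2 [gN gR gS] Hmin w1.
apply: wp_seq; apply: evalE; rewrite ?gN ?gR // => st3 [hN hR hS] S2 R5 w2.
set X0 := restr u0 v0 _ in S2 R5.
have {}Hmin (X : {set _}) : u0 \in X -> v0 \notin X -> F y 0 X0 <= F y 0 X.
  by move=> uX vX; have := Hmin X; rewrite (restr_id uX vX).
have crossX0 : 0 < d X0.
  apply/(cut_gt0P tl hd ci0 X0); exists e; rewrite !inE.
  have vu : v0 != u0 by rewrite eq_sym.
  by case: Euv => -[-> ->]; rewrite !eqxx !(negPf vu) /= ?orbT.
have fr0 : frame [:: 0%N] [:: 5%N; 6%N; 7%N; 8%N] [:: 0%N; 2%N] st st3.
  split=> k Hk; first by rewrite hN // gN.
    by rewrite hR // gR.
  move: Hk; rewrite !inE => /norP[k0 k2]; by rewrite hS ?gS // !inE.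
apply: wp_if => /=; rewrite R5 => Hle.
  apply: wp_setS; apply: HQ => /=.
  - case: fr0 => [f1 f2 f3]; split=> // k /=.
    by rewrite !inE /upd => /norP[k0 k2]; rewrite (negPf k0) f3 // !inE (negPf k0).
  - by left; rewrite /upd /= S2.
  - by move: w1 w2 => [/= ? ? ?] [/= ? ? ?]; split=> /=; rewrite /probe_cost; lia.
apply: wp_skip; apply: HQ => //=.
- right; split=> /=; first by rewrite hS // gS.
  by move=> X uX vX; apply: lt_le_trans (Hmin _ uX vX); rewrite ltNge.
- by move: w1 w2 => [/= ? ? ?] [/= ? ? ?]; split=> /=; rewrite /probe_cost; lia.
Qed.

Lemma probe_ok Q st : rmem st 2%N = 0 ->
    (forall st', frame [:: 0%N; 1%N] [:: 5%N; 6%N; 7%N; 8%N] [:: 0%N; 2%N] st st' ->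
       (F (rmem st 1%N) 0 (smem st' 0%N) <= 0 /\ 0 < d (smem st' 0%N)) \/
       (smem st' 0%N = smem st 0%N /\ forall X, 0 < d X -> 0 < F (rmem st 1%N) 0 X) ->
       within (m * (2 * probe_cost + 5) + 5) (m * 4) st st' -> Q st') ->
  wpm probe Q st.
Proof.
move=> t0 HQ; apply: wp_seq; apply: wp_setN; set st1 := tick _.
set y := rmem st 1%N in HQ *.
pose found (X : {set 'I_n}) := F y 0 X <= 0 /\ 0 < d X.
pose Inv i st' := [/\ nmem st' 1%N = i, (i <= m)%N, found (smem st' 0%N) \/
    (smem st' 0%N = smem st 0%N /\ forall e : 'I_m, (e < i)%N -> forall X : {set 'I_n},
       (tl e \in X) != (hd e \in X) -> 0 < F y 0 X) &
    frame [:: 0%N; 1%N] [:: 5%N; 6%N; 7%N; 8%N] [:: 0%N; 2%N] st st'].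
have I0 : Inv 0%N st1.
  split=> //; first by right.
  by split=> // k /=; rewrite !inE /upd => /norP[_ /negPf ->].
apply: wp_mono (wp_while (N:=m) (K:=(2 * probe_cost + 5)%N) (B:=4) _ _ I0) _.
- by move=> i st' [].
- move=> i st' [Hi im Hf [fN fR fS]] /=; rewrite Hi -ltnNge => lt.
  pose e := Ordinal lt.
  have tE st2 : nmem st2 1%N = i -> neval tl hd st2 (NTail (Nreg 1)) = tl e.
    by move=> /= ->; rewrite (_ : i = e :> nat) // valK.
  have hE st2 : nmem st2 1%N = i -> neval tl hd st2 (NHead (Nreg 1)) = hd e.
    by move=> /= ->; rewrite (_ : i = e :> nat) // valK.
  apply: wp_seq; apply: (@probe_pair_ok _ _ (tl e) (hd e) e).
  + by move=> st2 H; rewrite /= Hi in H; split; [exact: tE|exact: hE].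
  + by left.
  + by rewrite /= fR.
  move=> st2 [gN gR gS] H2 w2.
  apply: wp_seq; apply: (@probe_pair_ok _ _ (hd e) (tl e) e).
  + by move=> st3 H; rewrite gN //= Hi in H; split; [exact: hE|exact: tE].
  + by right.
  + by rewrite gR //= fR.
  move=> st3 [hN hR hS] H3 w3; apply: wp_setN.
  have N1 : nmem st3 1%N = i by rewrite hN // gN.
  rewrite gR //= fR // -/y in H3; rewrite /= fR // -/y in H2.
  split; last by move: w2 w3 => [/= ? ? ?] [? ? ?]; split=> /=; lia.
  split=> //=; first by rewrite /upd /= N1 addn1.
    case: H3 => [f3|[-> H3]]; first by left.
    case: H2 => [f2|[-> H2]]; first by left.
    case: Hf => [f1|[-> H1]]; [by left|right; split=> // e' He' X HX].
    move: He'; rewrite ltnS leq_eqVlt => /orP[/eqP Ee|/H1]; last exact.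
    have {}Ee : e' = e by apply: val_inj.
    rewrite {}Ee in HX; case: (boolP (tl e \in X)) HX => tX; case: (boolP (hd e \in X)) => hX // _.
      exact: H2.
    exact: H3.
  split=> k /=.
  + rewrite !inE /upd => /norP[k0 k1]; rewrite (negPf k1) hN ?gN /= ?fN //.
    * by rewrite !inE (negPf k0).
    * by rewrite inE.
    * by rewrite inE.
  + by move=> H; rewrite hR // gR //= fR.
  + by move=> H; rewrite hS // gS //= fS.
move=> st2 [[i [st3 [[Hi im Hf [fN fR fS]] /= H ->]]] w].
rewrite Hi negbK in H; have {H im} Em : i = m by apply/eqP; rewrite eqn_leq im.
apply: HQ => //=; last first.
  by move: w => [/= ? ? ?]; split=> /=; lia.
case: Hf => [f|[-> Hf]]; [by left|right; split=> // X /cut_gt0P H].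
by have [//|e He] := H; apply: (Hf e) => //; rewrite Em.
Qed.

Lemma pot_shift y y' X : F y' 0 X = F y 0 X - (y' - y) * a X.
Proof. by rewrite /pot; ring. Qed.

Lemma a_lt0_d X : a X < 0 -> 0 < d X.
Proof. exact: (left_d a_le_d). Qed.

Lemma a_gt0_d X : 0 < a X -> 0 < d X.
Proof. exact: (right_d a_le_d). Qed.

Lemma zero_end_ok Q st : rmem st 2%N = 0 ->
    feasible br d a (rmem st 1%N) 0 -> feasible br d a (rmem st 20%N) 0 ->
    F (rmem st 20%N) 0 (smem st 0%N) = 0 -> 0 < a (smem st 0%N) ->
    F (rmem st 1%N) 0 (smem st 1%N) = 0 -> a (smem st 1%N) < 0 ->
    (forall st', solved st' -> within (m * (2 * probe_cost + 5) + 10) (m * 4) st st' -> Q st') ->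
  wpm zero_end Q st.
Proof.
move=> t0 fL fU HP aP HN aN HQ; apply: wp_seq; apply: wp_setR; set st1 := tick _.
have S0 : smem st1 0%N = smem st 0%N by [].
have S1 : smem st1 1%N = smem st 1%N by [].
have le_LU : rmem st 1%N <= rmem st 20%N.
  have := fL (smem st 0%N); rewrite (pot_shift (rmem st 20%N)) HP sub0r -mulNr opprB.
  by rewrite pmulr_lge0 // subr_ge0.
apply: wp_if => /=; rewrite {1 2}/upd /= => HLU.
  have E : rmem st 20%N = rmem st 1%N by apply/eqP; rewrite eq_le HLU le_LU.
  apply: wp_skip; apply: HQ; last by split=> /=; lia.
  apply: (@solved_pair (rmem st 1%N) 0) => //=.
  - by split; [apply: ltW|exact: aN|exact: a_gt0_d].
  - by rewrite -E.
  - by rewrite HN mulr0.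
  - by rewrite /upd /= addr0.
rewrite -ltNge in HLU.
apply: wp_seq; apply: wp_setR; set st2 := tick _.
have Y2 : rmem st2 1%N = (rmem st 1%N + rmem st 20%N) / 2 by [].
have fY : feasible br d a (rmem st2 1%N) 0.
  move=> X; rewrite Y2; have := fL X; have := fU X.
  rewrite (pot_shift (rmem st 1%N)) => H1 H2.
  rewrite (pot_shift (rmem st 1%N)); lra.
apply: probe_ok; first by rewrite /st2 /= /upd /= t0.
move=> st3 [fN fR fS] Hf w; apply: HQ; last first.
  by move: w; rewrite /st2 => -[/= ? ? ?]; split=> /=; lia.
have R0 : rmem st3 0%N = 0 by rewrite fR // /st2 /=.
have S3 : smem st3 1%N = smem st 1%N by rewrite fS.
case: Hf => [[Fle dX]|[_ pos]]; last exact: (solved_zero fY aN R0).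
have F0 : F (rmem st2 1%N) 0 (smem st3 0%N) = 0 by apply/eqP; rewrite eq_le Fle fY.
(* The potential of a fixed set is affine in [y]; being nonnegative at both ends and 0 at the
   midpoint, it is constant. *)
have a0 : a (smem st3 0%N) = 0.
  have := fL (smem st3 0%N); have := fU (smem st3 0%N).
  rewrite (pot_shift (rmem st2 1%N) (rmem st 1%N)) (pot_shift (rmem st2 1%N) (rmem st 20%N)) F0 Y2.
  move: HLU; set L := rmem st 1%N; set U := rmem st 20%N; set x := a _ => LU H1 H2.
  have UL : 0 < (U - L) / 2 by lra.
  have H3 : 0 <= - ((U - L) / 2 * x) by lra.
  have H4 : 0 <= (U - L) / 2 * x by lra.
  apply/eqP; rewrite eq_le; apply/andP; split.
    by move: H3; rewrite oppr_ge0 pmulr_rle0.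
  by move: H4; rewrite pmulr_rge0.
apply: (@solved_pair (rmem st2 1%N) 0) => //.
- split; [| |exact: dX]; last by rewrite S3; exact: aN.
  by move: a0; rewrite /net_weight => ->.
- by rewrite a0 mul0r.
- by rewrite R0 addr0.
Qed.

Lemma net_newton_ok k dir (dy : R) Q st : (k == 0%N) || (k == 1%N) -> `|dy| = 1 ->
    (forall st', reval tl hd c st' dir = dy) -> 0 < - (dy * a (smem st k)) ->
    (forall st', frame [:: 0%N] [:: 1%N; 2%N; 3%N; 4%N; 5%N; 6%N; 7%N; 8%N; 9%N; 16%N] [:: k; 2%N; 3%N] st st' ->
       rmem st' 2%N = 0 -> F (rmem st' 1%N) 0 (smem st' k) = 0 -> 0 < - (dy * a (smem st' k)) ->
       (exists Z, [/\ rmem st' 5%N = F (rmem st' 1%N) 0 Z, forall X, F (rmem st' 1%N) 0 Z <= F (rmem st' 1%N) 0 X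
         & ~~ ((F (rmem st' 1%N) 0 Z < 0) && (0 < - (dy * a Z)))]) ->
       within (net_cost + E + 10) (net_calls + 1) st st' -> Q st') ->
  wpm (net_newton k dir) Q st.
Proof.
move=> k01 dy1 dirE ak HQ; have [k2 k3] : k != 2%N /\ k != 3%N by case/orP: k01 => /eqP ->.
have ak0 : a (smem st k) != 0.
  by apply: contraTneq ak => ->; rewrite mulr0 oppr0 ltxx.
apply: wp_seq; apply: eval_set_ok => st1 [fN fR fS] E6 E7 E8 w1.
apply: wp_seq; apply: wp_setR; apply: wp_seq; apply: wp_setR.
apply: wp_seq; apply: wp_setR; rewrite dirE; apply: wp_seq; apply: wp_setR.
apply: wp_seq; apply: wp_setS; set st2 := tick _.
have R1 : rmem st2 1%N = br (smem st k) / a (smem st k) by rewrite /st2 /= /upd /= E8 E6.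
have R2 : rmem st2 2%N = 0 by [].
have S3 : smem st2 3%N = smem st k by rewrite /st2 /= /upd /= fS.
have F3 : F (rmem st2 1%N) 0 (smem st k) = 0.
  by rewrite R1 /pot mul0r addr0 divfK // subrr.
have w2 : within 5 0 st1 st2 by rewrite /st2; split=> /=; clear; lia.
apply: wp_seq; apply: (newton_ok M_ok c0 b_sub (dy:=dy) (dt:=0) (N:=net_newton_bound n m)) => //.
- by move=> N Z s; rewrite R2; apply: net_newton_length.
move=> st3 [gN gR gS] [s s0 [T1 T2 [Lmin L5 L9] ends H]] w3.
rewrite R2 mulr0 addr0 in T2.
apply: wp_setS.
have [onF ak'] : F (rmem st3 1%N) 0 (smem st3 3%N) = 0 /\ 0 < - (dy * a (smem st3 3%N)).
  move: H; rewrite /hit T2 mul0r sub0r => -[[s00 ->]|[_ -> ->] //].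
  by rewrite T1 s00 mul0r addr0 S3.
apply: HQ => //=.
- split=> j /=.
  + by move=> Hj; rewrite gN // /st2 /= fN.
  + rewrite !inE => Hj; move: (Hj).
    move=> /norP[j1 /norP[j2 /norP[j3 /norP[j4 /norP[j5 /norP[j6 /norP[j7 /norP[j8 /norP[j9 j16]]]]]]]]].
    rewrite gR; last first.
      by rewrite !inE (negPf j1) (negPf j2) (negPf j5) (negPf j6) (negPf j7) (negPf j8) (negPf j9).
    rewrite /st2 /= /upd (negPf j4) (negPf j3) (negPf j2) (negPf j1) fR //.
    by rewrite !inE (negPf j6) (negPf j7).
  + rewrite !inE => /norP[jk /norP[j2 j3]].
    rewrite /upd (negPf jk) gS; last by rewrite !inE (negPf j2).
    by rewrite /st2 /= /upd (negPf j3) fS.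
- by rewrite /upd eqxx onF.
- by rewrite /upd eqxx.
- exists (smem st3 2%N); rewrite T2 in Lmin L5; split=> //.
  by move: ends; rewrite L5 L9 mul0r sub0r.
have := within_trans (within_trans w1 w2 (leqnn _) (leqnn _)) w3 (leqnn _) (leqnn _).
by case=> ? ? ?; split=> /=; rewrite /net_cost /net_calls; lia.
Qed.

Lemma zero_case_ok Q st :
    feasible br d a (rmem st 20%N) 0 ->
    F (rmem st 20%N) 0 (smem st 0%N) = 0 -> 0 < a (smem st 0%N) -> a (smem st 1%N) < 0 ->
    (forall st', solved st' ->
      within (net_cost + E + m * (2 * probe_cost + 5) + 20) (net_calls + 1 + m * 4) st st' -> Q st') ->
  wpm zero_case Q st.
Proof.
move=> fU HP aP aN HQ; apply: wp_seq; apply: (@net_newton_ok 1 (RConst 1) 1) => //.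
- by rewrite normr1.
- by rewrite mul1r oppr_gt0.
move=> st1 [fN fR fS] T2 onF; rewrite mul1r oppr_gt0 => aN' [Z [_ Zmin ends]] w1.
have S0 : smem st1 0%N = smem st 0%N by rewrite fS.
have R20 : rmem st1 20%N = rmem st 20%N by rewrite fR.
apply: zero_end_ok => //; rewrite ?S0 ?R20 //.
  (* A violated minimizer at the left end would have nonnegative net, hence be violated at the right
     end as well, which is feasible. *)
  move=> X; apply: le_trans (Zmin X); rewrite leNgt; apply/negP => neg.
  move: ends; rewrite neg mul1r oppr_gt0 /= -leNgt => aZ.
  have le_y : rmem st1 1%N <= rmem st 20%N.
    have := fU (smem st1 1%N); rewrite (pot_shift (rmem st1 1%N)) onF sub0r -mulrN.
    by rewrite pmulr_lge0 ?oppr_gt0 // subr_ge0.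
  have := fU Z; rewrite (pot_shift (rmem st1 1%N)).
  have : 0 <= (rmem st 20%N - rmem st1 1%N) * a Z by rewrite mulr_ge0 // subr_ge0.
  lra.
move=> st2 sol w2; apply: HQ => //.
by apply: within_trans w1 w2 _ _; lia.
Qed.


(* Beyond the point where the line of [X] exceeds a value [t1] attained elsewhere,
   all tangents have slopes of the sign of [a X]. *)
Lemma prime_side y y1 t1 t X Z : feasible br d a y1 t1 -> F y (t1 + 1) X = 0 -> 0 < d X ->
    feasible br d a y t -> F y t Z = 0 -> 0 < d Z -> y1 = 0 -> 0 < a X * a Z.
Proof.
move=> f1 onX dX f onZ dZ y10; rewrite y10 in f1.
have H1 := f1 X; have H2 := f1 Z; have H3 := f X.
have t_ge : t1 < t.
  have : 0 <= (t - (t1 + 1)) * d X by move: H3 onX; rewrite /pot; lra.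
  by rewrite pmulr_lge0 //; lra.
have P1 : 0 < y * a X by move: H1 onX; rewrite /pot; lra.
have P2 : 0 < y * a Z.
  have : 0 < (t - t1) * d Z by rewrite mulr_gt0 // subr_gt0.
  by move: H2 onZ; rewrite /pot; lra.
have := mulr_gt0 P1 P2; have -> : y * a X * (y * a Z) = y ^+ 2 * (a X * a Z) by ring.
by rewrite pmulr_rgt0 // exprn_even_gt0 //=; apply: contraTneq P1 => ->; rewrite mul0r ltxx.
Qed.

(** * Minimization by tangents when T is positive everywhere *)

Section Positive.
Hypothesis pos : forall y t, feasible br d a y t -> 0 < t.

Lemma prime_tangent_ok k t1 Q st : (k == 0%N) || (k == 1%N) ->
    rmem st 3%N = 0 -> rmem st 4%N = 1 -> rmem st 17%N = t1 + 1 -> feasible br d a 0 t1 ->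
    a (smem st k) != 0 ->
    (forall st', frame [:: 0%N] [:: 1%N; 2%N; 5%N; 6%N; 7%N; 8%N; 9%N; 16%N] [:: k; 2%N; 3%N] st st' ->
       tangent br d a (smem st' k) -> 0 < a (smem st k) * a (smem st' k) ->
       within (cut_cost + E + 10) (cut_calls + 1) st st' -> Q st') ->
  wpm (prime_tangent k) Q st.
Proof.
move=> k01 R3 R4 R17 f1 ak HQ; have [k2 k3] : k != 2%N /\ k != 3%N by case/orP: k01 => /eqP ->.
apply: wp_seq; apply: eval_set_ok => st1 [fN fR fS] E6 E7 E8 w1.
apply: wp_seq; apply: wp_setR; apply: wp_seq; apply: wp_setR; set st2 := tick _.
have w2 : within 2 0 st1 st2 by rewrite /st2; split=> /=; clear; lia.
have Y2 : rmem st2 1%N = ((t1 + 1) * d (smem st k) + br (smem st k)) / a (smem st k).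
  by rewrite /st2 /= /upd /= E6 E7 E8 fR // R17.
have onX : F (rmem st2 1%N) (t1 + 1) (smem st k) = 0.
  by rewrite Y2 /pot divfK //; ring.
have T2 : rmem st2 2%N = 0 by [].
have T3 : rmem st2 3%N = 0 by rewrite /st2 /= /upd /= fR.
have T4 : rmem st2 4%N = 1 by rewrite /st2 /= /upd /= fR.
apply: wp_seq; apply: newton_up_ok; rewrite ?T2 //.
move=> st3 [gN gR gS] T1 f3 H w3; apply: wp_setS.
have {H} [t3 onZ dZ] : [/\ 0 < rmem st3 2%N, F (rmem st3 1%N) (rmem st3 2%N) (smem st3 3%N) = 0
    & 0 < d (smem st3 3%N)].
  case: H => [[t30 _]|[t30 onZ dZ]]; last by split=> //; apply: pos f3.
  by have := pos f3; rewrite t30 ltxx.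
have dX : 0 < d (smem st k) by apply: (d_gt0 a_le_d).
apply: HQ => /=.
- split=> j /=.
  + by move=> Hj; rewrite gN // /st2 /= fN.
  + rewrite !inE => Hj; move: (Hj).
    move=> /norP[j1 /norP[j2 /norP[j5 /norP[j6 /norP[j7 /norP[j8 /norP[j9 j16]]]]]]].
    rewrite gR; last first.
      by rewrite !inE (negPf j1) (negPf j2) (negPf j5) (negPf j6) (negPf j7) (negPf j8) (negPf j9).
    by rewrite /st2 /= /upd (negPf j2) (negPf j1) fR // !inE (negPf j6) (negPf j7).
  + rewrite !inE => /norP[jk /norP[j2 j3]].
    by rewrite /upd (negPf jk) gS ?inE ?(negPf j2) // /st2 /= fS.
- by exists (rmem st3 1%N), (rmem st3 2%N); rewrite /upd eqxx.
- rewrite /upd eqxx; rewrite T1 in f3 onZ.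
  exact: (prime_side f1 onX dX f3 onZ dZ erefl).
have := within_trans (within_trans w1 w2 (leqnn _) (leqnn _)) w3 (leqnn _) (leqnn _).
by case=> h1 h2 h3; clear -h1 h2 h3; split=> /=; lia.
Qed.

Lemma prime_tangents_ok Q st : 0 < a (smem st 0%N) -> a (smem st 1%N) < 0 ->
    (forall st', (forall k, k != 0%N -> nmem st' k = nmem st k) ->
       rmem st' 3%N = 0 /\ rmem st' 4%N = 1 ->
       tangent br d a (smem st' 0%N) /\ 0 < a (smem st' 0%N) ->
       tangent br d a (smem st' 1%N) /\ a (smem st' 1%N) < 0 ->
       within (3 * cut_cost + 2 * E + 30) (3 * cut_calls + 2) st st' -> Q st') ->
  wpm prime_tangents Q st.
Proof.
move=> aP aN HQ.
apply: wp_seq; apply: wp_setR; apply: wp_seq; apply: wp_setR.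
apply: wp_seq; apply: wp_setR; apply: wp_seq; apply: wp_setR; set st1 := tick _.
have w1 : within 4 0 st st1 by rewrite /st1; split=> /=; clear; lia.
apply: wp_seq; apply: newton_up_ok; rewrite /st1 //.
rewrite -/st1 => st2 [fN fR fS] T1 f2 _ w2.
apply: wp_seq; apply: wp_setR; set st3 := tick _.
have R17 : rmem st3 17%N = rmem st2 2%N + 1 by [].
have f0 : feasible br d a 0 (rmem st2 2%N) by rewrite -[0](_ : rmem st1 1%N = 0) // -T1.
have S0 : smem st3 0%N = smem st 0%N by rewrite /st3 /= fS.
have S1 : smem st3 1%N = smem st 1%N by rewrite /st3 /= fS.
have R3 : rmem st3 3%N = 0 by rewrite /st3 /= /upd /= fR.
have R4 : rmem st3 4%N = 1 by rewrite /st3 /= /upd /= fR.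
have w3 : within 1 0 st2 st3 by rewrite /st3; split=> /=; clear; lia.
apply: wp_seq; apply: (prime_tangent_ok (k:=0%N) _ R3 R4 R17 f0) => //.
  by rewrite S0 gt_eqF.
move=> st4 [gN gR gS] tP; rewrite S0 pmulr_rgt0 // => aP' w4.
apply: (prime_tangent_ok (k:=1%N) _ _ _ _ f0) => //; rewrite ?gR ?gS //.
  by rewrite S1 lt_eqF.
rewrite S1 => st5 [hN hR hS] tN; rewrite nmulr_rgt0 // => aN' w5.
apply: HQ.
- by move=> k k0; rewrite hN ?gN ?inE // /st3 /= fN ?inE.
- by rewrite !hR // !gR.
- by rewrite !hS.
- by [].
have W := within_trans (within_trans (within_trans (within_trans w1 w2 (leqnn _) (leqnn _))
  w3 (leqnn _) (leqnn _)) w4 (leqnn _) (leqnn _)) w5 (leqnn _) (leqnn _).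
by case: W => h1 h2 h3; clear -h1 h2 h3; split; lia.
Qed.

Lemma intersect_ok Q st : 0 < a (smem st 0%N) -> a (smem st 1%N) < 0 ->
    (forall st', frame [:: 0%N] [:: 1%N; 6%N; 7%N; 8%N; 10%N; 11%N; 12%N; 18%N] [::] st st' ->
       F (rmem st' 1%N) (rmem st' 18%N) (smem st 0%N) = 0 ->
       F (rmem st' 1%N) (rmem st' 18%N) (smem st 1%N) = 0 ->
       within (2 * E + 10) 2 st st' -> Q st') ->
  wpm intersect Q st.
Proof.
move=> aP aN HQ.
apply: wp_seq; apply: eval_set_ok => st1 [fN fR fS] E6 E7 E8 w1.
apply: wp_seq; apply: wp_setR; apply: wp_seq; apply: wp_setR; apply: wp_seq; apply: wp_setR.
set st2 := tick _.
have w2 : within 3 0 st1 st2 by rewrite /st2; split=> /=; clear; lia.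
apply: wp_seq; apply: eval_set_ok => st3 [gN gR gS] G6 G7 G8 w3.
apply: wp_seq; apply: wp_setR; apply: wp_setR; set st4 := tick _.
have w4 : within 2 0 st3 st4 by rewrite /st4; split=> /=; clear; lia.
have R10 : rmem st3 10%N = a (smem st 0%N) by rewrite gR // /st2 /= /upd /= E6.
have R11 : rmem st3 11%N = d (smem st 0%N) by rewrite gR // /st2 /= /upd /= E7.
have R12 : rmem st3 12%N = br (smem st 0%N) by rewrite gR // /st2 /= /upd /= E8.
have S1 : smem st2 1%N = smem st 1%N by rewrite /st2 /= fS.
rewrite S1 in G6 G7 G8.
have [dP dN] := conj (a_gt0_d aP) (a_lt0_d aN).
set X := smem st 0%N in aP R10 R11 R12 dP HQ; set Y := smem st 1%N in aN S1 G6 G7 G8 dN HQ.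
have den : 0 < a X * d Y - a Y * d X.
  by rewrite addr_gt0 ?mulr_gt0 // oppr_gt0 nmulr_rlt0.
have R18 : rmem st4 18%N = (a Y * br X - a X * br Y) / (a X * d Y - a Y * d X).
  by rewrite /st4 /= /upd /= R10 R11 R12 G6 G7 G8.
have R1 : rmem st4 1%N = (br X + rmem st4 18%N * d X) / a X.
  by rewrite /st4 /= /upd /= R10 R11 R12 G6 G7 G8.
have FX : F (rmem st4 1%N) (rmem st4 18%N) X = 0.
  by rewrite R1 /pot divfK ?gt_eqF //; ring.
apply: HQ => //.
- split=> j.
  + by move=> Hj; rewrite /st4 /= gN // /st2 /= fN.
  + rewrite !inE => /norP[j1 /norP[j6 /norP[j7 /norP[j8 /norP[j10 /norP[j11 /norP[j12 j18]]]]]]].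
    rewrite /st4 /= /upd (negPf j1) (negPf j18) gR ?inE ?(negPf j6) ?(negPf j7) ?(negPf j8) //.
    by rewrite /st2 /= /upd (negPf j10) (negPf j11) (negPf j12) fR // !inE (negPf j6) (negPf j7).
  + by move=> _; rewrite /st4 /= gS // /st2 /= fS.
- apply: (mulfI (x:=a X)); first by rewrite gt_eqF.
  rewrite mulr0 -[RHS](mulr0 (a Y)) -FX; apply/eqP; rewrite -subr_eq0; apply/eqP.
  have -> : a X * F (rmem st4 1%N) (rmem st4 18%N) Y - a Y * F (rmem st4 1%N) (rmem st4 18%N) X =
    rmem st4 18%N * (a X * d Y - a Y * d X) - (a Y * br X - a X * br Y) by rewrite /pot; ring.
  by rewrite R18 divfK ?gt_eqF // subrr.
have W := within_trans (within_trans (within_trans w1 w2 (leqnn _) (leqnn _))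
  w3 (leqnn _) (leqnn _)) w4 (leqnn _) (leqnn _).
by case: W => h1 h2 h3; clear -h1 h2 h3; split; lia.
Qed.

Lemma kelley_trace_extend k P N Z (y v t : nat -> R) Z0 y0 v0 t0 :
    kelley_trace br d a k P N Z y v t ->
    F y0 v0 (P k) = 0 -> F y0 v0 (N k) = 0 -> feasible br d a y0 t0 -> F y0 t0 Z0 = 0 ->
    0 <= t0 -> v0 < t0 -> a Z0 != 0 ->
  exists P' N' Z' y' v' t', [/\ kelley_trace br d a k.+1 P' N' Z' y' v' t',
    P' k.+1 = (if 0 < a Z0 then Z0 else P k) & N' k.+1 = (if 0 < a Z0 then N k else Z0)].
Proof.
move=> [HP HN tr] onP onN f0 onZ t00 vt aZ.
pose ext T (f : nat -> T) j (x : T) i := if i == j then x else f i.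
have extE T (f : nat -> T) j x : ext T f j x j = x by rewrite /ext eqxx.
have ext_lt T (f : nat -> T) j x i : (i < j)%N -> ext T f j x i = f i.
  by move=> ij; rewrite /ext ltn_eqF.
exists (ext _ P k.+1 (if 0 < a Z0 then Z0 else P k)), (ext _ N k.+1 (if 0 < a Z0 then N k else Z0)).
exists (ext _ Z k Z0), (ext _ y k y0), (ext _ v k v0), (ext _ t k t0).
rewrite !extE; split=> //; split; rewrite ?ext_lt //.
move=> i; rewrite ltnS leq_eqVlt => /orP[/eqP ->|ik].
  rewrite !extE !ext_lt //; split=> //.
  by case: (ltrgt0P (a Z0)) aZ => //; [left|right].
have ik1 : (i < k.+1)%N by apply: ltnW.
by rewrite !ext_lt ?ltnS //; apply: tr.
Qed.

Definition step_cost := (3 * E + cut_cost + 50)%N.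

(** Natural register 2 flags completion. The concluding step adds no replacement to the trace, hence
    the successor of [kelley_bound]. *)
Let Inv k st := (rmem st 3%N = 0 /\ rmem st 4%N = 1) /\
  ([/\ nmem st 2%N = 0%N,
       exists P N Z y v t, [/\ kelley_trace br d a k P N Z y v t, smem st 0%N = P k & smem st 1%N = N k],
       0 < a (smem st 0%N) & a (smem st 1%N) < 0] \/
   [/\ nmem st 2%N = 1%N, (k <= (kelley_bound n m).+1)%N & solved st]).

Lemma kelley_step_ok k st : Inv k st -> nmem st 2%N = 0%N ->
  wpm kelley_step (fun st' => Inv k.+1 st' /\ within step_cost (cut_calls + 3) st st') (tick st).
Proof.
move=> [[R3 R4] [[_ [P [N [Z [y [v [t [tr EP EN]]]]]]] aP aN]|[-> //]]] N2.
have kb : (k.+1 <= (kelley_bound n m).+1)%N by rewrite ltnS; apply: kelley_length tr.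
apply: wp_seq; apply: intersect_ok => // st1 [fN fR fS] onP onN w1.
rewrite /= in onP onN; set v0 := rmem st1 18%N in onP onN; set y0 := rmem st1 1%N in onP onN.
apply: wp_seq; apply: (@wp_mono _ _ _ _ _ _ _ _ _ _ (fun st2 => [/\ nmem st2 = nmem st1,
   smem st2 = smem st1, forall j, j != 2%N -> rmem st2 j = rmem st1 j,
   0 <= rmem st2 2%N /\ (rmem st2 2%N = v0 \/ rmem st2 2%N = 0 /\ v0 < 0) & within 3 0 st1 st2])).
  apply: wp_if => /= Hv; apply: wp_setR; split=> //=; try by [split=> /=; lia];
    try by move=> j /negPf; rewrite /upd => ->.
    by rewrite /upd /=; split=> //; left.
  by rewrite /upd /=; split=> //; right; rewrite ltNge.
move=> st2 [gN gS gR [T0 Tv] w2].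
apply: wp_seq; apply: wp_setS; apply: wp_seq; set st3 := tick _.
have w3 : within 1 0 st2 st3 by rewrite /st3; split=> /=; clear; lia.
have E33 : rmem st3 3%N = 0 by rewrite /st3 /= gR // fR.
have E34 : rmem st3 4%N = 1 by rewrite /st3 /= gR // fR.
apply: newton_up_ok => // st4 [hN hR hS] Y4 f4 H w4.
have E32 : rmem st3 2%N = rmem st2 2%N by [].
rewrite E32 in H.
have {}Y4 : rmem st4 1%N = y0 by rewrite Y4 /st3 /= gR.
rewrite Y4 in f4 H; set t0 := rmem st4 2%N in f4 H.
have t0_gt0 : 0 < t0 by apply: pos f4.
have v_le_T : v0 <= rmem st2 2%N by case: Tv => [->|[-> /ltW]].
have T_le_t : rmem st2 2%N <= t0 by case: H => [[-> _]|[/ltW]].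
have R18 : rmem st4 18%N = v0 by rewrite hR //= gR.
have S0 : smem st4 0%N = smem st 0%N by rewrite hS //= /upd /= gS fS.
have S1 : smem st4 1%N = smem st 1%N by rewrite hS //= /upd /= gS fS.
have N4 : nmem st4 2%N = 0%N by rewrite hN // /st3 /= gN fN.
have [R43 R44] : rmem st4 3%N = 0 /\ rmem st4 4%N = 1 by rewrite !hR //= !gR // !fR.
have W4 : within (2 * E + 16 + cut_cost) (cut_calls + 2) st st4.
  have W := within_trans (within_trans (within_trans w1 w2 (leqnn _) (leqnn _))
     w3 (leqnn _) (leqnn _)) w4 (leqnn _) (leqnn _).
  by case: W => [/= h1 h2 h3]; clear -h1 h2 h3; split; lia.
have done_ok st5 : rmem st5 2%N = t0 ->
    rmem st5 3%N = 0 /\ rmem st5 4%N = 1 ->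
    dual_pair tl hd c (smem st5 0%N) (smem st5 1%N) ->
    F y0 t0 (smem st5 0%N) = 0 -> a (smem st5 0%N) * F y0 t0 (smem st5 1%N) = 0 ->
    within (step_cost - 5) (cut_calls + 3) st st5 ->
    wpm finish (fun st' => Inv k.+1 st' /\ within step_cost (cut_calls + 3) st st') st5.
  move=> r2 [r3 r4] XY H1 H2 w; apply: wp_seq; apply: wp_setR; apply: wp_setN; split.
    split=> //; right; split=> //.
    apply: (@solved_pair y0 t0) => //=; first exact: ltW.
    by rewrite /upd /= r2.
  by move: w; rewrite /step_cost => -[/= h1 h2 h3]; clear -h1 h2 h3; split=> /=; lia.
apply: wp_if => /=; rewrite R18 => Hle.
  have Ev : t0 = v0 by apply/eqP; rewrite eq_le Hle (le_trans v_le_T).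
  apply: done_ok => //=; rewrite ?S0 ?S1 ?Ev ?onP ?onN ?mulr0 //.
    by split; [apply: ltW|exact: aN|exact: a_gt0_d].
  by move: W4; rewrite /step_cost => -[/= h1 h2 h3]; clear -h1 h2 h3; split=> /=; lia.
have lt_vt : v0 < t0 by rewrite ltNge.
(* Had Newton's method not moved, [t0] would be [v0] or 0, contradicting the failed test or the
   positivity of T. *)
have {H} [onZ dZ] : F y0 t0 (smem st4 3%N) = 0 /\ 0 < d (smem st4 3%N).
  case: H => [[Et _]|[_ -> ->] //].
  case: Tv => [Ev|[E0 _]]; first by move: lt_vt; rewrite Et Ev ltxx.
  by move: t0_gt0; rewrite Et E0 ltxx.
apply: wp_seq; apply: eval_set_ok => st5 [iN iR iS] E6 _ _ w5.
rewrite /= in E6 iR iS; set Z0 := smem st4 3%N in onZ dZ E6.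
have W5 : within (3 * E + 17 + cut_cost) (cut_calls + 3) st st5.
  by move: W4 w5 => [h1 h2 h3] [/= h4 h5 h6]; clear -h1 h2 h3 h4 h5 h6; split; lia.
have N5 : nmem st5 2%N = 0%N by rewrite iN.
have [R53 R54] : rmem st5 3%N = 0 /\ rmem st5 4%N = 1 by rewrite !iR.
have extend : a Z0 != 0 -> exists P' N' Z' y' v' t', [/\ kelley_trace br d a k.+1 P' N' Z' y' v' t',
    P' k.+1 = (if 0 < a Z0 then Z0 else P k) & N' k.+1 = (if 0 < a Z0 then N k else Z0)].
  rewrite EP in onP; rewrite EN in onN => aZ.
  exact: (kelley_trace_extend tr onP onN f4 onZ (ltW t0_gt0) lt_vt aZ).
apply: wp_if => /=; rewrite E6.
  rewrite -ltNge => aZ; apply: wp_setS.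
  have [|P' [N' [Z' [y' [v' [t' [tr' EP' EN']]]]]]] := extend; first by rewrite gt_eqF.
  rewrite aZ in EP' EN'; split; last first.
    by move: W5; rewrite /step_cost => -[/= h1 h2 h3]; clear -h1 h2 h3; split=> /=; lia.
  split=> //; left; rewrite /= /upd /= !iS // S1; split=> //.
  by exists P', N', Z', y', v', t'; rewrite EP' EN' EN.
rewrite negbK => aZ1; apply: wp_if => /=; rewrite E6.
  rewrite -ltNge => aZ; apply: wp_setS.
  have [|P' [N' [Z' [y' [v' [t' [tr' EP' EN']]]]]]] := extend; first by rewrite lt_eqF.
  rewrite ltNge aZ1 /= in EP' EN'; split; last first.
    by move: W5; rewrite /step_cost => -[/= h1 h2 h3]; clear -h1 h2 h3; split=> /=; lia.
  split=> //; left; rewrite /= /upd /= !iS // S0; split=> //.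
  by exists P', N', Z', y', v', t'; rewrite EP' EN' EP.
(* A horizontal tangent certifies optimality alone: the factor [a Z0 = 0] removes any condition of
   tightness on its partner of negative net. *)
rewrite negbK => aZ2; have aZ : a Z0 = 0 by apply/eqP; rewrite eq_le aZ1.
apply: wp_seq; apply: wp_setS; apply: done_ok => //=; rewrite /upd /= ?iS //.
- by rewrite iR.
- split; [|by rewrite S1; exact: aN|exact: dZ].
  by move: aZ; rewrite /net_weight => ->.
- by rewrite -/Z0 aZ mul0r.
by move: W5; rewrite /step_cost => -[/= h1 h2 h3]; clear -h1 h2 h3; split=> /=; lia.
Qed.

Definition kelley_cost := (3 * cut_cost + 2 * E + 31 + (kelley_bound n m).+1 * step_cost)%N.
Definition kelley_calls := (3 * cut_calls + 2 + (kelley_bound n m).+1 * (cut_calls + 3))%N.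

Lemma kelley_ok Q st : nmem st 2%N = 0%N -> 0 < a (smem st 0%N) -> a (smem st 1%N) < 0 ->
    (forall st', solved st' -> within kelley_cost kelley_calls st st' -> Q st') ->
  wpm kelley Q st.
Proof.
move=> N2 aP aN HQ; apply: wp_seq; apply: prime_tangents_ok => // st1 hN R34 tP tN w1.
have I0 : Inv 0%N st1.
  split=> //; left; case: tP tN => tP aP' [tN aN']; split=> //; first by rewrite hN.
  by exists (fun=> smem st1 0%N), (fun=> smem st1 1%N), (fun=> set0), (fun=> 0), (fun=> 0), (fun=> 0).
apply: wp_mono (wp_while (N:=(kelley_bound n m).+1) (K:=step_cost) (B:=(cut_calls + 3)%N) _ _ I0) _.
- move=> k st2 [_ [[_ [P [N [Z [y [v [t [tr _ _]]]]]]] _ _]|[]//]].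
  exact: leqW (kelley_length m0 nm c0 b_sub tr).
- move=> k st2 Ik /= Hlt; apply: kelley_step_ok => //.
  by move: Hlt; rewrite -ltnNge ltnS leqn0 => /eqP.
move=> st2 [[k [st3 [[_ Ik] /= Hge ->]]] w2]; rewrite negbK in Hge.
case: Ik => [[H0]|[_ _ sol]]; first by rewrite H0 in Hge.
apply: HQ => //; have [h1 h2 h3] := within_trans w1 w2 (leqnn _) (leqnn _).
rewrite /kelley_cost /kelley_calls; clear -h1 h2 h3; split; lia.
Qed.

End Positive.

Definition spread_cost :=
  (n * (E + 10) + 2 * net_cost + 3 * E + m * (2 * probe_cost + 5) + kelley_cost + cut_cost + 50)%N.
Definition spread_calls := (n + 2 * net_calls + 4 * m + kelley_calls + cut_calls + 3)%N.

Lemma min_spread_ok : wpm min_spread (fun st =>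
  solved st /\ within spread_cost spread_calls (init_state R n) st) (init_state R n).
Proof.
set st0 := init_state R n; apply: wp_seq; apply: find_vertices_ok => // st1 [fN fR fS] Ha w1.
have {fN fR fS} [N2 [R1 R2 R3]] : nmem st1 2%N = 0%N /\ [/\ rmem st1 1%N = 0, rmem st1 2%N = 0 & rmem st1 3%N = 0].
  by rewrite fN // !fR.
apply: wp_seq; apply: eval_set_ok => st2 [gN gR gS] E6 _ _ w2.
have {w1 w2} w2 : within (n * (E + 10) + E + 1) (n + 1) st0 st2.
  by have [h1 h2 h3] := within_trans w1 w2 (leqnn _) (leqnn _); clear -h1 h2 h3; split; lia.
apply: wp_if => /=; rewrite E6 => Hle.
  case: Ha => [[_ a0]|[aP _]]; last by move: Hle; rewrite leNgt aP.
  apply: eulerian_case_ok => //=; rewrite ?gR // => st3 sol [/= h1 h2 h3]; split=> //.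
  move: w2 => [h4 h5 h6]; rewrite /spread_cost /spread_calls.
  clear -h1 h2 h3 h4 h5 h6; split; lia.
case: Ha => [[aP _]|[aP aN]]; first by rewrite aP in Hle.
have dirE st : reval tl hd c st (RSub (RConst 0) (RConst 1)) = -1 by rewrite /= sub0r.
apply: wp_seq; apply: (@net_newton_ok 0 _ (-1)) => //.
- by rewrite normrN normr1.
- by rewrite mulN1r opprK /= gS.
move=> st3 [hN hR hS] T2 onF; rewrite mulN1r opprK => aP3 [Z [R5 Zmin ends]] w3.
rewrite mulN1r opprK in ends.
apply: wp_seq; apply: wp_setR; set st4 := tick _.
have w4 : within (n * (E + 10) + net_cost + E + E + 13) (n + net_calls + 2) st0 st4.
  have w34 : within 1 0 st3 st4 by rewrite /st4; split=> /=; clear; lia.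
  have [h1 h2 h3] := within_trans (within_trans (within_trans w2 (within_tick st2) (leqnn _) (leqnn _))
    w3 (leqnn _) (leqnn _)) w34 (leqnn _) (leqnn _).
  by clear -h1 h2 h3; split; lia.
have w45 := within_trans w4 (within_tick st4) (leqnn _) (leqnn _).
have S1 : smem st4 1%N = smem st1 1%N by rewrite /st4 /= hS //= gS.
apply: wp_if => /=; rewrite {1}/upd /= R5 => Hge.
  apply: zero_case_ok => //=; rewrite ?S1 //.
  - by rewrite /upd /= => X; apply: le_trans (Zmin X).
  move=> st5 sol w5; split=> //.
  have [h1 h2 h3] := within_trans w45 w5 (leqnn _) (leqnn _); rewrite /spread_cost /spread_calls.
  by clear -h1 h2 h3; split; lia.
have Zneg : F (rmem st3 1%N) 0 Z < 0 by rewrite ltNge.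
have aZ : a Z <= 0 by rewrite leNgt; move: ends; rewrite Zneg.
(* To the right of the current abscissa the tight set of positive net is violated at height 0; at
   the abscissa and to its left [Z] is, since its net is nonpositive. So T has no zero. *)
have pos y t : feasible br d a y t -> 0 < t.
  move=> f; rewrite ltNge; apply/negP => t0.
  have f0 : feasible br d a y 0.
    move=> X; apply: le_trans (f X) _; rewrite /pot lerD2l ler_wpM2r //.
    exact: le_trans (a_le_d X).
  case: (ltrP (rmem st3 1%N) y) => Hy.
    have := f0 (smem st3 0%N); rewrite (pot_shift (rmem st3 1%N)) onF sub0r oppr_ge0.
    by rewrite pmulr_lle0 // subr_le0 leNgt Hy.
  have := f0 Z; rewrite (pot_shift (rmem st3 1%N)) => H.
  have : 0 <= (y - rmem st3 1%N) * a Z by rewrite mulr_le0 // subr_le0.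
  lra.
apply: (kelley_ok pos) => //=.
- by rewrite hN // gN.
- by rewrite hS //= gS.
move=> st5 sol w5; split=> //.
have [h1 h2 h3] := within_trans w45 w5 (leqnn _) (leqnn _); rewrite /spread_cost /spread_calls.
by clear -h1 h2 h3; split; lia.
Qed.

End Correctness.

(** * Growth of the bounds *)

Section Monomials.
Local Open Scope nat_scope.

Definition order_bounded (i j k : nat) (f : nat -> nat -> nat) := exists C, forall n m,
  0 < n -> 0 < m -> f n m <= C * (log_size m ^ i * m ^ j * n ^ k).

Lemma order_add i j k f g : order_bounded i j k f -> order_bounded i j k g ->
  order_bounded i j k (fun n m => f n m + g n m).
Proof.
move=> [C HC] [D HD]; exists (C + D) => n m n0 m0.
by rewrite mulnDl leq_add // ?HC ?HD.
Qed.

Lemma order_mul i j k i' j' k' f g : order_bounded i j k f -> order_bounded i' j' k' g ->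
  order_bounded (i + i') (j + j') (k + k') (fun n m => f n m * g n m).
Proof.
move=> [C HC] [D HD]; exists (C * D) => n m n0 m0.
apply: leq_trans (leq_mul (HC _ _ n0 m0) (HD _ _ n0 m0)) _.
by rewrite !expnD leq_eqVlt; apply/orP; left; apply/eqP; ring.
Qed.

Lemma order_weaken i' j' k' i j k f : order_bounded i' j' k' f ->
  i' <= i -> j' <= j -> k' <= k -> order_bounded i j k f.
Proof.
move=> [C HC] Hi Hj Hk; exists C => n m n0 m0; apply: leq_trans (HC _ _ n0 m0) _.
by rewrite leq_mul2l !leq_mul ?orbT // leq_pexp2l.
Qed.

Lemma order_const i j k c : order_bounded i j k (fun _ _ => c).
Proof.
by exists c => n m n0 m0; rewrite leq_pmulr // !muln_gt0 !expn_gt0 n0 m0.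
Qed.

Lemma order_n : order_bounded 0 0 1 (fun n _ => n).
Proof. by exists 1 => n m _ _; rewrite !mul1n. Qed.

Lemma order_m : order_bounded 0 1 0 (fun _ m => m).
Proof. by exists 1 => n m _ _; rewrite !mul1n muln1. Qed.

Lemma order_log : order_bounded 1 0 0 (fun _ m => log_size m).
Proof. by exists 1 => n m _ _; rewrite !muln1 mul1n. Qed.

Lemma order_succ i j k f : order_bounded i j k f -> order_bounded i j k (fun n m => (f n m).+1).
Proof.
move=> Hf; have [C HC] := order_add Hf (order_const i j k 1); exists C => n m n0 m0.
by rewrite -addn1 HC.
Qed.

Lemma order_scale_count : order_bounded 1 0 1 scale_count.
Proof.
have H : order_bounded 1 0 0 (fun _ m => 2 * log_size m + 4).
  by apply: order_add; [apply: (order_mul (order_const 0 0 0 2) order_log)|apply: order_const].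
exact: (order_mul order_n H).
Qed.

Lemma order_gap_size : order_bounded 1 0 0 (fun _ m => (gap_size m).+1).
Proof. by do 2!apply: order_succ; apply: (order_mul (order_const 0 0 0 6) order_log). Qed.

Lemma order_square : order_bounded 0 0 2 (fun n _ => (n ^ 2).+1).
Proof.
apply: order_succ; have [C HC] := order_mul order_n order_n; exists C => n m n0 m0.
by rewrite -mulnn; apply: HC.
Qed.

Lemma order_cut_newton : order_bounded 1 1 2 cut_newton_bound.
Proof. exact: (order_mul (order_mul order_m order_gap_size) order_square). Qed.

Lemma order_net_newton : order_bounded 2 0 3 net_newton_bound.
Proof.
exact: (order_mul (order_mul (order_succ order_scale_count) order_gap_size) order_square).
Qed.

Lemma order_run_length : order_bounded 2 1 3 run_length.
Proof.
exact: (order_mul (order_mul (order_mul (order_succ order_scale_count) order_m)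
  order_gap_size) order_square).
Qed.

Lemma order_change_count : order_bounded 2 2 3 change_count.
Proof.
have H := order_mul (order_succ order_scale_count) order_m.
have H2 : order_bounded 0 0 2 (fun n _ => n ^ 2).
  by exists 1 => n m _ _; rewrite !mul1n.
exact: (order_mul (order_mul (order_mul (order_mul (order_const 0 0 0 2) order_gap_size) order_m)
  (order_succ (order_add H H))) H2).
Qed.

Lemma order_kelley : order_bounded 4 3 6 kelley_bound.
Proof.
apply: order_succ.
exact: (order_mul (order_succ order_change_count) (order_succ order_run_length)).
Qed.

Lemma order_cut_calls : order_bounded 1 1 2 cut_calls.
Proof. exact: (order_mul (order_succ order_cut_newton) (order_const 0 0 0 2)). Qed.

(** The tangent phase dominates: its iteration count has exponents 4, 3, 6, and each iteration runs
    a vertical Newton search with exponents 1, 1, 2. *)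
Lemma order_spread_calls : order_bounded 5 4 8 spread_calls.
Proof.
have Hc := order_cut_calls.
have Hc' : order_bounded 5 4 8 cut_calls by apply: order_weaken Hc _ _ _.
apply: order_add; last exact: order_const.
apply: order_add; last exact: Hc'.
apply: order_add; last first.
  apply: order_add; last first.
    exact: (order_mul (order_succ order_kelley) (order_add Hc (order_const 1 1 2 3))).
  apply: order_add; last exact: order_const.
  exact: (order_mul (order_const 0 0 0 3) (order_weaken Hc (i:=5) (j:=4) (k:=8) isT isT isT)).
apply: order_add; last first.
  exact: (order_mul (order_const 0 0 0 4) (order_weaken order_m (i:=5) (j:=4) (k:=8) isT isT isT)).
apply: order_add; first exact: (order_weaken order_n).
by apply: (order_weaken (order_mul (order_const 0 0 0 2)
  (order_mul (order_succ order_net_newton) (order_const 0 0 0 2)))).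
Qed.

Definition poly_bounded f := exists k, order_bounded k k k f.

Lemma poly_of_order i j k f : order_bounded i j k f -> poly_bounded f.
Proof. by move=> H; exists (i + j + k); apply: order_weaken H _ _ _; lia. Qed.

Lemma poly_add f g : poly_bounded f -> poly_bounded g -> poly_bounded (fun n m => f n m + g n m).
Proof.
move=> [k Hk] [l Hl]; exists (k + l).
by apply: order_add; [apply: order_weaken Hk _ _ _|apply: order_weaken Hl _ _ _]; lia.
Qed.

Lemma poly_mul f g : poly_bounded f -> poly_bounded g -> poly_bounded (fun n m => f n m * g n m).
Proof. by move=> [k Hk] [l Hl]; exists (k + l); apply: order_mul. Qed.

Lemma poly_const c : poly_bounded (fun _ _ => c).
Proof. exact: poly_of_order (order_const 0 0 0 c). Qed.

Lemma poly_succ f : poly_bounded f -> poly_bounded (fun n m => (f n m).+1).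
Proof. by move=> [k Hk]; exists k; apply: order_succ. Qed.

Lemma poly_spread_cost : poly_bounded spread_cost.
Proof.
have Pn := poly_of_order order_n; have Pm := poly_of_order order_m.
have PE : poly_bounded (fun _ m => eval_cost m).
  by apply: poly_add (poly_const 20); apply: poly_mul (poly_const 10) Pm.
have PEx c k : poly_bounded (fun _ m => c * eval_cost m + k).
  by apply: poly_add (poly_const k); apply: poly_mul (poly_const c) PE.
have Pnewton f : poly_bounded f -> poly_bounded (fun n m => newton_cost m (f n m)).
  move=> Pf; apply: poly_mul (poly_succ Pf) _; apply: poly_add (poly_const 10); exact: PEx.
have Pcut : poly_bounded cut_cost := Pnewton _ (poly_of_order order_cut_newton).
have Pnet : poly_bounded net_cost := Pnewton _ (poly_of_order order_net_newton).
have Pstep : poly_bounded step_cost.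
  by apply: poly_add (poly_const 50); apply: poly_add Pcut; apply: poly_mul (poly_const 3) PE.
have Pkelley : poly_bounded kelley_cost.
  apply: poly_add; last exact: poly_mul (poly_succ (poly_of_order order_kelley)) Pstep.
  apply: poly_add (poly_const 31); apply: poly_add; last exact: poly_mul (poly_const 2) PE.
  exact: poly_mul (poly_const 3) Pcut.
apply: poly_add (poly_const 50); apply: poly_add Pcut; apply: poly_add Pkelley.
apply: poly_add; last first.
  apply: poly_mul Pm _; apply: poly_add (poly_const 5); apply: poly_mul (poly_const 2) _.
  exact: PEx.
apply: poly_add; last exact: poly_mul (poly_const 3) PE.
apply: poly_add; last exact: poly_mul (poly_const 2) Pnet.
by apply: poly_mul Pn _; apply: poly_add PE (poly_const 10).
Qed.

Lemma poly_bound f : poly_bounded f -> exists D d, forall n m, 0 < n -> 0 < m ->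
  f n m <= D * (n + m) ^ d.
Proof.
move=> [k [C HC]]; exists (C * 3 ^ k), (k * 3) => n m n0 m0.
apply: leq_trans (HC _ _ n0 m0) _; rewrite -[leqRHS]mulnA leq_mul2l; apply/orP; right.
have Hlog : log_size m <= 3 * (n + m).
  have : trunc_log 2 m < m.
    by apply: leq_trans (trunc_logP (isT : 1 < 2) m0); apply: ltn_expl.
  rewrite /log_size; lia.
have -> : 3 ^ k * (n + m) ^ (k * 3) = (3 * (n + m)) ^ k * (n + m) ^ k * (n + m) ^ k.
  by rewrite expnMn expnM !expnS expn0; ring.
have mono x y : x <= y -> x ^ k <= y ^ k by case: (k) => // k'; rewrite leq_exp2r.
by rewrite !leq_mul // mono ?leq_addl ?leq_addr.
Qed.

End Monomials.

(** For [m >= 2] the two extra units of [log_size] at most triple the binary logarithm, and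
    [ln 2 >= 1 / 2] doubles the factor to 6. *)
Lemma log_size_ln (R : realType) m : (1 < m)%N -> (log_size m)%:R <= 6 * ln (m%:R : R).
Proof.
move=> m1; have m0 : (0 < m)%N by apply: ltnW.
have ln2 : 2^-1 <= ln (2 : R).
  have := @le_ln1Dx R (- 2^-1); have -> : 1 + - 2^-1 = 2^-1 :> R by field.
  by rewrite lnV ?posrE // lerN2; apply; lra.
have t1 : (1 <= trunc_log 2 m)%N by rewrite trunc_log_gt0 m1.
have H1 : (trunc_log 2 m)%:R * ln (2 : R) <= ln (m%:R).
  rewrite mulr_natl -lnXn // ler_ln ?posrE ?exprn_gt0 ?ltr0n //.
  by rewrite -natrX ler_nat trunc_logP.
have H2 : (log_size m)%:R <= 3 * (trunc_log 2 m)%:R :> R.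
  by rewrite -natrM ler_nat /log_size; lia.
have H3 : (trunc_log 2 m)%:R * 2^-1 <= ln (m%:R : R).
  by apply: le_trans H1; rewrite ler_wpM2l.
lra.
Qed.

(** Two of the eight factors [n] are traded for [2 * m], which yields [m ^ 6] and the constant 4;
    the constant [6 ^ 6] comes from [log_size_ln]. The case [m = 1] is excluded because [ln 1 = 0]
    makes the bound vanish. *)
Lemma spread_calls_bound : exists C : nat, forall (R : realType) n m, (0 < n)%N -> (1 < m)%N ->
  (n <= 2 * m)%N -> (spread_calls n m)%:R <= C%:R * sfm_bound R n m.
Proof.
have [C HC] := order_spread_calls; exists (C * 4 * 6 ^ 6)%N => R n m n0 m1 nm.
have m0 : (0 < m)%N by apply: ltnW.
have H1 : (spread_calls n m <= C * 4 * (n ^ 4 * m ^ 6 * log_size m ^ 6 * n ^ 2))%N.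
  apply: leq_trans (HC _ _ n0 m0) _; rewrite -[leqRHS]mulnA leq_mul2l; apply/orP; right.
  have E : (log_size m ^ 5 * m ^ 4 * n ^ 8 = n ^ 2 * (log_size m ^ 5 * m ^ 4 * n ^ 6))%N.
    by rewrite (expnD n 2 6); ring.
  have E2 : (4 * (n ^ 4 * m ^ 6 * log_size m ^ 6 * n ^ 2) =
     (2 * m) ^ 2 * (log_size m ^ 5 * m ^ 4 * n ^ 6) * log_size m)%N by ring.
  rewrite E E2; apply: leq_trans (leq_pmulr _ _) => //.
  by rewrite leq_mul2r leq_exp2r // nm orbT.
have lnm : 0 <= ln (m%:R : R) by rewrite ln_ge0 // ler1n.
have H2 : (log_size m)%:R ^+ 6 <= 6 ^+ 6 * ln (m%:R : R) ^+ 6.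
  rewrite -exprMn; apply: lerXn2r; rewrite ?nnegrE ?ler0n ?mulr_ge0 //.
  exact: log_size_ln.
apply: (@le_trans _ _ ((C * 4 * (n ^ 4 * m ^ 6 * log_size m ^ 6 * n ^ 2))%N%:R)).
  by rewrite ler_nat.
have -> : (C * 4 * (n ^ 4 * m ^ 6 * log_size m ^ 6 * n ^ 2))%N%:R =
    C%:R * 4%:R * (n%:R ^+ 4 * m%:R ^+ 6 * (log_size m)%:R ^+ 6 * n%:R ^+ 2) :> R.
  by rewrite -!natrX -!natrM.
have -> : (C * 4 * 6 ^ 6)%N%:R = C%:R * 4%:R * 6%:R ^+ 6 :> R by rewrite -!natrX -!natrM.
rewrite /sfm_bound.
have P1 : 0 <= C%:R * 4%:R * (n%:R ^+ 4 * m%:R ^+ 6) :> R by rewrite !mulr_ge0 // exprn_ge0.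
apply: (@le_trans _ _ (C%:R * 4%:R * (n%:R ^+ 4 * m%:R ^+ 6) * ((6 ^+ 6 * ln m%:R ^+ 6) * n%:R ^+ 2))).
  have -> : C%:R * 4%:R * (n%:R ^+ 4 * m%:R ^+ 6 * (log_size m)%:R ^+ 6 * n%:R ^+ 2) =
    C%:R * 4%:R * (n%:R ^+ 4 * m%:R ^+ 6) * ((log_size m)%:R ^+ 6 * n%:R ^+ 2) :> R by ring.
  by apply: ler_wpM2l => //; apply: ler_wpM2r; rewrite ?exprn_ge0.
have -> : C%:R * 4 * 6 ^+ 6 * (n%:R ^+ 4 * m%:R ^+ 6 * ln m%:R ^+ 6 * (n%:R ^+ 2 + m%:R * ln m%:R ^+ 2)) =
  C%:R * 4%:R * (n%:R ^+ 4 * m%:R ^+ 6) * ((6 ^+ 6 * ln m%:R ^+ 6) * (n%:R ^+ 2 + m%:R * ln m%:R ^+ 2)) :> R.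
  by ring.
apply: ler_wpM2l => //; apply: ler_wpM2l; first by rewrite mulr_ge0 // exprn_ge0.
by rewrite lerDl mulr_ge0 // exprn_ge0.
Qed.

Theorem theorem4p20 :
  exists (P : program) (C D d : nat),
  forall (R : realType) (n m : nat) (tl hd : 'I_m -> 'I_n) (c : 'I_m -> R)
    (b : {set 'I_n} -> int) (M : nat -> ({set 'I_n} -> R) -> {set 'I_n}),
    (0 < m)%N ->
    no_isolated tl hd ->
    (forall e : 'I_m, 0 < c e) ->
    submodular b ->
    (exists x : 'I_m -> R, submodular_flow tl hd b x) ->
    sfm_solver M ->
    exists st : state R n,
      [/\ run tl hd c b M P (init_state R n) st,
          is_min_spread tl hd c b (rmem st 0%N),
          dual_certificate tl hd c b (rmem st 0%N) (smem st 0%N) (smem st 1%N),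
          (1 < m)%N ->
            (minims st)%:R <= C%:R * sfm_bound R n m /\
            (queries st)%:R <= C%:R * sfm_bound R n m
        & (steps st <= D * (n + m) ^ d)%N].
Proof.
have [C HC] := spread_calls_bound; have [D [d HD]] := poly_bound poly_spread_cost.
exists min_spread, C, D, d => R n m tl hd c b M m0 iso c0 b_sub flow M_ok.
have nm := card_no_isolated iso.
have n0 : (0 < n)%N by apply: leq_ltn_trans (ltn_ord (tl (Ordinal m0))).
have [st Hrun [[Hs Hd] [w1 w2 w3]]] := min_spread_ok m0 nm c0 b_sub flow M_ok.
exists st; split=> //; last exact: leq_trans w1 (HD _ _ n0 m0).
by move=> m1; split; apply: le_trans (HC R _ _ n0 m1 nm); rewrite ler_nat.
Qed.
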